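(* Let $G \subset \mathbb{C}$ be a simply connected domain and let $(\varphi_n)_{n\in\mathbb{N}}$ be a strongly frequently runaway sequence of univalent holomorphic self-maps $\varphi_n : G \to G$. Then the sequence of composition operators $(C_{\varphi_n})_n$ is frequently hypercyclic on $H(G)$; in other words, the set $FHC((C_{\varphi_n})_n)$ is not empty.
   Context: $\mathbb{N}=\{1,2,3,\dots\}$. A domain is a nonempty connected open subset of $\mathbb{C}$; a domain $G$ (possibly $G=\mathbb{C}$) is simply connected if $\mathbb{C}_\infty\setminus G$ is connected, where $\mathbb{C}_\infty=\mathbb{C}\cup\{\infty\}$ is the one-point compactification of $\mathbb{C}$. $H(G)$ is the space of holomorphic functions $G\to\mathbb{C}$ with the topology of uniform convergence on compact subsets of $G$. For a holomorphic map $\varphi:G\to G$, the composition operator is $C_\varphi: H(G)\to H(G)$, $C_\varphi f = f\circ\varphi$. Univalent means one-to-one. For $A\subset\mathbb{N}$, the lower density is $\underline{\rm dens}(A)=\liminf_{n\to\infty}\frac{{\rm card}(A\cap\{1,\dots,n\})}{n}$. For a sequence $(T_n)_n$ of continuous linear maps $X\to Y$ between topological vector spaces, a vector $x_0\in X$ is frequently hypercyclic for $(T_n)_n$ if $\underline{\rm dens}(\{n\in\mathbb{N}: T_n x_0\in V\})>0$ for every nonempty open set $V\subset Y$; $FHC((T_n)_n)$ is the set of such vectors, and $(T_n)_n$ is frequently hypercyclic if $FHC((T_n)_n)\neq\varnothing$. A sequence $(K_\nu)_{\nu\in\mathbb{N}}$ of compact subsets of $G$ is exhaustive if $G=\bigcup_{\nu}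 K_\nu$ and $K_\nu$ is contained in the interior of $K_{\nu+1}$ for all $\nu$. $\mathcal{M}(G)$ is the family of compact sets $K\subset G$ such that $\mathbb{C}\setminus K$ is connected. A sequence $(\varphi_n)_n$ of holomorphic self-maps of $G$ is strongly frequently runaway if there exist an exhaustive sequence $(K_\nu)_{\nu}\subset\mathcal{M}(G)$ and a family $\{A(\nu):\nu\in\mathbb{N}\}$ of subsets of $\mathbb{N}$ such that: (P1) $\underline{\rm dens}(A(\nu))>0$ for all $\nu\in\mathbb{N}$; (P2) the sets $A(\nu)$ ($\nu\in\mathbb{N}$) are pairwise disjoint, and the sets $\varphi_n(K_\nu)$ ($\nu\in\mathbb{N}$, $n\in A(\nu)$) are pairwise disjoint (i.e. sets corresponding to different indices $\nu$, respectively to different index pairs $(n,\nu)$, are disjoint); (P3) for every compact $K\subset G$ there are only finitely many pairs $(n,\nu)$ with $\nu\in\mathbb{N}$, $n\in A(\nu)$ and $K\cap\varphi_n(K_\nu)\neq\varnothing$. *)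

(* Defs.v *)
From HB Require Import structures.
From mathcomp Require Import all_boot all_order all_algebra finmap complex.
From mathcomp Require Import all_classical all_reals all_analysis.

Set Implicit Arguments.
Unset Strict Implicit.
Unset Printing Implicit Defensive.

Import Order.TTheory GRing.Theory Num.Theory.
Import numFieldNormedType.Exports.

Local Open Scope classical_set_scope.
Local Open Scope ring_scope.

(* [R[i]] has no topology of its own in the library: the regular module [R[i]^o]
   carries the one induced by the modulus, and [derivable _ z 1] on it is
   complex differentiability at [z]. *)
Notation Cplx R := (R[i])^o.

Record domain (R : realType) := Domain {
  domain_set :> set (Cplx R);
  domain_nonempty : domain_set !=set0;
  domain_open : open domain_set;
  domain_connected : connected domain_set }.

Definition simply_connected (R : realType) (G : set (Cplx R)) : Prop :=
  connected (~` (Some @` G) : set (one_point_compactification (Cplx R))).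

(* Functions on [G] are functions on the subtype [set_type G], which carries the
   subspace topology.  As [G] is open, the value 0 given off [G] by [valL_] does
   not affect differentiability at points of [G]. *)
Definition holomorphic (R : realType) (G : domain R) (f : G -> Cplx R) : Prop :=
  forall z : G, derivable (valL_ (0 : Cplx R) f) (\val z) 1.

(* [{family compact, G -> C}] is the topology of uniform convergence on compact
   subsets of [G]; the subtype gets the subspace topology. *)
Definition hol_space (R : realType) (G : domain R) : Type :=
  [set f : {family compact, G -> Cplx R} | holomorphic f].
HB.instance Definition _ (R : realType) (G : domain R) :=
  Topological.copy (hol_space G)
    [set f : {family compact, G -> Cplx R} | holomorphic f].

Record hol_selfmap (R : realType) (G : domain R) := HolSelfmap {
  selfmap_fun :> G -> G;
  selfmap_hol : holomorphic (fun z => \val (selfmap_fun z)) }.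

Lemma holomorphic_comp (R : realType) (G : domain R) (phi : hol_selfmap G)
  (f : G -> Cplx R) : holomorphic f -> holomorphic (f \o phi).
Proof.
move=> hf z.
have Gz : domain_set G (\val z) by apply: set_mem; exact: (valP z).
have gE (g : G -> Cplx R) (x : G) : valL_ (0 : Cplx R) g (\val x) = g x.
  exact: (congr1 (@^~ x) (valLK (0 : Cplx R) g)).
pose psi := valL_ (0 : Cplx R) (fun w => \val (phi w)).
have psiE : psi (\val z) = \val (phi z) by exact: gE.
apply: (@near_eq_derivable _ _ _ (valL_ (0 : Cplx R) f \o psi)).
  near=> w.
  have Gw : domain_set G w by near: w; apply: open_nbhs_nbhs; split => //; exact: domain_open.
  pose w' : G := SigSub (mem_set Gw).
  have psiw : psi w = \val (phi w') by exact: (gE _ w').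
  rewrite /= psiw; exact: etrans (gE f (phi w')) (esym (gE (f \o phi) w')).
apply: diff_derivable; apply: differentiable_comp.
  exact/derivable1_diffP/selfmap_hol.
by rewrite psiE; exact/derivable1_diffP/hf.
Unshelve. all: by end_near. Qed.

Definition comp_op (R : realType) (G : domain R) (phi : hol_selfmap G)
    (f : hol_space G) : hol_space G :=
  SigSub (mem_set (holomorphic_comp (phi := phi) (set_mem (valP f)))).

(* Sequences indexed by the positive integers are functions on [nat] whose value
   at 0 is never used; the value 0/0 = 0 at [n = 0] does not affect the liminf. *)
Definition lower_density (R : realType) (A : set nat) : \bar R :=
  limn_einf (fun n : nat =>
    (#|` fset_set (A `&` [set k | (1 <= k <= n)%N])|%:R / n%:R)%:E).

Definition FHC (R : realType) (X Y : topologicalType) (T : nat -> X -> Y) :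
    set X :=
  [set x0 | forall V : set Y, open V -> V !=set0 ->
     (0 < lower_density R [set n | (0 < n)%N /\ V (T n x0)])%E].

Definition frequently_hypercyclic (R : realType) (X Y : topologicalType)
    (T : nat -> X -> Y) : Prop :=
  FHC R T !=set0.

Definition exhaustive (T : topologicalType) (K : nat -> set T) : Prop :=
  [/\ forall nu, compact (K nu),
      \bigcup_nu K nu = [set: T]
    & forall nu, K nu `<=` interior (K nu.+1)].

(* The class M(G).  The complement is taken in the whole plane, hence the image
   under [\val]; compactness in the subtype [G] and in the plane coincide. *)
Definition compact_conn_compl (R : realType) (G : domain R) : set (set G) :=
  [set K | compact K /\ connected (~` ((fun z : G => \val z) @` K))].

(* A point [p] of [nat * nat] stands for the pair (n, nu). *)
Definition strongly_frequently_runaway (R : realType) (G : domain R)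
    (phi : nat -> G -> G) : Prop :=
  exists (K : nat -> set G) (A : nat -> set nat),
    [/\ exhaustive K,
        forall nu, compact_conn_compl (K nu)
      & forall nu, A nu `<=` [set n | (0 < n)%N]] /\
    [/\ forall nu, (0 < lower_density R (A nu))%E,
        trivIset setT A /\
          trivIset [set p : nat * nat | A p.2 p.1]
                   (fun p => phi p.1 @` K p.2)
      & forall L : set G, compact L ->
          finite_set [set p : nat * nat |
            A p.2 p.1 /\ L `&` (phi p.1 @` K p.2) !=set0]].

(* Main.v *)
(* The sets B(n, nu) = phi_n(K_nu), n in A(nu), are compact, without holes, pairwise disjoint and
   locally finite in G.  Hence there is F holomorphic on G that on each B(n, nu) is
   1/(nu + 1)-close to P_nu o phi_n^-1, where (P_nu) runs through the polynomials with Gaussian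
   rational coefficients, taking each of them infinitely often; then F o phi_n is
   1/(nu + 1)-close to P_nu on K_nu for every n in A(nu).  By Runge's theorem each nonempty open
   set of H(G) contains, for some nu, every function that is 1/(nu + 1)-close to P_nu on K_nu, so
   F o phi_n lies in it for all n in A(nu).

   F is a limit of polynomials, each obtained from the previous one by a Runge correction.  G is
   exhausted by polynomially convex sets L_j, where L_(j+1) is the hull of K_j together with all
   the B(n, nu) that meet K_j; then B(n, nu) meets L_j and its complement in closed pieces, and
   the j-th correction is small on L_j and prescribed on the part of B(n, nu) in L_(j+1) \ L_j.

   No planar topology is needed for unions and images of sets without holes: if E had a hole
   W around a, no neighbourhood of E would carry functions whose derivatives approximate
   1/(w - a), whereas the existence of such functions is stable under disjoint unions and
   injective holomorphic maps. *)
Require Import Defs.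
From mathcomp Require Import all_boot all_order all_algebra finmap complex ring lra.
From mathcomp Require Import all_classical all_reals all_analysis.

Set Implicit Arguments.
Unset Strict Implicit.
Unset Printing Implicit Defensive.

Import Order.TTheory GRing.Theory Num.Theory.
Import numFieldNormedType.Exports.

Local Open Scope classical_set_scope.
Local Open Scope ring_scope.
Local Open Scope complex_scope.

(** Having no holes is used in two forms. Runge's theorem consumes polynomials that separate a point
    from E ([sep]); for a compact full set they exist at every outside point, by pole pushing.
    Unions and images are controlled through [good], which [sep] implies and which a contour
    integral makes incompatible with holes. All contours bound rectangles or unions of grid squares,
    so the Cauchy theory rests on Goursat's lemma and on the single constant [kc]. The obstacle in
    building F is that a set B(n, nu) may be cut into pieces that enter at different stages, and
    that a value prescribed on one piece is disturbed by every later correction. The tolerances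
    therefore decrease geometrically and stay below the target error of every set met so far. Each
    polynomial recurs along nu because nu has to be large twice: for 1/(nu + 1) to be small, and for
    K_nu to contain a given compact set. Simple connectedness keeps the hulls L_j inside G;
    univalence makes the targets on the B(n, nu) well defined and holomorphic. *)

(* The norm of [R[i]] takes its values in [R[i]]. *)
Definition nm (R : realType) (z : R[i]) : R := complex.Re `|z|.

(** * Real-valued modulus, continuity and complex derivatives at a point *)

Section Modulus.
Variable R : realType.
Implicit Types (z w k a b : R[i]) (x y : R) (f g : R[i] -> R[i]).

Lemma nmE z : `|z| = (nm z)%:C.
Proof. by rewrite /nm normc_def. Qed.

Lemma ltc_nm z x : (`|z| < x%:C) = (nm z < x).
Proof. by rewrite nmE ltcR. Qed.

Lemma lec_nm z x : (`|z| <= x%:C) = (nm z <= x).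
Proof. by rewrite nmE lecR. Qed.

Lemma nm_ge0 z : 0 <= nm z.
Proof. by rewrite -ler0c -nmE. Qed.

Lemma nm0 : nm (0 : R[i]) = 0.
Proof. by rewrite /nm normr0. Qed.

Lemma nm1 : nm (1 : R[i]) = 1.
Proof. by rewrite /nm normr1. Qed.

Lemma nm_eq0 z : (nm z == 0) = (z == 0).
Proof. by rewrite -[RHS]normr_eq0 nmE eq_complex /= eqxx andbT. Qed.

Lemma nm_gt0 z : (0 < nm z) = (z != 0).
Proof. by rewrite lt_neqAle nm_ge0 andbT eq_sym nm_eq0. Qed.

Lemma nmD z w : nm (z + w) <= nm z + nm w.
Proof. by rewrite -lecR rmorphD /= -!nmE ler_normD. Qed.

Lemma nmN z : nm (- z) = nm z.
Proof. by rewrite /nm normrN. Qed.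

Lemma nmB z w : nm (z - w) <= nm z + nm w.
Proof. by rewrite -(nmN w) nmD. Qed.

Lemma nm_sym z w : nm (z - w) = nm (w - z).
Proof. by rewrite -nmN opprB. Qed.

Lemma nm_tri z w t : nm (z - t) <= nm (z - w) + nm (w - t).
Proof. by apply: le_trans (nmD _ _); rewrite addrA subrK. Qed.

Lemma nm_leD z w : nm z <= nm w + nm (z - w).
Proof. by rewrite -{1}(subrKC w z) nmD. Qed.

Lemma nmM z w : nm (z * w) = nm z * nm w.
Proof. by apply: complexI; rewrite rmorphM /= -!nmE normrM. Qed.

Lemma nmX z n : nm (z ^+ n) = nm z ^+ n.
Proof. by apply: complexI; rewrite rmorphXn /= -!nmE normrX. Qed.

Lemma nmV z : nm z^-1 = (nm z)^-1.
Proof. by apply: complexI; rewrite fmorphV /= -!nmE normfV. Qed.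

Lemma nm_real x : nm x%:C = `|x|.
Proof. by rewrite /nm normc_def /= expr0n /= addr0 sqrtr_sqr. Qed.

Lemma nm_i : nm ('i : R[i]) = 1.
Proof. by rewrite /nm normc_def /= expr0n /= add0r expr1n sqrtr1. Qed.

Lemma nm_Re z : `|complex.Re z| <= nm z.
Proof. by rewrite -lecR -nmE normc_ge_Re. Qed.

Lemma nm_Im z : `|complex.Im z| <= nm z.
Proof.
have := nm_Re (z * 'i); rewrite nmM nm_i mulr1.
by rewrite ReiNIm normrN.
Qed.

Lemma nm_ReIm z : nm z <= `|complex.Re z| + `|complex.Im z|.
Proof.
rewrite {1}(complexE z) (le_trans (nmD _ _))// nmM nm_i mul1r !nm_real.
by [].
Qed.

Lemma nbhsCP (z : Cplx R) (A : set (Cplx R)) :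
  nbhs z A <-> exists2 d : R, 0 < d & forall w : R[i], nm (w - z) < d -> A w.
Proof.
split.
  move/nbhs_ballP => -[e /= e0]; rewrite -ball_normE /= => eA.
  have eE : e = (complex.Re e)%:C by rewrite RRe_real// gtr0_real.
  exists (complex.Re e); first by rewrite -ltcR -eE.
  by move=> w wz; apply: eA => /=; rewrite eE ltc_nm nm_sym.
move=> [d d0 dA]; apply/nbhs_ballP; exists d%:C => /=; first by rewrite ltcR.
by rewrite -ball_normE => w /=; rewrite ltc_nm nm_sym; exact: dA.
Qed.

Lemma openCP (A : set (Cplx R)) :
  open A <-> forall z, A z ->
    exists2 d : R, 0 < d & forall w : R[i], nm (w - z) < d -> A w.
Proof.
rewrite openE; split => [h z /h /nbhsCP//|h z /h Az].
exact/nbhsCP.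
Qed.

(** Stated for functions on the bare field [R[i]], with the cast to the normed module [Cplx R]
    hidden inside, so that values are computed and compared in [R[i]]. The same holds for [cder] and
    [iscder]. *)
Definition ctn (f : R[i] -> R[i]) (z : R[i]) : Prop :=
  {for (z : Cplx R), continuous (f : Cplx R -> Cplx R)}.

Definition cder (f : R[i] -> R[i]) (z : R[i]) : Prop :=
  derivable (f : Cplx R -> Cplx R) (z : Cplx R) 1.

Definition iscder (f : R[i] -> R[i]) (z d : R[i]) : Prop :=
  is_derive (z : Cplx R) 1 (f : Cplx R -> Cplx R) (d : Cplx R).

Lemma ctnP (f : R[i] -> R[i]) (z : R[i]) : ctn f z <->
  forall e : R, 0 < e ->
    exists2 d : R, 0 < d & forall w, nm (w - z) < d -> nm (f w - f z) < e.
Proof.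
split=> [cf e e0|h A /nbhsCP[e e0 eA]].
  have /nbhsCP : nbhs (f z : Cplx R) [set w | nm (w - f z) < e] by apply/nbhsCP; exists e.
  by move/nbhsCP/cf/nbhsCP.
by apply/nbhsCP; have [d d0 dA] := h e e0; exists d => // w /dA /eA.
Qed.

(** Clearing the denominator removes the punctured neighbourhood: at w = z both sides vanish, so
    such estimates compose without a case distinction. *)
Lemma is_deriveCP (f : Cplx R -> Cplx R) (z d : Cplx R) :
  is_derive z 1 f d <-> forall e : R, 0 < e ->
    exists2 r : R, 0 < r &
      forall w, nm (w - z) < r -> nm (f w - f z - d * (w - z)) <= e * nm (w - z).
Proof.
split.
  move=> fd e e0.
  have : h^-1 *: (f (h *: 1 + z) - f z) @[h --> (0:Cplx R)^'] --> d.
    by rewrite -(@derive_val _ _ _ _ _ _ _ fd); exact: (@ex_derive _ _ _ _ _ _ _ fd).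
  move=> /cvgrPdist_lt/(_ e%:C); rewrite ltcR => /(_ e0).
  rewrite near_withinE => /nbhsCP[r r0 H]; exists r => // w wr.
  have [->|wz] := eqVneq w z; first by rewrite !subrr mulr0 subr0 nm0 mulr0.
  have := H (w - z); rewrite subr0 subr_eq0 => /(_ wr wz).
  rewrite ltc_nm => /ltW; rewrite [_ *: 1]mulr1 subrK.
  rewrite -(ler_pM2r (x := nm (w - z))) ?nm_gt0 ?subr_eq0//.
  rewrite -nmM; apply: le_trans; rewrite -nmN opprB mulrBl.
  have -> : ((w - z)^-1 *: (f w - f z)) * (w - z) = f w - f z.
    by rewrite -[_ *: _]/(_ * _) mulrAC mulVf ?mul1r// subr_eq0.
  by rewrite -nmN opprB.
move=> H.
have K : h^-1 *: (f (h *: 1 + z) - f z) @[h --> (0:Cplx R)^'] --> d.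
  apply/cvgrPdist_le => e e0; have eE : e = (complex.Re e)%:C by rewrite RRe_real// gtr0_real.
  have /H[r r0 rH] : 0 < complex.Re e by rewrite -ltcR -eE.
  rewrite near_withinE; apply/nbhsCP; exists r => // h; rewrite subr0 => hr h0.
  rewrite eE lec_nm -(ler_pM2r (x := nm h)) ?nm_gt0//.
  have := rH (h + z); rewrite addrK => /(_ hr); apply: le_trans.
  rewrite -nmM mulrBl [_ *: 1]mulr1 -[_ *: _]/(_ * _) mulrAC mulVf ?mul1r//.
  by rewrite -nmN opprB.
by apply: DeriveDef; [apply/cvg_ex; exists d | rewrite /derive; exact: cvg_lim].
Qed.

Lemma iscderP (f : R[i] -> R[i]) (z d : R[i]) :
  iscder f z d <-> forall e : R, 0 < e ->
    exists2 r : R, 0 < r &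
      forall w, nm (w - z) < r -> nm (f w - f z - d * (w - z)) <= e * nm (w - z).
Proof. exact: is_deriveCP. Qed.

Lemma cder_ctn (f : R[i] -> R[i]) (z : R[i]) : cder f z -> ctn f z.
Proof. by move/derivable1_diffP/differentiable_continuous. Qed.

Lemma iscder_der (f : R[i] -> R[i]) (z d : R[i]) : iscder f z d -> cder f z.
Proof. by move=> h; exact: (@ex_derive _ _ _ _ _ _ _ h). Qed.

Lemma cder_isder (f : R[i] -> R[i]) (z : R[i]) : cder f z -> exists d, iscder f z d.
Proof. by move=> /derivableP h; eexists; exact: h. Qed.

Lemma ctn_add f g z : ctn f z -> ctn g z -> ctn (fun w => f w + g w) z.
Proof. by move=> cf cg; apply: (@cvgD R[i] (Cplx R) _ (nbhs (z : Cplx R)) _ f g _ _ cf cg). Qed.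

Lemma ctn_sub f g z : ctn f z -> ctn g z -> ctn (fun w => f w - g w) z.
Proof. by move=> cf cg; apply: (@cvgB R[i] (Cplx R) _ (nbhs (z : Cplx R)) _ f g _ _ cf cg). Qed.

Lemma ctn_mul f g z : ctn f z -> ctn g z -> ctn (fun w => f w * g w) z.
Proof. by move=> cf cg; apply: (@cvgM R[i] _ (nbhs (z : Cplx R)) _ f g _ _ cf cg). Qed.

Lemma ctn_inv f z : f z != 0 -> ctn f z -> ctn (fun w => (f w)^-1) z.
Proof. by move=> f0 cf; apply: (@cvgV R[i] _ (nbhs (z : Cplx R)) _ f _ f0 cf). Qed.

Lemma ctn_cst k z : ctn (fun=> k) z.
Proof. by apply/ctnP => e e0; exists 1 => // w _; rewrite subrr nm0. Qed.

Lemma ctn_id z : ctn (fun w => w) z.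
Proof. by move=> A. Qed.

Lemma ctn_comp f g z : ctn f z -> ctn g (f z) -> ctn (fun w => g (f w)) z.
Proof. by move=> cf cg; apply: (@continuous_comp _ _ _ (f : Cplx R -> Cplx R) (g : Cplx R -> Cplx R) _ cf cg). Qed.

Lemma iscder_cst k z : iscder (fun=> k) z 0.
Proof. exact: (@is_derive_cst R[i] (Cplx R) (Cplx R)). Qed.

Lemma iscder_id z : iscder (fun w => w) z 1.
Proof. exact: (@is_derive_id R[i] (Cplx R)). Qed.

Lemma iscder_add f g z a b : iscder f z a -> iscder g z b -> iscder (fun w => f w + g w) z (a + b).
Proof. exact: (@is_deriveD R[i] (Cplx R) (Cplx R) f g). Qed.

Lemma iscder_sub f g z a b : iscder f z a -> iscder g z b -> iscder (fun w => f w - g w) z (a - b).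
Proof. exact: (@is_deriveB R[i] (Cplx R) (Cplx R) f g). Qed.

Lemma iscder_mul f g z a b : iscder f z a -> iscder g z b ->
  iscder (fun w => f w * g w) z (f z * b + g z * a).
Proof. exact: (@is_deriveM R[i] (Cplx R) f g). Qed.

Lemma iscder_comp f g z a b : iscder f z a -> iscder g (f z) b ->
  iscder (fun w => g (f w)) z (b * a).
Proof.
move=> fa gb; have /cder_ctn/ctnP cf := iscder_der fa; move: fa gb => /iscderP fa /iscderP gb.
apply/iscderP => e e0.
have a1 : 0 < nm a + 1 by rewrite ltr_wpDl ?nm_ge0.
have b1 : 0 < nm b + 1 by rewrite ltr_wpDl ?nm_ge0.
have e2 : 0 < e / 2 by rewrite divr_gt0.
have [r1 r10 r1P] := gb _ (divr_gt0 e2 a1).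
have [r2 r20 r2P] := fa _ (divr_gt0 e2 b1).
(* Error 1 near z yields the Lipschitz bound |f w - f z| <= (|a| + 1) |w - z|, which turns the
   estimate for g at f z into one in |w - z|. *)
have [r3 r30 r3P] := fa _ (ltr01 : 0 < 1 :> R).
have [r4 r40 r4P] := cf _ r10.
exists (Num.min (Num.min r2 r3) r4); first by rewrite !lt_min r20 r30.
move=> w; rewrite !lt_min -andbA => /and3P[w2 w3 w4].
have h1 := r1P _ (r4P _ w4); have h2 := r2P _ w2; have h3 := r3P _ w3.
have h4 : nm (f w - f z) <= (nm a + 1) * nm (w - z).
  apply: (le_trans (nm_leD _ (a * (w - z)))); rewrite nmM mulrDl mul1r lerD2l.
  by rewrite (le_trans h3)// mul1r.
have -> : g (f w) - g (f z) - b * a * (w - z) =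
  (g (f w) - g (f z) - b * (f w - f z)) + b * (f w - f z - a * (w - z)) by ring.
apply: (le_trans (nmD _ _)); rewrite [e]splitr mulrDl lerD//.
  apply: (le_trans h1); apply: (le_trans (ler_wpM2l (ltW (divr_gt0 e2 a1)) h4)).
  by rewrite mulrA divfK// lt0r_neq0.
rewrite nmM; apply: (le_trans (ler_wpM2l (nm_ge0 b) h2)).
rewrite mulrA ler_wpM2r ?nm_ge0// mulrCA ger_pMr//.
by rewrite ler_pdivrMr// mul1r lerDl ler01.
Qed.

Lemma iscder_inv f z a : f z != 0 -> iscder f z a ->
  iscder (fun w => (f w)^-1) z (- a / f z ^+ 2).
Proof.
move=> fz fa; split; first exact: (@derivableV R[i] (Cplx R) f _ _ fz (iscder_der fa)).
rewrite (@deriveV R[i] (Cplx R) f _ _ fz (iscder_der fa)).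
rewrite (@derive_val _ _ _ _ _ _ _ fa) /GRing.scale /=.
by rewrite -[LHS]/(- f z ^- 2 * a) mulNr mulrC mulNr.
Qed.

Lemma iscder_near f g z a (d : R) : 0 < d -> (forall w, nm (w - z) < d -> f w = g w) ->
  iscder f z a -> iscder g z a.
Proof.
move=> d0 fg /iscderP h; apply/iscderP => e /h[r r0 rP].
exists (Num.min d r) => [|w]; first by rewrite lt_min d0.
rewrite lt_min => /andP[wd wr]; rewrite -!fg ?subrr ?nm0//.
exact: rP.
Qed.

Lemma iscder_unique f z a b : iscder f z a -> iscder f z b -> a = b.
Proof.
by move=> fa fb; rewrite -(@derive_val _ _ _ _ _ _ _ fa) (@derive_val _ _ _ _ _ _ _ fb).
Qed.

Lemma iscder_eq f z a b : iscder f z a -> a = b -> iscder f z b.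
Proof. by move=> + <-. Qed.

Lemma cder_cst k z : cder (fun=> k) z.
Proof. exact: iscder_der (iscder_cst _ _). Qed.

Lemma cder_id z : cder (fun w => w) z.
Proof. exact: iscder_der (iscder_id _). Qed.

Lemma cder_add f g z : cder f z -> cder g z -> cder (fun w => f w + g w) z.
Proof. by move=> /cder_isder[a fa] /cder_isder[b gb]; exact: iscder_der (iscder_add fa gb). Qed.

Lemma cder_sub f g z : cder f z -> cder g z -> cder (fun w => f w - g w) z.
Proof. by move=> /cder_isder[a fa] /cder_isder[b gb]; exact: iscder_der (iscder_sub fa gb). Qed.

Lemma cder_mul f g z : cder f z -> cder g z -> cder (fun w => f w * g w) z.
Proof. by move=> /cder_isder[a fa] /cder_isder[b gb]; exact: iscder_der (iscder_mul fa gb). Qed.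

Lemma cder_inv f z : f z != 0 -> cder f z -> cder (fun w => (f w)^-1) z.
Proof. by move=> fz /cder_isder[a fa]; exact: iscder_der (iscder_inv fz fa). Qed.

Lemma cder_comp f g z : cder f z -> cder g (f z) -> cder (fun w => g (f w)) z.
Proof. by move=> /cder_isder[a fa] /cder_isder[b gb]; exact: iscder_der (iscder_comp fa gb). Qed.

Lemma cder_near f g z (d : R) : 0 < d -> (forall w, nm (w - z) < d -> f w = g w) ->
  cder f z -> cder g z.
Proof. by move=> d0 fg /cder_isder[a fa]; exact: iscder_der (iscder_near d0 fg fa). Qed.

Lemma iscder_horner (p : {poly R[i]}) z : iscder (fun w => p.[w]) z p^`().[z].
Proof.
elim/poly_ind: p => [|p c IH].
  have -> : (fun w => (0 : {poly R[i]}).[w]) = fun=> 0 by apply/funext => w; rewrite horner0.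
  by rewrite deriv0 horner0; exact: iscder_cst.
have -> : (fun w => (p * 'X + c%:P).[w]) = fun w => p.[w] * w + c.
  by apply/funext => w; rewrite !hornerE.
have -> : (p * 'X + c%:P)^`().[z] = p.[z] * 1 + z * p^`().[z] + 0.
  by rewrite derivD derivM derivX derivC !hornerE; ring.
exact: (iscder_add (iscder_mul IH (iscder_id z)) (iscder_cst c z)).
Qed.

Lemma cder_horner (p : {poly R[i]}) z : cder (fun w => p.[w]) z.
Proof. exact: iscder_der (iscder_horner p z). Qed.

End Modulus.
Arguments cder_cst {R} k z.
Arguments cder_id {R} z.
Arguments ctn_cst {R} k z.
Arguments ctn_id {R} z.
Arguments cder_horner {R} p z.
Arguments cder_ctn {R} [f z] _.
Arguments cder_add {R} [f g z] _ _.
Arguments cder_sub {R} [f g z] _ _.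
Arguments cder_mul {R} [f g z] _ _.
Arguments cder_inv {R} [f z] _ _.
Arguments cder_comp {R} [f g z] _ _.
Arguments ctn_add {R} [f g z] _ _.
Arguments ctn_sub {R} [f g z] _ _.
Arguments ctn_mul {R} [f g z] _ _.
Arguments ctn_inv {R} [f z] _ _.
Arguments ctn_comp {R} [f g z] _ _.

(** * Integration over segments and rectangles *)

Section RealIntegral.
Variable R : realType.
Implicit Types (v w : R -> R) (a b c : R).

Definition rint v a b : R := \int[@lebesgue_measure R]_(x in `[a, b]) v x.

(** Continuity is two-sided even at the endpoints: the integrands come from functions on the plane,
    whose lines extend beyond the segment. *)
Definition rcont v a b := forall t, a <= t <= b -> {for t, continuous v}.

Lemma rcont_within v a b : rcont v a b -> {within `[a, b], continuous v}.
Proof.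
by move=> h; apply: continuous_in_subspaceT => t /set_mem /= /itvP tab; apply: h; rewrite !tab.
Qed.

Lemma rcont_integrable v a b : rcont v a b ->
  (@lebesgue_measure R).-integrable `[a, b] (EFin \o v).
Proof.
move/rcont_within => h; apply: continuous_compact_integrable => //.
exact: segment_compact.
Qed.

Lemma rintD v w a b : rcont v a b -> rcont w a b ->
  rint (fun t => v t + w t) a b = rint v a b + rint w a b.
Proof.
by move=> cv cw; rewrite /rint RintegralD//; exact: rcont_integrable.
Qed.

Lemma rintB v w a b : rcont v a b -> rcont w a b ->
  rint (fun t => v t - w t) a b = rint v a b - rint w a b.
Proof.
by move=> cv cw; rewrite /rint RintegralB//; exact: rcont_integrable.
Qed.

Lemma rintZ v k a b : rcont v a b -> rint (fun t => k * v t) a b = k * rint v a b.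
Proof.
by move=> cv; rewrite /rint RintegralZl//; exact: rcont_integrable.
Qed.

Lemma rint_chasles v a b c : a <= b -> b <= c -> rcont v a c ->
  rint v a c = rint v a b + rint v b c.
Proof.
move=> ab bc cv.
have := @Rintegral_itvB R v (BLeft a) (BRight c) b (rcont_integrable cv).
rewrite !bnd_simp => /(_ ab bc) /(canRL (subrK _)).
rewrite -/(rint _ _ _) => ->; rewrite addrC; congr (_ + _).
have cvb : rcont v b c by move=> t /andP[bt tc]; apply: cv; rewrite (le_trans ab).
rewrite Rintegral_itv_obnd_cbnd; first by [].
apply: integrableS (rcont_integrable cvb); [by [] | by [] | exact: subset_itv_oc_cc].
Qed.

Lemma rcont_cst k a b : rcont (fun=> k) a b.
Proof. by move=> t _; apply: cst_continuous. Qed.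

Lemma rint_cst k a b : a <= b -> rint (fun=> k) a b = k * (b - a).
Proof.
move=> ab; rewrite /rint Rintegral_cst//= lebesgue_measure_itv/= lte_fin.
have [->|/eqP ab'] := eqVneq a b; first by rewrite ltxx subrr !mulr0.
by rewrite lt_neqAle ab andbT; move/eqP : ab' => ->.
Qed.

Lemma le_rint v w a b : rcont v a b -> rcont w a b ->
  (forall t, a <= t <= b -> v t <= w t) -> rint v a b <= rint w a b.
Proof.
move=> cv cw vw; apply: le_Rintegral; first by [].
- exact: rcont_integrable.
- exact: rcont_integrable.
- by move=> t /= /itvP tab; apply: vw; rewrite !tab.
Qed.

Lemma rint_ge v k a b : a <= b -> rcont v a b -> (forall t, a <= t <= b -> k <= v t) ->
  k * (b - a) <= rint v a b.
Proof.
by move=> ab cv kv; rewrite -rint_cst//; apply: le_rint => //; exact: rcont_cst.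
Qed.

Lemma rint_bound v M a b : a <= b -> rcont v a b ->
  (forall t, a <= t <= b -> `|v t| <= M) -> `|rint v a b| <= M * (b - a).
Proof.
move=> ab cv vM; rewrite ler_norml -mulNr; apply/andP; split.
  by apply: rint_ge => // t /vM; rewrite ler_norml => /andP[].
rewrite -rint_cst//; apply: le_rint => //; first exact: rcont_cst.
by move=> t /vM; rewrite ler_norml => /andP[].
Qed.

Lemma rint_FTC (V : R -> R) v a b : a <= b -> rcont v a b ->
  (forall t, a <= t <= b -> is_derive t 1 V (v t)) -> rint v a b = V b - V a.
Proof.
move=> ab cv dV; have [eab|/eqP nab] := eqVneq a b.
  by rewrite eab /rint set_itv1 Rintegral_set1 subrr.
have lab : a < b by rewrite lt_neqAle ab andbT; apply/eqP.
have cV t : a <= t <= b -> {for t, continuous V}.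
  move=> /dV dVt; apply: differentiable_continuous; apply/derivable1_diffP.
  exact: (@ex_derive _ _ _ _ _ _ _ dVt).
rewrite /rint /Rintegral (continuous_FTC2 lab (rcont_within cv) (F := V)) //=.
- split.
  + move=> t tab; have /dV dVt : a <= t <= b by rewrite !ltW ?(itvP tab).
    exact: (@ex_derive _ _ _ _ _ _ _ dVt).
  + by apply: cvg_at_right_filter; apply: cV; rewrite lexx.
  + by apply: cvg_at_left_filter; apply: cV; rewrite lexx ab.
- move=> t tab; have /dV dVt : a <= t <= b by rewrite !ltW ?(itvP tab).
  by rewrite derive1E (@derive_val _ _ _ _ _ _ _ dVt).
Qed.

End RealIntegral.

(** * Complex-valued integrals, by real and imaginary parts *)

Section ComplexIntegral.
Variable R : realType.
Implicit Types (u v : R -> R[i]) (a b c : R).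
Local Notation Re := complex.Re.
Local Notation Im := complex.Im.

Definition cint u a b : R[i] :=
  rint (fun t => Re (u t)) a b +i* rint (fun t => Im (u t)) a b.

Definition ccont u a b := forall t, a <= t <= b -> forall e, 0 < e ->
  exists2 d : R, 0 < d & forall s, `|s - t| < d -> nm (u s - u t) < e.

Lemma continuous_atP (v : R -> R) t : {for t, continuous v} <-> forall e, 0 < e ->
  exists2 d : R, 0 < d & forall s, `|s - t| < d -> `|v s - v t| < e.
Proof.
split=> [cv e e0|h].
  move/cvgrPdist_lt/(_ e e0) : cv => /nbhs_ballP[d /= d0 dP]; exists d => // s sd.
  by rewrite distrC; apply: dP; rewrite -(@ball_normE _ R^o) /= distrC.
apply/cvgrPdist_lt => e /h[d d0 dP]; apply/nbhs_ballP; exists d => //= s.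
by move=> st; rewrite distrC; apply: dP; rewrite distrC.
Qed.

Lemma creB (z w : R[i]) : Re (z - w) = Re z - Re w.
Proof. by case: z w => ? ? [? ?]. Qed.
Lemma cimB (z w : R[i]) : Im (z - w) = Im z - Im w.
Proof. by case: z w => ? ? [? ?]. Qed.
Lemma creD (z w : R[i]) : Re (z + w) = Re z + Re w.
Proof. by case: z w => ? ? [? ?]. Qed.
Lemma cimD (z w : R[i]) : Im (z + w) = Im z + Im w.
Proof. by case: z w => ? ? [? ?]. Qed.
Lemma creM (z w : R[i]) : Re (z * w) = Re z * Re w - Im z * Im w.
Proof. by case: z w => ? ? [? ?]. Qed.
Lemma cimM (z w : R[i]) : Im (z * w) = Re z * Im w + Im z * Re w.
Proof. by case: z w => ? ? [? ?]. Qed.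

Lemma complex_eq (z w : R[i]) : Re z = Re w -> Im z = Im w -> z = w.
Proof. by case: z w => ? ? [? ?] /= -> ->. Qed.

Lemma ccont_Re u a b : ccont u a b -> rcont (fun t => Re (u t)) a b.
Proof.
move=> cu t tab; apply/continuous_atP => e /(cu t tab)[d d0 dP]; exists d => // s /dP.
by apply: le_lt_trans; rewrite -creB nm_Re.
Qed.

Lemma ccont_Im u a b : ccont u a b -> rcont (fun t => Im (u t)) a b.
Proof.
move=> cu t tab; apply/continuous_atP => e /(cu t tab)[d d0 dP]; exists d => // s /dP.
by apply: le_lt_trans; rewrite -cimB nm_Im.
Qed.

Lemma cintD u v a b : ccont u a b -> ccont v a b ->
  cint (fun t => u t + v t) a b = cint u a b + cint v a b.
Proof.
move=> cu cv; apply: complex_eq; rewrite ?(creD, cimD) /=.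
  rewrite -rintD; first by congr rint; apply/funext => t; rewrite creD.
    exact: ccont_Re.
  exact: ccont_Re.
rewrite -rintD; first by congr rint; apply/funext => t; rewrite cimD.
  exact: ccont_Im.
exact: ccont_Im.
Qed.

Lemma rcontZ (k : R) (w : R -> R) a b : rcont w a b -> rcont (fun t => k * w t) a b.
Proof. by move=> cw t tab; apply: cvgM; [exact: cvg_cst | exact: cw]. Qed.

Lemma cintZ u (k : R[i]) a b : ccont u a b ->
  cint (fun t => k * u t) a b = k * cint u a b.
Proof.
move=> cu; have cR := ccont_Re cu; have cI := ccont_Im cu.
apply: complex_eq; rewrite ?(creM, cimM) /= -!rintZ//.
  rewrite -rintB; try exact: rcontZ.
  by congr rint; apply/funext => t; rewrite creM.
rewrite -rintD; try exact: rcontZ.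
by congr rint; apply/funext => t; rewrite cimM.
Qed.

Lemma ccontZ u (k : R[i]) a b : ccont u a b -> ccont (fun t => k * u t) a b.
Proof.
move=> cu t tab e e0; have k1 : 0 < nm k + 1 by rewrite ltr_wpDl ?nm_ge0.
have [d d0 dP] := cu t tab (e / (nm k + 1)) (divr_gt0 e0 k1).
exists d => // s /dP; rewrite -mulrBr nmM ltr_pdivlMr//.
by apply: le_lt_trans; rewrite mulrC ler_wpM2l ?nm_ge0// lerDl.
Qed.

Lemma cintB u v a b : ccont u a b -> ccont v a b ->
  cint (fun t => u t - v t) a b = cint u a b - cint v a b.
Proof.
move=> cu cv; rewrite -mulN1r -cintZ// -cintD//; last exact: ccontZ.
by congr cint; apply/funext => t; rewrite mulN1r.
Qed.

Lemma cint_chasles u a b c : a <= b -> b <= c -> ccont u a c ->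
  cint u a c = cint u a b + cint u b c.
Proof.
move=> ab bc cu; apply: complex_eq; rewrite ?(creD, cimD) /= -rint_chasles//.
exact: ccont_Re. exact: ccont_Im.
Qed.

(** The factor 2 is the price of estimating the real and imaginary parts separately. *)
Lemma cint_bound u M a b : a <= b -> ccont u a b ->
  (forall t, a <= t <= b -> nm (u t) <= M) -> nm (cint u a b) <= 2 * M * (b - a).
Proof.
move=> ab cu uM; apply: (le_trans (nm_ReIm _)) => /=.
rewrite mulrDl mul1r mulrDl lerD//; apply: rint_bound => //.
- exact: ccont_Re.
- by move=> t /uM; apply: le_trans; exact: nm_Re.
- exact: ccont_Im.
- by move=> t /uM; apply: le_trans; exact: nm_Im.
Qed.

Lemma is_deriveRP (V : R -> R) (t d : R) :
  (forall e : R, 0 < e -> exists2 r : R, 0 < r &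
     forall s, `|s - t| < r -> `|V s - V t - d * (s - t)| <= e * `|s - t|) ->
  is_derive t 1 V d.
Proof.
move=> H.
have K : h^-1 *: (V (h *: 1 + t) - V t) @[h --> (0:R)^'] --> d.
  apply/cvgrPdist_le => e /H[r r0 rH].
  rewrite near_withinE; apply/nbhs_ballP; exists r => //= h.
  rewrite -(@ball_normE _ R^o) /= sub0r normrN => hr h0.
  rewrite -(ler_pM2r (x := `|h|)) ?normr_gt0//.
  have := rH (h + t); rewrite addrK => /(_ hr); apply: le_trans.
  rewrite -normrM mulrBl [_ *: 1]mulr1 -[_ *: _]/(_ * _) mulrAC mulVf ?mul1r//.
  by rewrite -normrN opprB.
by apply: DeriveDef; [apply/cvg_ex; exists d | rewrite /derive; exact: cvg_lim].
Qed.

Lemma cint_FTC (U : R -> R[i]) u a b : a <= b -> ccont u a b ->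
  (forall t, a <= t <= b -> forall e : R, 0 < e -> exists2 r : R, 0 < r &
     forall s, `|s - t| < r -> nm (U s - U t - u t * (s - t)%:C) <= e * `|s - t|) ->
  cint u a b = U b - U a.
Proof.
move=> ab cu dU; apply: complex_eq; rewrite ?(creB, cimB) /=.
  apply: (rint_FTC (V := fun t => Re (U t))) => //; first exact: ccont_Re.
  move=> t tab; apply: is_deriveRP => e /(dU t tab)[r r0 rP]; exists r => // s /rP.
  apply: le_trans; rewrite (le_trans _ (nm_Re _))// !creB creM /=.
  by rewrite mulr0 subr0.
apply: (rint_FTC (V := fun t => Im (U t))) => //; first exact: ccont_Im.
move=> t tab; apply: is_deriveRP => e /(dU t tab)[r r0 rP]; exists r => // s /rP.
apply: le_trans; rewrite (le_trans _ (nm_Im _))// !cimB cimM /=.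
by rewrite mulr0 add0r.
Qed.

End ComplexIntegral.

Section SegmentIntegral.
Variable R : realType.
Local Notation C := R[i].
Implicit Types (f g : C -> C) (p d z k : C) (a b c : R).

Definition sint g p d a b : C := d * cint (fun t => g (p + t%:C * d)) a b.

Definition scont g p d a b := forall t, a <= t <= b -> ctn g (p + t%:C * d).

Lemma scont_ccont g p d a b : scont g p d a b -> ccont (fun t => g (p + t%:C * d)) a b.
Proof.
move=> cg t tab e e0; have /ctnP/(_ e e0)[r r0 rP] := cg t tab.
have d1 : 0 < nm d + 1 by rewrite ltr_wpDl ?nm_ge0.
exists (r / (nm d + 1)) => [|s]; first exact: divr_gt0.
rewrite ltr_pdivlMr// => st; apply: rP.
have -> : p + s%:C * d - (p + t%:C * d) = (s - t)%:C * d.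
  by rewrite rmorphB; ring.
rewrite nmM nm_real (le_lt_trans _ st)// ler_wpM2l// lerDl.
exact: ler01.
Qed.

Lemma scontS g p d a b a' b' : a <= a' -> b' <= b -> scont g p d a b -> scont g p d a' b'.
Proof.
move=> aa bb cg t /andP[h1 h2]; apply: cg.
by rewrite (le_trans aa h1) (le_trans h2 bb).
Qed.

Lemma sintB f g p d a b : scont f p d a b -> scont g p d a b ->
  sint (fun w => f w - g w) p d a b = sint f p d a b - sint g p d a b.
Proof.
by move=> cf cg; rewrite /sint cintB ?mulrBr//; exact: scont_ccont.
Qed.

Lemma sintZ f k p d a b : scont f p d a b ->
  sint (fun w => k * f w) p d a b = k * sint f p d a b.
Proof.
by move=> cf; rewrite /sint cintZ 1?mulrCA//; exact: scont_ccont.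
Qed.

Lemma sint_chasles g p d a b c : a <= b -> b <= c -> scont g p d a c ->
  sint g p d a c = sint g p d a b + sint g p d b c.
Proof.
by move=> ab bc cg; rewrite /sint (cint_chasles ab bc) ?mulrDr//; exact: scont_ccont.
Qed.

Lemma sint_bound g M p d a b : a <= b -> scont g p d a b ->
  (forall t, a <= t <= b -> nm (g (p + t%:C * d)) <= M) ->
  nm (sint g p d a b) <= nm d * (2 * M * (b - a)).
Proof.
move=> ab cg gM; rewrite /sint nmM ler_wpM2l ?nm_ge0//.
by apply: cint_bound => //; exact: scont_ccont.
Qed.

Lemma sint_FTC L g p d a b : a <= b -> scont g p d a b ->
  (forall t, a <= t <= b -> iscder L (p + t%:C * d) (g (p + t%:C * d))) ->
  sint g p d a b = L (p + b%:C * d) - L (p + a%:C * d).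
Proof.
move=> ab cg dL; rewrite /sint -cintZ; last exact: scont_ccont.
apply: (cint_FTC (U := fun t => L (p + t%:C * d))) => //.
  by apply: ccontZ; exact: scont_ccont.
move=> t /dL /iscderP h e e0.
have d1 : 0 < nm d + 1 by rewrite ltr_wpDl ?nm_ge0.
have [r r0 rP] := h _ (divr_gt0 e0 d1).
exists (r / (nm d + 1)) => [|s]; first exact: divr_gt0.
rewrite ltr_pdivlMr// => st.
have E : p + s%:C * d - (p + t%:C * d) = (s - t)%:C * d.
  by rewrite rmorphB; ring.
have := rP (p + s%:C * d); rewrite E nmM nm_real /=.
have le1 : `|s - t| * nm d <= `|s - t| * (nm d + 1) by rewrite ler_wpM2l// lerDl ler01.
move=> /(_ (le_lt_trans le1 st)) /=; rewrite -[e / _ * _]mulrA.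
have -> : d * g (p + t%:C * d) * (s - t)%:C = g (p + t%:C * d) * ((s - t)%:C * d) by ring.
move/le_trans; apply; rewrite ler_wpM2l ?(ltW e0)//.
by rewrite mulrC ler_pdivrMr.
Qed.

End SegmentIntegral.

(** Pigeonhole for the bisection in Goursat's lemma: one of the four quarters carries at least a
    quarter of the integral. *)
Lemma quarter_arith (R : realFieldType) (x x1 x2 x3 x4 : R) :
  x <= x1 + x2 + (x3 + x4) -> 4 * x1 < x -> 4 * x2 < x -> 4 * x3 < x -> x <= 4 * x4.
Proof. lra. Qed.

(** * Contour integrals over rectangles and Goursat's lemma *)

Section Rectangle.
Variable R : realType.
Local Notation C := R[i].
Implicit Types (f g L : C -> C) (z k : C) (a b c d : R).

(** The boundary is run counterclockwise. The base points are chosen so that the parameter of a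
    horizontal side is the real part, and that of a vertical side the imaginary part. *)
Definition rectint g a b c d : C :=
  sint g ('i * c%:C) 1 a b + sint g b%:C 'i c d
  - sint g ('i * d%:C) 1 a b - sint g a%:C 'i c d.

Definition rctn g a b c d :=
  (forall t, a <= t <= b -> ctn g (t +i* c) /\ ctn g (t +i* d)) /\
  (forall t, c <= t <= d -> ctn g (a +i* t) /\ ctn g (b +i* t)).

Lemma hptE (t c : R) : 'i * c%:C + t%:C * 1 = t +i* c.
Proof. by apply: complex_eq; rewrite ?(creD, cimD, creM, cimM) /=; ring. Qed.

Lemma vptE (t c : R) : c%:C + t%:C * 'i = c +i* t.
Proof. by apply: complex_eq; rewrite ?(creD, cimD, creM, cimM) /=; ring. Qed.

Lemma rctn_sctn g a b c d : rctn g a b c d ->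
  [/\ scont g ('i * c%:C) 1 a b, scont g b%:C 'i c d,
      scont g ('i * d%:C) 1 a b & scont g a%:C 'i c d].
Proof.
move=> [h v]; split=> t tab; rewrite ?(hptE, vptE).
- exact: (h t tab).1.
- exact: (v t tab).2.
- exact: (h t tab).2.
- exact: (v t tab).1.
Qed.

Lemma rectintB f g a b c d : rctn f a b c d -> rctn g a b c d ->
  rectint (fun w => f w - g w) a b c d = rectint f a b c d - rectint g a b c d.
Proof.
move=> /rctn_sctn[f1 f2 f3 f4] /rctn_sctn[g1 g2 g3 g4].
rewrite /rectint !sintB//.
by move: (sint f _ _ _ _) (sint f _ _ _ _) (sint f _ _ _ _) (sint f _ _ _ _)
  (sint g _ _ _ _) (sint g _ _ _ _) (sint g _ _ _ _) (sint g _ _ _ _) => *; ring.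
Qed.

Lemma rectintZ f k a b c d : rctn f a b c d ->
  rectint (fun w => k * f w) a b c d = k * rectint f a b c d.
Proof.
by move=> /rctn_sctn[f1 f2 f3 f4]; rewrite /rectint !sintZ//; ring.
Qed.

Lemma rectint_bound g M a b c d : a <= b -> c <= d -> rctn g a b c d ->
  (forall t, a <= t <= b -> nm (g (t +i* c)) <= M /\ nm (g (t +i* d)) <= M) ->
  (forall t, c <= t <= d -> nm (g (a +i* t)) <= M /\ nm (g (b +i* t)) <= M) ->
  nm (rectint g a b c d) <= 4 * M * ((b - a) + (d - c)).
Proof.
move=> ab cd /rctn_sctn[g1 g2 g3 g4] h v; rewrite /rectint.
have := sint_bound ab g1 (M := M); have := sint_bound cd g2 (M := M).
have := sint_bound ab g3 (M := M); have := sint_bound cd g4 (M := M).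
rewrite nm_i nm1 !mul1r => b4 b3 b2 b1.
apply: (le_trans (nmB _ _)); apply: (@le_trans _ _ (2 * M * (b - a) + 2 * M * (d - c)
  + 2 * M * (b - a) + 2 * M * (d - c))); last by lra.
apply: lerD; last by apply: b4 => t tab; rewrite vptE; have [] := v t tab.
apply: (le_trans (nmB _ _)); apply: lerD; last by apply: b3 => t tab; rewrite hptE; have [] := h t tab.
apply: (le_trans (nmD _ _)); apply: lerD.
  by apply: b1 => t tab; rewrite hptE; have [] := h t tab.
by apply: b2 => t tab; rewrite vptE; have [] := v t tab.
Qed.

Lemma rectint_FTC L g a b c d : a <= b -> c <= d -> rctn g a b c d ->
  (forall t, a <= t <= b -> iscder L (t +i* c) (g (t +i* c)) /\ iscder L (t +i* d) (g (t +i* d))) ->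
  (forall t, c <= t <= d -> iscder L (a +i* t) (g (a +i* t)) /\ iscder L (b +i* t) (g (b +i* t))) ->
  rectint g a b c d = 0.
Proof.
move=> ab cd /rctn_sctn[g1 g2 g3 g4] h v; rewrite /rectint.
rewrite (sint_FTC (L := L) ab g1); last by move=> t tab; rewrite hptE; have [] := h t tab.
rewrite (sint_FTC (L := L) cd g2); last by move=> t tab; rewrite vptE; have [] := v t tab.
rewrite (sint_FTC (L := L) ab g3); last by move=> t tab; rewrite hptE; have [] := h t tab.
rewrite (sint_FTC (L := L) cd g4); last by move=> t tab; rewrite vptE; have [] := v t tab.
by rewrite !hptE !vptE; ring.
Qed.

Lemma rectint_splitV g a m b c d : a <= m -> m <= b ->
  scont g ('i * c%:C) 1 a b -> scont g ('i * d%:C) 1 a b ->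
  rectint g a b c d = rectint g a m c d + rectint g m b c d.
Proof.
move=> am mb g1 g2; rewrite /rectint (sint_chasles am mb g1) (sint_chasles am mb g2).
by move: (sint _ _ _ _ _) (sint _ _ _ _ _) (sint _ _ _ _ _) (sint _ _ _ _ _)
  (sint _ _ _ _ _) (sint _ _ _ _ _) (sint _ _ _ _ _) => *; ring.
Qed.

Lemma rectint_splitH g a b c m d : c <= m -> m <= d ->
  scont g a%:C 'i c d -> scont g b%:C 'i c d ->
  rectint g a b c d = rectint g a b c m + rectint g a b m d.
Proof.
move=> am mb g1 g2; rewrite /rectint (sint_chasles am mb g1) (sint_chasles am mb g2).
by move: (sint _ _ _ _ _) (sint _ _ _ _ _) (sint _ _ _ _ _) (sint _ _ _ _ _)
  (sint _ _ _ _ _) (sint _ _ _ _ _) (sint _ _ _ _ _) => *; ring.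
Qed.

Lemma nested_point (a b : nat -> R) : (forall n, a n <= a n.+1) ->
  (forall n, b n.+1 <= b n) -> (forall n, a n <= b n) ->
  exists x, forall n, a n <= x <= b n.
Proof.
move=> aS bS ab.
have am m n : (m <= n)%N -> a m <= a n.
  by move=> /subnK <-; elim: (n - m)%N => // k /le_trans; apply; rewrite addSn.
have bm m n : (m <= n)%N -> b n <= b m.
  by move=> /subnK <-; elim: (n - m)%N => // k; apply: le_trans; rewrite addSn.
have abmn m n : a m <= b n.
  rewrite (le_trans (am _ _ (leq_maxl m n)))// (le_trans (ab _))//.
  exact/bm/leq_maxr.
have hs : has_sup (range a).
  by split; [exists (a 0%N), 0%N | exists (b 0%N) => _ [n _ <-]].
exists (sup (range a)) => n; apply/andP; split.
  by apply: ub_le_sup; [exact: hs.2 | exists n].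
by apply: ge_sup; [exact: hs.1 | move=> _ [m _ <-]].
Qed.

Definition indom f a b c d :=
  forall x y, a <= x <= b -> c <= y <= d -> cder f (x +i* y).

Lemma indomS f a b c d a' b' c' d' : a <= a' -> b' <= b -> c <= c' -> d' <= d ->
  indom f a b c d -> indom f a' b' c' d'.
Proof.
move=> aa bb cc dd h x y /andP[x1 x2] /andP[y1 y2]; apply: h.
  by rewrite (le_trans aa x1) (le_trans x2 bb).
by rewrite (le_trans cc y1) (le_trans y2 dd).
Qed.

Lemma indom_rctn f a b c d : a <= b -> c <= d -> indom f a b c d -> rctn f a b c d.
Proof.
by move=> ab cd h; split => t tab; split; apply/cder_ctn/h; rewrite ?lexx ?ab ?cd ?tab.
Qed.

Lemma goursat_quarter f a b c d : a <= b -> c <= d -> indom f a b c d ->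
  exists a' b' c' d', [/\ a <= a' <= b', b' <= b, c <= c' <= d', d' <= d
    & [/\ b' - a' = (b - a) / 2, d' - c' = (d - c) / 2
    & nm (rectint f a b c d) <= 4 * nm (rectint f a' b' c' d')]].
Proof.
move=> ab cd h; pose m := (a + b) / 2; pose n := (c + d) / 2.
have am : a <= m by rewrite /m; lra.
have mb : m <= b by rewrite /m; lra.
have cn : c <= n by rewrite /n; lra.
have nd : n <= d by rewrite /n; lra.
have hm1 : m - a = (b - a) / 2 by rewrite /m; field.
have hm2 : b - m = (b - a) / 2 by rewrite /m; field.
have hn1 : n - c = (d - c) / 2 by rewrite /n; field.
have hn2 : d - n = (d - c) / 2 by rewrite /n; field.
move: m n am mb cn nd hm1 hm2 hn1 hn2 => m n am mb cn nd hm1 hm2 hn1 hn2.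
have [h1 h2 h3 h4] := rctn_sctn (indom_rctn ab cd h).
have h5 := indomS (lexx a) mb (lexx c) (lexx d) h.
have h6 := indomS am (lexx b) (lexx c) (lexx d) h.
have [v1 v2 v3 v4] := rctn_sctn (indom_rctn am cd h5).
have [w1 w2 w3 w4] := rctn_sctn (indom_rctn mb cd h6).
have E := rectint_splitV am mb h1 h3.
rewrite (rectint_splitH cn nd v4 v2) (rectint_splitH cn nd w4 w2) in E.
set r1 := rectint f a m c n in E; set r2 := rectint f a m n d in E.
set r3 := rectint f m b c n in E; set r4 := rectint f m b n d in E.
have T : nm (rectint f a b c d) <= nm r1 + nm r2 + (nm r3 + nm r4).
  by rewrite E (le_trans (nmD _ _))// lerD ?nmD.
have [H|H1] := leP (nm (rectint f a b c d)) (4 * nm r1).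
  by exists a, m, c, n; split; rewrite ?lexx ?am ?cn//; split.
have [H|H2] := leP (nm (rectint f a b c d)) (4 * nm r2).
  by exists a, m, n, d; split; rewrite ?lexx ?am ?nd ?cn//; split.
have [H|H3] := leP (nm (rectint f a b c d)) (4 * nm r3).
  by exists m, b, c, n; split; rewrite ?lexx ?am ?cn ?mb//; split.
exists m, b, n, d; split; rewrite ?lexx ?am ?cn ?mb ?nd//; split => //; rewrite -/r4.
exact: quarter_arith T H1 H2 H3.
Qed.

Lemma rect_dist (x y a b c d x' y' : R) : a <= x <= b -> c <= y <= d ->
  a <= x' <= b -> c <= y' <= d ->
  nm ((x +i* y) - (x' +i* y')) <= (b - a) + (d - c).
Proof.
move=> /andP[? ?] /andP[? ?] /andP[? ?] /andP[? ?].
apply: (le_trans (nm_ReIm _)); rewrite lerD// ler_norml; apply/andP; split => /=; lra.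
Qed.

(** Nested rectangles, each a half-size quarter of the previous one, keep at least the fraction 4^-n
    of the integral. At their common point z the function is affine up to a small multiple of |w -
    z|; the affine part has a primitive and integrates to 0, and the remainder contributes only a
    small multiple of 4^-n. *)
Theorem goursat f a b c d : a <= b -> c <= d -> indom f a b c d -> rectint f a b c d = 0.
Proof.
move=> ab cd h; apply/eqP; rewrite -nm_eq0 eq_le nm_ge0 andbT.
pose good (q : R * R * R * R) := let: (a', b', c', d') := q in
  [/\ a <= a', a' <= b', b' <= b & [/\ c <= c', c' <= d' & d' <= d]].
pose stp (q q' : R * R * R * R) :=
  let: (a1, b1, c1, d1) := q in let: (a2, b2, c2, d2) := q' in
  [/\ a1 <= a2, b2 <= b1, c1 <= c2, d2 <= d1
    & [/\ b2 - a2 = (b1 - a1) / 2, d2 - c2 = (d1 - c1) / 2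
    & nm (rectint f a1 b1 c1 d1) <= 4 * nm (rectint f a2 b2 c2 d2)]].
(* A rectangle is carried together with the proof that it lies in the original one, so that the
   choice of a quarter can be iterated. *)
have nxt (q : {q | good q}) : {q' : {q | good q} | stp (sval q) (sval q')}.
  case: q => -[[[a1 b1] c1] d1] [/= h1 h2 h3 [h4 h5 h6]].
  apply: cid; have [a2 [b2 [c2 [d2 [/andP[k1 k2] k3 /andP[k4 k5] k6 [k7 k8 k9]]]]]] :=
    goursat_quarter h2 h5 (indomS h1 h3 h4 h6 h).
  have gq : good (a2, b2, c2, d2).
    split; [exact: le_trans k1 | by [] | exact: le_trans h3 | split => //].
      exact: le_trans k4.
    exact: le_trans h6.
  by exists (exist _ _ gq); split.
have g0 : good (a, b, c, d) by split => //; split.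
pose q n : {q | good q} := iter n (fun q => sval (nxt q)) (exist _ _ g0).
pose A n := (sval (q n)).1.1.1; pose B n := (sval (q n)).1.1.2.
pose D n := (sval (q n)).2; pose E n := (sval (q n)).1.2.
have qE n : sval (q n) = (A n, B n, E n, D n) by rewrite /A /B /E /D; case: (sval _) => -[[]].
have G n : good (A n, B n, E n, D n) by rewrite -qE; case: (q n).
have S n : stp (A n, B n, E n, D n) (A n.+1, B n.+1, E n.+1, D n.+1).
  by rewrite -!qE; exact: (svalP (nxt (q n))).
have [x xP] : exists x, forall n, A n <= x <= B n.
  by apply: nested_point => n; [have [] := S n | have [] := S n | have [] := G n].
have [y yP] : exists y, forall n, E n <= y <= D n.
  by apply: nested_point => n; [have [] := S n | have [] := S n | have [_ _ _ []] := G n].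
have len n : B n - A n = (b - a) / 2 ^+ n /\ D n - E n = (d - c) / 2 ^+ n.
  elim: n => [|n [IH1 IH2]]; first by rewrite !expr0 !divr1.
  have [_ _ _ _ [-> -> _]] := S n.
  by rewrite IH1 IH2 exprSr invfM !mulrA.
have I n : nm (rectint f a b c d) <= 4 ^+ n * nm (rectint f (A n) (B n) (E n) (D n)).
  elim: n => [|n IH]; first by rewrite expr0 mul1r.
  apply: (le_trans IH); have [_ _ _ _ [_ _ k]] := S n.
  by rewrite exprSr -mulrA ler_wpM2l// exprn_ge0.
have [xab ycd] : a <= x <= b /\ c <= y <= d by split; [exact: (xP 0%N) | exact: (yP 0%N)].
have [k /iscderP kP] := cder_isder (h x y xab ycd).
set z := x +i* y in kP.
(* The added 1 keeps [l] positive for a degenerate rectangle. *)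
pose l := (b - a) + (d - c) + 1.
have l0 : 0 < l by rewrite /l; lra.
apply/ler_addgt0Pr => e e0; rewrite add0r.
(* In the n-th rectangle the distance to z and the sum of the two side lengths are at most l / 2^n,
   and [rectint_bound] adds a factor 4; dividing by 4 l^2 leaves e / 4^n. *)
have e' : 0 < e / (4 * l ^+ 2) by rewrite divr_gt0// mulr_gt0// exprn_gt0.
have [r r0 rP] := kP _ e'.
have [n nr] : exists n : nat, l / 2 ^+ n < r.
  have [n _ nP] : \forall n \near \oo, l / r < n%:R by apply: nbhs_infty_gtr.
  exists n; rewrite ltr_pdivrMr ?exprn_gt0// mulrC -ltr_pdivrMr//.
  apply: (lt_trans (nP n (leqnn n))).
  by rewrite -natrX ltr_nat ltn_expl.
have [g1 g2 g3 [g4 g5 g6]] := G n.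
have [lA lE] := len n.
have two0 : 0 < 2 ^+ n :> R by rewrite exprn_gt0.
have dz (s t : R) : A n <= s <= B n -> E n <= t <= D n -> nm ((s +i* t) - z) <= l / 2 ^+ n.
  move=> sA tE; apply: (le_trans (rect_dist sA tE (xP n) (yP n))).
  rewrite lA lE -mulrDl ler_wpM2r ?invr_ge0 ?(ltW two0)// /l; lra.
pose p (w : C) : C := f z + k * (w - z).
pose P (w : C) : C := f z * w + k * 2^-1 * (w - z) * (w - z).
have dP w : iscder P w (p w).
  have sz := iscder_sub (iscder_id w) (iscder_cst z w).
  apply: (iscder_eq (iscder_add (iscder_mul (iscder_cst (f z) w) (iscder_id w))
   (iscder_mul (iscder_mul (iscder_cst (k * 2^-1) w) sz) sz))).
  by rewrite /p; field.
have cp w : ctn p w.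
  exact: (cder_ctn (cder_add (cder_cst (f z) w)
    (cder_mul (cder_cst k w) (cder_sub (cder_id w) (cder_cst z w))))).
have rp : rctn p (A n) (B n) (E n) (D n) by split => t _; split; exact: cp.
have rf : rctn f (A n) (B n) (E n) (D n).
  by apply: indom_rctn => //; exact: indomS h.
have p0 : rectint p (A n) (B n) (E n) (D n) = 0.
  by apply: (rectint_FTC (L := P)) => // t _; split.
have rfp : rctn (fun w => f w - p w) (A n) (B n) (E n) (D n).
  by split=> t tab; split; apply: ctn_sub (cp _);
    [exact: (rf.1 t tab).1 | exact: (rf.1 t tab).2 | exact: (rf.2 t tab).1 | exact: (rf.2 t tab).2].
have M s t : A n <= s <= B n -> E n <= t <= D n ->
    nm (f (s +i* t) - p (s +i* t)) <= e / (4 * l ^+ 2) * (l / 2 ^+ n).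
  move=> sA tE; have sz := dz s t sA tE.
  have := rP _ (le_lt_trans sz nr); rewrite /p opprD addrA => /le_trans; apply.
  by rewrite ler_wpM2l// ltW.
apply: (le_trans (I n)).
have -> : rectint f (A n) (B n) (E n) (D n) =
    rectint (fun w => f w - p w) (A n) (B n) (E n) (D n).
  by rewrite rectintB// p0 subr0.
have := rectint_bound g2 g5 rfp (M := e / (4 * l ^+ 2) * (l / 2 ^+ n)).
have AA : A n <= A n <= B n by rewrite lexx.
have BB : A n <= B n <= B n by rewrite lexx g2.
have EE : E n <= E n <= D n by rewrite lexx.
have DD : E n <= D n <= D n by rewrite lexx g5.
move=> /(_ (fun t tab => conj (M t _ tab EE) (M t _ tab DD))
  (fun t tab => conj (M _ t AA tab) (M _ t BB tab))).
rewrite lA lE -mulrDl => H.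
have q0 : 0 < 4 ^+ n :> R by rewrite exprn_gt0.
apply: (le_trans (ler_wpM2l (ltW q0) H)).
have -> : 4 ^+ n = 2 ^+ n * 2 ^+ n :> R by rewrite -exprMn; congr (_ ^+ n); ring.
have -> : 2 ^+ n * 2 ^+ n * (4 * (e / (4 * l ^+ 2) * (l / 2 ^+ n)) * ((b - a + (d - c)) / 2 ^+ n))
  = e * ((b - a + (d - c)) / l).
  by field; rewrite !lt0r_neq0.
rewrite ger_pMr// ler_pdivrMr// mul1r /l; lra.
Qed.

End Rectangle.

(** * Cauchy's formula on rectangles *)

Section Cauchy.
Variable R : realType.
Local Notation C := R[i].
Implicit Types (f g L : C -> C) (z w k : C) (a b c d r x y : R).

Lemma rctn_sub f g a b c d : rctn f a b c d -> rctn g a b c d ->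
  rctn (fun w => f w - g w) a b c d.
Proof.
move=> [f1 f2] [g1 g2]; split=> t h.
  by split; [exact: ctn_sub (f1 t h).1 (g1 t h).1 | exact: ctn_sub (f1 t h).2 (g1 t h).2].
by split; [exact: ctn_sub (f2 t h).1 (g2 t h).1 | exact: ctn_sub (f2 t h).2 (g2 t h).2].
Qed.

Definition pdom g a b c d z := forall s t, a <= s <= b -> c <= t <= d ->
  s +i* t != z -> cder g (s +i* t).

Lemma pdomS g a b c d z a' b' c' d' : a <= a' -> b' <= b -> c <= c' -> d' <= d ->
  pdom g a b c d z -> pdom g a' b' c' d' z.
Proof.
move=> aa bb cc dd h x y /andP[x1 x2] /andP[y1 y2]; apply: h.
  by rewrite (le_trans aa x1) (le_trans x2 bb).
by rewrite (le_trans cc y1) (le_trans y2 dd).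
Qed.

Lemma pdom_indom g a b c d x y : pdom g a b c d (x +i* y) ->
  [|| x < a, b < x, y < c | d < y] -> indom g a b c d.
Proof.
move=> h o s t sab tcd; apply: h => //; apply/negP => /eqP[sx ty].
by move: o sab tcd; rewrite sx ty => /or4P[] /lt_geF ->; rewrite ?andbF.
Qed.

Lemma pdom_rctn g a b c d x y : pdom g a b c d (x +i* y) -> a < x < b -> c < y < d ->
  rctn g a b c d.
Proof.
move=> h /andP[ax xb] /andP[cy yd].
have ab : a <= b by rewrite ltW// (lt_trans ax).
have cd : c <= d by rewrite ltW// (lt_trans cy).
split=> t tab; split; apply: cder_ctn; apply: h; rewrite ?lexx ?ab ?cd ?tab//;
  apply/negP => /eqP[e1 e2]; move: ax xb cy yd; rewrite -?e1 -?e2 ?ltxx//.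
Qed.

(** The two vertical strips and the two remaining horizontal pieces around the small square miss the
    exceptional point, so Goursat's lemma removes them one after the other. *)
Lemma rect_shrink g a b c d x y r : pdom g a b c d (x +i* y) -> 0 < r ->
  a <= x - r -> x + r <= b -> c <= y - r -> y + r <= d ->
  rectint g a b c d = rectint g (x - r) (x + r) (y - r) (y + r).
Proof.
move=> h r0 ax xb cy yd.
have hx : x - r < x < x + r by rewrite ltrBlDr !ltrDl r0.
have hy : y - r < y < y + r by rewrite ltrBlDr !ltrDl r0.
case/andP: (hx) => hx1 hx2; case/andP: (hy) => hy1 hy2.
have xx : x - r <= x + r by rewrite ltW// (lt_trans hx1).
have yy : y - r <= y + r by rewrite ltW// (lt_trans hy1).
have ab : a <= b by rewrite (le_trans ax)// (le_trans xx).
have cd : c <= d by rewrite (le_trans cy)// (le_trans yy).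
have ab' : a < x < b by rewrite (le_lt_trans ax) ?(lt_le_trans _ xb).
have cd' : c < y < d by rewrite (le_lt_trans cy) ?(lt_le_trans _ yd).
have ar : a <= x + r by rewrite (le_trans ax).
have rb : x - r <= b by rewrite (le_trans xx).
have cr : c <= y + r by rewrite (le_trans cy).
have rd : y - r <= d by rewrite (le_trans yy).
have [s1 _ s3 _] := rctn_sctn (pdom_rctn h ab' cd').
rewrite (rectint_splitV (m := x - r) ax rb s1 s3).
have h1 : indom g a (x - r) c d.
  by apply: (pdom_indom (x := x) (y := y)); [exact: pdomS h | rewrite hx1 orbT].
rewrite (goursat ax cd h1) add0r.
have h2 := pdomS ax (lexx b) (lexx c) (lexx d) h.
have hxb : x - r < x < b by rewrite hx1 (lt_le_trans hx2).
have hyd : y - r < y < d by rewrite hy1 (lt_le_trans hy2).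
have [t1 _ t3 _] := rctn_sctn (pdom_rctn h2 hxb cd').
rewrite (rectint_splitV (m := x + r) xx xb t1 t3).
have h3 : indom g (x + r) b c d.
  by apply: (pdom_indom (x := x) (y := y)); [exact: pdomS h | rewrite hx2].
rewrite (goursat xb cd h3) addr0.
have h4 := pdomS ax xb (lexx c) (lexx d) h.
have [_ u2 _ u4] := rctn_sctn (pdom_rctn h4 hx cd').
rewrite (rectint_splitH (m := y - r) cy rd u4 u2).
have h5 : indom g (x - r) (x + r) c (y - r).
  by apply: (pdom_indom (x := x) (y := y)); [exact: pdomS h | rewrite hy1 !orbT].
rewrite (goursat xx cy h5) add0r.
have h6 := pdomS ax xb cy (lexx d) h.
have [_ v2 _ v4] := rctn_sctn (pdom_rctn h6 hx hyd).
rewrite (rectint_splitH (m := y + r) yy yd v4 v2).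
have h7 : indom g (x - r) (x + r) (y + r) d.
  by apply: (pdom_indom (x := x) (y := y)); [exact: pdomS h | rewrite hy2 !orbT].
by rewrite (goursat xx yd h7) addr0.
Qed.

Lemma inner_radius a b c d x y : a < x < b -> c < y < d ->
  exists2 r, 0 < r & [/\ a <= x - r, x + r <= b, c <= y - r & y + r <= d].
Proof.
move=> /andP[ax xb] /andP[cy yd].
exists (Num.min (Num.min (x - a) (b - x)) (Num.min (y - c) (d - y))).
  by rewrite !lt_min !subr_gt0 ax xb cy.
set r := Num.min _ _.
have : r <= r by []. rewrite {2}/r !le_min -andbA => /and4P[h1 h2 h3 h4].
by split; move: h1 h2 h3 h4; move: r => r; lra.
Qed.

Lemma sq_bdry x y r : 0 <= r -> forall t,
  (x - r <= t <= x + r -> nm ((t +i* (y - r)) - (x +i* y)) >= r /\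
     nm ((t +i* (y + r)) - (x +i* y)) >= r) /\
  (y - r <= t <= y + r -> nm (((x - r) +i* t) - (x +i* y)) >= r /\
     nm (((x + r) +i* t) - (x +i* y)) >= r).
Proof.
move=> r0 t; have hr : `|r| = r by rewrite ger0_norm.
split=> _; split.
- by apply: (le_trans _ (nm_Im _)) => /=; rewrite addrAC subrr add0r normrN hr.
- by apply: (le_trans _ (nm_Im _)) => /=; rewrite addrAC subrr add0r hr.
- by apply: (le_trans _ (nm_Re _)) => /=; rewrite addrAC subrr add0r normrN hr.
- by apply: (le_trans _ (nm_Re _)) => /=; rewrite addrAC subrr add0r hr.
Qed.

(** Removable singularity: on the boundary of a square of half side r about the point, |g| is at
    most e / (16 r). [rectint_bound] multiplies this by 4 and by the sum 4 r of two sides, which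
    gives e. *)
Lemma rectint_exc0 g a b c d x y : pdom g a b c d (x +i* y) -> a < x < b -> c < y < d ->
  (forall e : R, 0 < e -> exists2 r : R, 0 < r & forall w, w != x +i* y ->
     nm (w - (x +i* y)) < r -> nm ((w - (x +i* y)) * g w) <= e) ->
  rectint g a b c d = 0.
Proof.
move=> h ab cd lim; set z := x +i* y in h lim.
apply/eqP; rewrite -nm_eq0 eq_le nm_ge0 andbT; apply/ler_addgt0Pr => e e0; rewrite add0r.
have [r0 r00 rP] := lim (e / 16) (divr_gt0 e0 (ltr0n _ 16)).
have [r1 r10 [ax1 xb1 cy1 yd1]] := inner_radius ab cd.
pose r := Num.min (r0 / 8) r1.
have rpos : 0 < r by rewrite lt_min divr_gt0.
have rr1 : r <= r1 by rewrite ge_min lexx orbT.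
have rr0 : 8 * r <= r0 by rewrite mulrC -ler_pdivlMr// ge_min lexx.
have [ax xb cy yd] : [/\ a <= x - r, x + r <= b, c <= y - r & y + r <= d].
  by split; move: rr1 ax1 xb1 cy1 yd1; clear; lra.
rewrite (rect_shrink h rpos ax xb cy yd).
have rx : x - r <= x + r by rewrite lerBlDr -addrA lerDl addr_ge0 ?ltW.
have ry : y - r <= y + r by rewrite lerBlDr -addrA lerDl addr_ge0 ?ltW.
have hx : x - r < x < x + r by rewrite ltrBlDr !ltrDl rpos.
have hy : y - r < y < y + r by rewrite ltrBlDr !ltrDl rpos.
have rc := pdom_rctn (pdomS ax xb cy yd h) hx hy.
have key s t : x - r <= s <= x + r -> y - r <= t <= y + r -> r <= nm ((s +i* t) - z) ->
    nm (g (s +i* t)) <= e / 16 / r.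
  move=> sx ty rle; rewrite ler_pdivlMr//.
  have wz : s +i* t != z by rewrite -subr_eq0 -nm_gt0 (lt_le_trans rpos).
  have lt0 : nm ((s +i* t) - z) < r0.
    apply: (le_lt_trans (rect_dist sx ty (_ : _ <= x <= _) (_ : _ <= y <= _))).
    - by case/andP: hx => /ltW -> /ltW ->.
    - by case/andP: hy => /ltW -> /ltW ->.
    - by apply: (lt_le_trans _ rr0); move: rpos; clear; lra.
  have := rP _ wz lt0; rewrite nmM; apply: le_trans; rewrite mulrC ler_wpM2r ?nm_ge0//.
have B := sq_bdry x y (ltW rpos).
have le_l (u v : R) : u <= v -> u <= u <= v by move=> ->; rewrite lexx.
have le_r (u v : R) : u <= v -> u <= v <= v by move=> ->; rewrite lexx.
have := rectint_bound rx ry rc (M := e / 16 / r).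
have P1 t : x - r <= t <= x + r ->
    nm (g (t +i* (y - r))) <= e / 16 / r /\ nm (g (t +i* (y + r))) <= e / 16 / r.
  by move=> tx; have [/(_ tx)[? ?] _] := B t; split; apply: key => //; [exact: le_l | exact: le_r].
have P2 t : y - r <= t <= y + r ->
    nm (g ((x - r) +i* t)) <= e / 16 / r /\ nm (g ((x + r) +i* t)) <= e / 16 / r.
  by move=> tx; have [_ /(_ tx)[? ?]] := B t; split; apply: key => //; [exact: le_l | exact: le_r].
move=> /(_ P1 P2) /le_trans; apply.
have -> : 4 * (e / 16 / r) * (x + r - (x - r) + (y + r - (y - r))) = e.
  by field; rewrite lt0r_neq0.
by [].
Qed.

(* This is 2 pi i, but only its nonvanishing is ever used. *)
Definition kc : C := rectint (fun w : C => w^-1) (-1) 1 (-1) 1.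

Lemma pdom_inv a b c d z : pdom (fun w => (w - z)^-1) a b c d z.
Proof.
move=> s t _ _ wz.
by apply: cder_inv; [rewrite subr_eq0 | exact: (cder_sub (cder_id _) (cder_cst z _))].
Qed.

Arguments pdom_inv : clear implicits.

Lemma rectint_shrink2 g a b c d a' b' c' d' x y :
  pdom g a b c d (x +i* y) -> pdom g a' b' c' d' (x +i* y) ->
  a < x < b -> c < y < d -> a' < x < b' -> c' < y < d' ->
  rectint g a b c d = rectint g a' b' c' d'.
Proof.
move=> h h' ab cd ab' cd'.
have [r1 r10 [ax1 xb1 cy1 yd1]] := inner_radius ab cd.
have [r2 r20 [ax2 xb2 cy2 yd2]] := inner_radius ab' cd'.
pose r := Num.min r1 r2.
have r0 : 0 < r by rewrite lt_min r10.
have rr1 : r <= r1 by rewrite ge_min lexx.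
have rr2 : r <= r2 by rewrite ge_min lexx orbT.
by rewrite (rect_shrink (r := r) h)// ?(rect_shrink (r := r) h')//;
  move: rr1 rr2 ax1 xb1 cy1 yd1 ax2 xb2 cy2 yd2; clear; lra.
Qed.

(** Both this integral and [kc] may be taken over a large square [-N, N]^2 that contains z and 0.
    There the integrands differ by z / ((w - z) w), which is of order N^-2, on a contour of length
    of order N. *)
Lemma rectint_kernel a b c d x y : a < x < b -> c < y < d ->
  rectint (fun w => (w - (x +i* y))^-1) a b c d = kc.
Proof.
move=> ab cd; set z := x +i* y.
apply/eqP; rewrite -subr_eq0 -nm_eq0 eq_le nm_ge0 andbT.
apply/ler_addgt0Pr => e e0; rewrite add0r.
(* The term 2 |z| gives |w - z| >= N / 2 on the contour, the term 32 |z| / e makes the final bound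
   32 |z| / N at most e, and 1 keeps N positive. *)
pose N := 1 + 2 * nm z + 32 * nm z / e.
have z0 := nm_ge0 z.
have q0 : 0 <= 32 * nm z / e by rewrite divr_ge0 ?mulr_ge0// ltW.
have N1 : 1 <= N by rewrite /N -addrA lerDl addr_ge0// mulr_ge0.
have N0 : 0 < N by exact: lt_le_trans N1.
have zN : 2 * nm z < N by rewrite /N; move: q0; move: (_ / e) => q q0; lra.
have hN0 : - N < 0 < N by rewrite oppr_lt0 N0.
have zlt : nm z < N by move: z0 zN; clear; lra.
have xN : - N < x < N.
  by rewrite -ltr_norml (le_lt_trans (nm_Re z)).
have yN : - N < y < N.
  by rewrite -ltr_norml (le_lt_trans (nm_Im z)).
rewrite (rectint_shrink2 (a' := - N) (b' := N) (c' := - N) (d' := N) (pdom_inv _ _ _ _ z))//; last exact: pdom_inv.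
have kcE : kc = rectint (fun w => w^-1) (- N) N (- N) N.
  have E : (fun w : C => w^-1) = fun w => (w - (0 +i* 0))^-1.
    by apply/funext => w; rewrite subr0.
  rewrite /kc E; apply: rectint_shrink2; [exact: pdom_inv | exact: pdom_inv|..] => //.
  - by rewrite oppr_lt0 ltr01.
  - by rewrite oppr_lt0 ltr01.
have r1 : rctn (fun w => (w - z)^-1) (- N) N (- N) N by exact: (pdom_rctn (pdom_inv _ _ _ _ z)).
have r2 : rctn (fun w : C => w^-1) (- N) N (- N) N.
  have E : (fun w : C => w^-1) = fun w => (w - (0 +i* 0))^-1.
    by apply/funext => w; rewrite subr0.
  by rewrite E; exact: (pdom_rctn (pdom_inv _ _ _ _ _)).
rewrite kcE -rectintB//.
have rB : rctn (fun w => (w - z)^-1 - w^-1) (- N) N (- N) N.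
  exact: rctn_sub r1 r2.
have key w : N <= nm w -> nm ((w - z)^-1 - w^-1) <= 2 * nm z / N ^+ 2.
  move=> Nw; have w0 : w != 0 by rewrite -nm_gt0 (lt_le_trans N0).
  have wz : N / 2 <= nm (w - z).
    have := nm_leD w z; have : nm z < N / 2 by rewrite ltr_pdivlMr// mulrC.
    move: Nw; clear; move: (nm w) (nm z) (nm (w - z)) => *; lra.
  have wz0 : w - z != 0 by rewrite -nm_gt0 (lt_le_trans _ wz)// divr_gt0.
  have -> : (w - z)^-1 - w^-1 = z * ((w - z)^-1 * w^-1) by field; rewrite w0.
  rewrite nmM nmM !nmV.
  have -> : 2 * nm z / N ^+ 2 = nm z * ((N / 2)^-1 * N^-1) by field; rewrite lt0r_neq0.
  have i1 : (nm (w - z))^-1 <= (N / 2)^-1 by rewrite lef_pV2 ?posrE ?nm_gt0// divr_gt0.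
  have i2 : (nm w)^-1 <= N^-1 by rewrite lef_pV2 ?posrE ?nm_gt0.
  rewrite (ler_wpM2l z0)//.
  by apply: (ler_pM _ _ i1 i2); rewrite invr_ge0 nm_ge0.
have NN : - N <= N by rewrite (le_trans (ltW (proj1 (andP hN0))))// ltW.
have B := sq_bdry 0 0 (ltW N0).
have := rectint_bound NN NN rB (M := 2 * nm z / N ^+ 2).
have P1 t : - N <= t <= N ->
    nm (((t +i* (- N)) - z)^-1 - (t +i* (- N))^-1) <= 2 * nm z / N ^+ 2 /\
    nm (((t +i* N) - z)^-1 - (t +i* N)^-1) <= 2 * nm z / N ^+ 2.
  move=> tN; have [h _] := B t; move: h; rewrite !sub0r !add0r !subr0 => /(_ tN)[? ?].
  by split; exact: key.
have P2 t : - N <= t <= N ->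
    nm ((((- N) +i* t) - z)^-1 - ((- N) +i* t)^-1) <= 2 * nm z / N ^+ 2 /\
    nm (((N +i* t) - z)^-1 - (N +i* t)^-1) <= 2 * nm z / N ^+ 2.
  move=> tN; have [_ h] := B t; move: h; rewrite !sub0r !add0r !subr0 => /(_ tN)[? ?].
  by split; exact: key.
move=> /(_ P1 P2) /le_trans; apply.
have -> : 4 * (2 * nm z / N ^+ 2) * (N - - N + (N - - N)) = (32 * nm z) / N.
  by field; rewrite lt0r_neq0.
rewrite ler_pdivrMr// [e * N]mulrC -ler_pdivrMr//.
by rewrite /N lerDr addr_ge0// mulr_ge0.
Qed.

Lemma im_sint1 g (p : C) a b :
  complex.Im (sint g p 1 a b) = rint (fun t => complex.Im (g (p + t%:C * 1))) a b.
Proof. by rewrite /sint mul1r. Qed.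

Lemma im_sinti g (p : C) a b :
  complex.Im (sint g p 'i a b) = rint (fun t => complex.Re (g (p + t%:C * 'i))) a b.
Proof. by rewrite /sint mulrC ImiRe. Qed.

(** Each of the four sides contributes the integral of 1 / (t^2 + 1) over [-1, 1] to the imaginary
    part, and that integrand is at least 1/2. *)
Lemma kc_neq0 : kc != 0.
Proof.
pose v (t : R) := (t ^+ 2 + 1)^-1.
have vpos (t : R) : 0 < t ^+ 2 + 1 by have := sqr_ge0 t; lra.
have ImE : complex.Im kc = 4 * rint v (-1) 1.
  rewrite /kc /rectint cimB cimB cimD !im_sint1 !im_sinti.
  have E1 : (fun t : R => complex.Im ('i * (-1)%:C + t%:C * 1 : C)^-1) = v.
    by apply/funext => t; rewrite hptE /= /v; field; rewrite lt0r_neq0.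
  have E2 : (fun t : R => complex.Re (1%:C + t%:C * 'i : C)^-1) = v.
    by apply/funext => t; rewrite vptE /= /v; field; rewrite lt0r_neq0.
  have E3 : (fun t : R => complex.Im ('i * 1%:C + t%:C * 1 : C)^-1) = fun t => -1 * v t.
    by apply/funext => t; rewrite hptE /= /v; field; rewrite lt0r_neq0.
  have E4 : (fun t : R => complex.Re ((-1)%:C + t%:C * 'i : C)^-1) = fun t => -1 * v t.
    by apply/funext => t; rewrite vptE /= /v; field; rewrite lt0r_neq0.
  rewrite E1 E2 E3 E4.
  have cv : rcont v (-1) 1.
    move=> t _; apply: cvgV; first by rewrite lt0r_neq0.
    apply: cvgD; last exact: cvg_cst.
    exact: exprn_continuous.
  rewrite !rintZ//; ring.
have cv : rcont v (-1) 1.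
  move=> t _; apply: cvgV; first by rewrite lt0r_neq0.
  apply: cvgD; last exact: cvg_cst.
  exact: exprn_continuous.
have v2 t : -1 <= t <= 1 -> 1 / 2 <= v t.
  move=> /andP[t1 t2]; rewrite div1r lef_pV2 ?posrE//.
  suff : t ^+ 2 <= 1 by lra.
  by rewrite expr2; nra.
have N1 : (-1 : R) <= 1 by lra.
have := rint_ge N1 cv v2; rewrite (_ : 1 / 2 * (1 - -1) = 1); last by field.
move=> h; apply/eqP => k0; move: ImE; rewrite k0 /= => E; move: h; lra.
Qed.

(** Residue form: subtracting k / (w - z) leaves a removable singularity. In this generality it
    serves both for f / (w - z) and for g phi' / (phi - phi z) with phi injective. *)
Lemma cauchy_gen g a b c d x y k : pdom g a b c d (x +i* y) -> a < x < b -> c < y < d ->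
  (forall e : R, 0 < e -> exists2 r : R, 0 < r & forall w, w != x +i* y ->
     nm (w - (x +i* y)) < r -> nm ((w - (x +i* y)) * g w - k) <= e) ->
  rectint g a b c d = kc * k.
Proof.
set z := x +i* y => h ab cd lim.
pose q w := k * (w - z)^-1.
have hq : pdom q a b c d z.
  move=> s t sab tcd wz; apply: cder_mul; first exact: cder_cst.
  exact: (pdom_inv _ _ _ _ z s t sab tcd wz).
have hs : pdom (fun w => g w - q w) a b c d z.
  move=> s t sab tcd wz; apply: cder_sub; first exact: h.
  exact: hq.
have rg := pdom_rctn h ab cd; have rq := pdom_rctn hq ab cd.
have E : rectint (fun w => g w - q w) a b c d = 0.
  apply: (rectint_exc0 hs ab cd) => e /lim[r r0 rP]; exists r => // w wz wr.
  have wz0 : w - z != 0 by rewrite subr_eq0.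
  have -> : (w - z) * (g w - q w) = (w - z) * g w - k by rewrite /q; field.
  exact: rP.
move: E; rewrite rectintB// => /eqP; rewrite subr_eq0 => /eqP ->.
rewrite /q rectintZ; last exact: (pdom_rctn (pdom_inv a b c d z)).
by rewrite rectint_kernel// mulrC.
Qed.

Lemma cauchy_formula f a b c d x y : indom f a b c d -> a < x < b -> c < y < d ->
  rectint (fun w => f w / (w - (x +i* y))) a b c d = kc * f (x +i* y).
Proof.
move=> h ab cd; set z := x +i* y.
have [/andP[ax xb] /andP[cy yd]] := conj ab cd.
have cz : cder f z by apply: h; rewrite !ltW.
have hp : pdom (fun w => f w / (w - z)) a b c d z.
  move=> s t sab tcd wz.
  exact: cder_mul (h s t sab tcd) (pdom_inv _ _ _ _ z s t sab tcd wz).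
apply: (cauchy_gen hp ab cd) => e e0; have /ctnP/(_ e e0)[r r0 rP] := cder_ctn cz.
exists r => // w wz /rP/ltW; rewrite -/z.
have wz0 : w - z != 0 by rewrite subr_eq0.
by have -> : (w - z) * (f w / (w - z)) = f w by field.
Qed.

End Cauchy.

(** * Integrals depending on a parameter *)

Section ParametricIntegral.
Variable R : realType.
Local Notation C := R[i].
Implicit Types (f g h L k : C -> C) (z w p d : C) (a b c r x y : R).

Lemma rcont_nm (u : R -> C) a b : ccont u a b -> rcont (fun t => nm (u t)) a b.
Proof.
move=> cu t tab; apply/continuous_atP => e /(cu t tab)[d d0 dP]; exists d => // s /dP.
apply: le_lt_trans; rewrite ler_norml; apply/andP; split.
  by rewrite lerBrDr addrC lerBlDr nm_sym addrC -lerBlDr lerBlDr addrC nm_leD.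
by rewrite lerBlDr addrC nm_leD.
Qed.

Lemma scont_bounded g p d a b : scont g p d a b ->
  exists2 M : R, 0 <= M & forall t, a <= t <= b -> nm (g (p + t%:C * d)) <= M.
Proof.
move=> cg; have [ab|ba] := leP a b; last first.
  by exists 0 => // t /andP[h1 h2]; move: (le_trans h1 h2); rewrite leNgt ba.
have /rcont_within cw := rcont_nm (scont_ccont cg).
have [t0 t0ab tM] := EVT_max ab cw.
exists (nm (g (p + t0%:C * d))); first exact: nm_ge0.
by move=> t tab; apply: tM; rewrite in_itv.
Qed.

Lemma scont_away g w p d a b : scont g p d a b ->
  (forall t, a <= t <= b -> g (p + t%:C * d) != w) ->
  exists2 m : R, 0 < m & forall t, a <= t <= b -> m <= nm (g (p + t%:C * d) - w).
Proof.
move=> cg gw; have [ab|ba] := leP a b; last first.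
  by exists 1 => // t /andP[h1 h2]; move: (le_trans h1 h2); rewrite leNgt ba.
have cgw : scont (fun z => g z - w) p d a b.
  by move=> t tab; apply: ctn_sub (cg t tab) (ctn_cst w _).
have /rcont_within cw := rcont_nm (scont_ccont cgw).
have [t0 t0ab tM] := EVT_min ab cw.
exists (nm (g (p + t0%:C * d) - w)).
  by rewrite nm_gt0 subr_eq0 gw//; move: t0ab; rewrite in_itv.
by move=> t tab; apply: tM; rewrite in_itv.
Qed.

(* A second-order Taylor bound; k1 is minus the derivative of k. *)
Definition kernel (k k1 : C -> C) := forall m : R, 0 < m -> exists2 B : R, 0 <= B &
  forall u s, m <= nm u -> nm s <= m / 2 -> nm (k (u - s) - k u - s * k1 u) <= B * nm s ^+ 2.

Lemma kernel1 : kernel (fun u => u^-1) (fun u => u ^- 2).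
Proof.
move=> m m0; exists (2 / m ^+ 3); first by rewrite divr_ge0// exprn_ge0// ltW.
move=> u s mu sm.
have h : m / 2 <= nm (u - s).
  by have := nm_leD u s; move: mu sm; move: (nm u) (nm s) (nm _); clear => *; lra.
have m2 : 0 < m / 2 by rewrite divr_gt0.
have u0 : u != 0 by rewrite -nm_gt0 (lt_le_trans m0).
have us0 : u - s != 0 by rewrite -nm_gt0 (lt_le_trans m2).
have -> : (u - s)^-1 - u^-1 - s * u ^- 2 = s ^+ 2 * ((u - s)^-1 * u^-1 ^+ 2).
  by field; rewrite u0.
rewrite nmM nmX mulrC ler_wpM2r ?exprn_ge0 ?nm_ge0// nmM nmX !nmV.
have -> : 2 / m ^+ 3 = (m / 2)^-1 * m^-1 ^+ 2 by field; rewrite lt0r_neq0.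
have i1 : (nm (u - s))^-1 <= (m / 2)^-1 by rewrite lef_pV2 ?posrE ?nm_gt0.
have i2 : (nm u)^-1 <= m^-1 by rewrite lef_pV2 ?posrE ?nm_gt0.
apply: (ler_pM _ _ i1); rewrite ?exprn_ge0 ?invr_ge0 ?nm_ge0//.
by rewrite lerXn2r ?nnegrE ?invr_ge0 ?nm_ge0// ltW.
Qed.

Lemma kernel2 : kernel (fun u => u ^- 2) (fun u => 2 * u ^- 3).
Proof.
(* The remainder is s^2 (3 - 2 s / u) u^-2 (u - s)^-2; the bracket is at most 4, and |u - s| >= m /
   2 gives another factor 4. *)
move=> m m0; exists (16 / m ^+ 4); first by rewrite divr_ge0// exprn_ge0// ltW.
move=> u s mu sm.
have h : m / 2 <= nm (u - s).
  by have := nm_leD u s; move: mu sm; move: (nm u) (nm s) (nm _); clear => *; lra.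
have m2 : 0 < m / 2 by rewrite divr_gt0.
have u0 : u != 0 by rewrite -nm_gt0 (lt_le_trans m0).
have us0 : u - s != 0 by rewrite -nm_gt0 (lt_le_trans m2).
have -> : (u - s) ^- 2 - u ^- 2 - s * (2 * u ^- 3) =
   s ^+ 2 * ((3 - 2 * (s / u)) * (u^-1 ^+ 2 * (u - s)^-1 ^+ 2)).
  by field; rewrite ?us0 ?u0.
rewrite nmM nmX mulrC ler_wpM2r ?exprn_ge0 ?nm_ge0//.
have -> : 16 / m ^+ 4 = 4 * (m^-1 ^+ 2 * (m / 2)^-1 ^+ 2) by field; rewrite lt0r_neq0.
have i1 : (nm (u - s))^-1 <= (m / 2)^-1 by rewrite lef_pV2 ?posrE ?nm_gt0.
have i2 : (nm u)^-1 <= m^-1 by rewrite lef_pV2 ?posrE ?nm_gt0.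
have sq (x y : R) : 0 <= x -> x <= y -> x ^+ 2 <= y ^+ 2.
  by move=> x0 xy; rewrite lerXn2r ?nnegrE// (le_trans x0).
rewrite nmM nmM !nmX !nmV; apply: ler_pM; rewrite ?mulr_ge0 ?exprn_ge0 ?invr_ge0 ?nm_ge0//.
  apply: (le_trans (nmB _ _)); rewrite !nmM nmV.
  have -> : nm (3 : C) = 3 by rewrite (_ : 3 = (3 : R)%:C) ?nm_real ?ger0_norm// rmorphMn.
  have -> : nm (2 : C) = 2 by rewrite (_ : 2 = (2 : R)%:C) ?nm_real ?ger0_norm// rmorphMn.
  have : nm s / nm u <= 1 / 2.
    rewrite ler_pdivrMr ?nm_gt0//; move: mu sm; move: (nm s) (nm u); clear => *; lra.
  by set q := nm s / nm u; move: q => q hq; lra.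
apply: ler_pM; rewrite ?exprn_ge0 ?invr_ge0 ?nm_ge0//.
  by apply: sq => //; rewrite invr_ge0 nm_ge0.
by apply: sq => //; rewrite invr_ge0 nm_ge0.
Qed.

Definition kctn (k : C -> C) := forall u, u != 0 -> ctn k u.

Lemma scont_kernel k h g p d a b w : kctn k -> scont h p d a b -> scont g p d a b ->
  (forall t, a <= t <= b -> g (p + t%:C * d) != w) ->
  scont (fun z => h z * k (g z - w)) p d a b.
Proof.
move=> ck ch cg gw t tab; apply: ctn_mul (ch t tab) _.
apply: ctn_comp (ctn_sub (cg t tab) (ctn_cst w _)) _.
by apply: ck; rewrite subr_eq0 gw.
Qed.

(** Differentiation under the integral sign. On the compact segment g keeps a distance m from w, so
    the second-order bound of the kernel is uniform and integrates to a multiple of |v - w|^2. The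
    inner function g is the identity in Cauchy's formula and phi in the inversion of phi. *)
Lemma sint_param k (k1 : C -> C) h g p d a b w : a <= b -> kernel k k1 -> kctn k -> kctn k1 ->
  scont h p d a b -> scont g p d a b ->
  (forall t, a <= t <= b -> g (p + t%:C * d) != w) ->
  iscder (fun v => sint (fun z => h z * k (g z - v)) p d a b) w
         (sint (fun z => h z * k1 (g z - w)) p d a b).
Proof.
move=> ab K ck ck1 ch cg gw.
have [M M0 MP] := scont_bounded ch.
have [m m0 mP] := scont_away cg gw.
have [B B0 BP] := K m m0.
have m2 : 0 < m / 2 by rewrite divr_gt0.
pose N := nm d * (2 * (M * B) * (b - a)).
have N0 : 0 <= N by rewrite !mulr_ge0 ?nm_ge0// subr_ge0.
have N1 : 0 < N + 1 by rewrite ltr_wpDl.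
apply/iscderP => e e0; exists (Num.min (m / 2) (e / (N + 1))).
  by rewrite lt_min m2 divr_gt0.
move=> v; rewrite lt_min => /andP[v1 v2].
have gv t : a <= t <= b -> g (p + t%:C * d) != v.
  move=> tab; apply/negP => /eqP E; have := mP t tab; rewrite E leNgt => /negP; apply.
  by apply: (lt_le_trans v1); rewrite ler_pdivrMr// ler_peMr ?ltW// ltr1n.
have s1 := scont_kernel ck ch cg gv; have s2 := scont_kernel ck ch cg gw.
have s3 := scont_kernel ck1 ch cg gw.
have s4 : scont (fun z => h z * k (g z - v) - h z * k (g z - w)
    - (v - w) * (h z * k1 (g z - w))) p d a b.
  move=> t tab; apply: ctn_sub (ctn_sub (s1 t tab) (s2 t tab)) _.
  exact: ctn_mul (ctn_cst _ _) (s3 t tab).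
have s12 : scont (fun z => h z * k (g z - v) - h z * k (g z - w)) p d a b.
  by move=> t tab; exact: ctn_sub (s1 t tab) (s2 t tab).
have s3' : scont (fun z => (v - w) * (h z * k1 (g z - w))) p d a b.
  by move=> t tab; exact: ctn_mul (ctn_cst _ _) (s3 t tab).
cbv beta; rewrite -(sintB s1 s2) [X in _ - X]mulrC -(sintZ (v - w) s3) -(sintB s12 s3').
have := sint_bound (M := M * B * nm (v - w) ^+ 2) ab s4.
have P t : a <= t <= b -> nm (h (p + t%:C * d) * k (g (p + t%:C * d) - v)
   - h (p + t%:C * d) * k (g (p + t%:C * d) - w)
    - (v - w) * (h (p + t%:C * d) * k1 (g (p + t%:C * d) - w))) <= M * B * nm (v - w) ^+ 2.
  move=> tab; have := BP (g (p + t%:C * d) - w) (v - w) (mP t tab) (ltW v1).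
  have -> : g (p + t%:C * d) - w - (v - w) = g (p + t%:C * d) - v by ring.
  move=> H.
  have -> : h (p + t%:C * d) * k (g (p + t%:C * d) - v)
   - h (p + t%:C * d) * k (g (p + t%:C * d) - w)
    - (v - w) * (h (p + t%:C * d) * k1 (g (p + t%:C * d) - w)) =
   h (p + t%:C * d) * (k (g (p + t%:C * d) - v) - k (g (p + t%:C * d) - w)
     - (v - w) * k1 (g (p + t%:C * d) - w)) by ring.
  by rewrite nmM -mulrA; apply: ler_pM; rewrite ?nm_ge0// MP.
move=> /(_ P) /le_trans; apply.
have -> : nm d * (2 * (M * B * nm (v - w) ^+ 2) * (b - a)) = N * nm (v - w) * nm (v - w).
  by rewrite /N; ring.
rewrite ler_wpM2r ?nm_ge0//.
move: v2; rewrite ltr_pdivlMr// => /ltW; apply: le_trans.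
by rewrite mulrC ler_wpM2l ?nm_ge0// lerDl ler01.
Qed.

Definition offbd g a b c (d : R) w :=
  (forall t, a <= t <= b -> g (t +i* c) != w /\ g (t +i* d) != w) /\
  (forall t, c <= t <= d -> g (a +i* t) != w /\ g (b +i* t) != w).

Lemma rect_param k (k1 : C -> C) h g a b c (d : R) w : a <= b -> c <= d -> kernel k k1 -> kctn k -> kctn k1 ->
  rctn h a b c d -> rctn g a b c d -> offbd g a b c d w ->
  iscder (fun v => rectint (fun z => h z * k (g z - v)) a b c d) w
         (rectint (fun z => h z * k1 (g z - w)) a b c d).
Proof.
move=> ab cd K ck ck1 rh rg o; have [h1 h2 h3 h4] := rctn_sctn rh.
have [g1 g2 g3 g4] := rctn_sctn rg; have [e1 e2] := o.
rewrite /rectint; apply: iscder_sub; last first.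
  by apply: sint_param => // t tab; rewrite vptE; case: (e2 t tab).
apply: iscder_sub; last first.
  by apply: sint_param => // t tab; rewrite hptE; case: (e1 t tab).
apply: iscder_add; last first.
  by apply: sint_param => // t tab; rewrite vptE; case: (e2 t tab).
by apply: sint_param => // t tab; rewrite hptE; case: (e1 t tab).
Qed.

Lemma kctn1 : kctn (fun u => u^-1).
Proof. by move=> u u0; exact: ctn_inv u0 (ctn_id u). Qed.

Lemma kctn2 : kctn (fun u => u ^- 2).
Proof.
move=> u u0; have -> : (fun u : C => u ^- 2) = fun u => (u * u)^-1.
  by apply/funext => v; rewrite expr2.
exact: (@ctn_inv _ (fun u => u * u) u (mulf_neq0 u0 u0) (ctn_mul (ctn_id u) (ctn_id u))).
Qed.

Lemma kctn3 : kctn (fun u => 2 * u ^- 3).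
Proof.
move=> u u0; have -> : (fun u : C => 2 * u ^- 3) = fun u => 2 * (u * u * u)^-1.
  by apply/funext => v; rewrite exprSr expr2.
apply: (@ctn_mul _ (fun=> 2) (fun u => (u * u * u)^-1) u (ctn_cst 2 u)).
apply: (@ctn_inv _ (fun u => u * u * u) u (mulf_neq0 (mulf_neq0 u0 u0) u0)).
exact: (ctn_mul (ctn_mul (ctn_id u) (ctn_id u)) (ctn_id u)).
Qed.

Lemma cauchy_param h g a b c (d : R) w : a <= b -> c <= d ->
  rctn h a b c d -> rctn g a b c d -> offbd g a b c d w ->
  iscder (fun v => rectint (fun z => h z / (g z - v)) a b c d) w
         (rectint (fun z => h z * (g z - w) ^- 2) a b c d).
Proof.
by move=> ab cd ch cg o; apply: (rect_param ab cd kernel1 kctn1 kctn2).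
Qed.

Lemma cauchy_param2 h g a b c (d : R) w : a <= b -> c <= d ->
  rctn h a b c d -> rctn g a b c d -> offbd g a b c d w ->
  cder (fun v => rectint (fun z => h z * (g z - v) ^- 2) a b c d) w.
Proof.
by move=> ab cd ch cg o; apply: iscder_der (rect_param ab cd kernel2 kctn2 kctn3 ch cg o).
Qed.

End ParametricIntegral.

(** * Derivatives and locally uniform limits of holomorphic functions *)

Section Holomorphy.
Variable R : realType.
Local Notation C := R[i].
Implicit Types (f g h L : C -> C) (z w : C) (a b c d r x y : R) (G : set (Cplx R)).

(* Opaque, so that unification never unfolds a derivative into a limit. *)
Lemma cD_exists : {D : (C -> C) -> C -> C | forall f z, cder f z -> iscder f z (D f z)}.
Proof. by exists (fun f z => 'D_1 (f : Cplx R -> Cplx R) (z : Cplx R)) => f z; exact: derivableP. Qed.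

Definition cD : (C -> C) -> C -> C := sval cD_exists.

Lemma iscderD f z : cder f z -> iscder f z (cD f z).
Proof. exact: (svalP cD_exists). Qed.

Lemma cD_eq f z w : iscder f z w -> cD f z = w.
Proof. by move=> h; apply: iscder_unique (iscderD (iscder_der h)) h. Qed.

Definition sq x y r s t := (x - r <= s <= x + r) && (y - r <= t <= y + r).

Lemma sq_nm x y r s t : sq x y r s t -> nm ((s +i* t) - (x +i* y)) <= 2 * r.
Proof.
case/andP=> /andP[s1 s2] /andP[t1 t2]; apply: (le_trans (nm_ReIm _)) => /=.
rewrite mulrDl mul1r lerD// ler_norml; apply/andP; split; lra.
Qed.

Lemma nm_sq x y r z : nm (z - (x +i* y)) < r ->
  x - r < complex.Re z < x + r /\ y - r < complex.Im z < y + r.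
Proof.
move=> h; have := le_lt_trans (nm_Re _) h; have := le_lt_trans (nm_Im _) h.
rewrite creB cimB /= !ltr_norml => /andP[h1 h2] /andP[h3 h4].
by split; apply/andP; split; lra.
Qed.

Lemma open_sq G z : open G -> G z ->
  exists2 r, 0 < r & forall s t, sq (complex.Re z) (complex.Im z) r s t -> G (s +i* t).
Proof.
move=> /openCP oG /oG[d d0 dP]; exists (d / 4); first by rewrite divr_gt0.
move=> s t /sq_nm h; apply: dP; case: z h => x y /= h; apply: (le_lt_trans h).
by move: d0; clear; lra.
Qed.

Lemma sq_bounds x r : 0 < r -> x - r < x < x + r /\ x - r <= x + r.
Proof. by move=> r0; split; [apply/andP; split|]; lra. Qed.

Lemma complex_eta (z : C) : complex.Re z +i* complex.Im z = z.
Proof. by case: z. Qed.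

Lemma offbd_id a b c d (z : C) : a < complex.Re z < b -> c < complex.Im z < d ->
  offbd (fun w => w) a b c d z.
Proof.
case: z => x y /= /andP[ax xb] /andP[cy yd]; split=> t _; split; apply/negP => /eqP[e1 e2].
- by move: cy; rewrite -e2 ltxx.
- by move: yd; rewrite -e2 ltxx.
- by move: ax; rewrite -e1 ltxx.
- by move: xb; rewrite -e1 ltxx.
Qed.

Lemma rctn_id a b c d : rctn (fun w : C => w) a b c d.
Proof. by split=> t _; split; exact: ctn_id. Qed.

Lemma cauchy_formulaz f a b c d (z : C) : indom f a b c d ->
  a < complex.Re z < b -> c < complex.Im z < d ->
  rectint (fun w => f w / (w - z)) a b c d = kc R * f z.
Proof. by case: z => x y h ab cd; exact: cauchy_formula. Qed.

(** Near z the derivative at v is [kc]^-1 times the integral of f(w) / (w - v)^2, by [cauchy_param],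
    and this integral is again differentiable in v, by [cauchy_param2]. *)
Lemma deriv_cder G f : open G -> (forall z, G z -> cder f z) ->
  forall z, G z -> cder (cD f) z.
Proof.
move=> oG hf z Gz; have [r r0 rP] := open_sq oG Gz.
set x := complex.Re z in rP; set y := complex.Im z in rP.
have hi : indom f (x - r) (x + r) (y - r) (y + r).
  by move=> s t sx ty; apply/hf/rP; rewrite /sq sx ty.
have [_ xx] := sq_bounds x r0; have [_ yy] := sq_bounds y r0.
have rc := indom_rctn xx yy hi.
pose F v := rectint (fun w => f w * (w - v) ^- 2) (x - r) (x + r) (y - r) (y + r).
have near_z v : nm (v - z) < r -> x - r < complex.Re v < x + r /\ y - r < complex.Im v < y + r.
  by move=> vr; apply: nm_sq; rewrite complex_eta.
have off v : nm (v - z) < r -> offbd (fun w => w) (x - r) (x + r) (y - r) (y + r) v.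
  by move=> /near_z[h1 h2]; exact: offbd_id.
have zz : nm (z - z) < r by rewrite subrr nm0.
have cF v : nm (v - z) < r -> cder F v.
  by move=> /off; exact: (cauchy_param2 xx yy rc (rctn_id _ _ _ _)).
have Df v : nm (v - z) < r -> cD f v = (kc R)^-1 * F v.
  move=> vr; apply: cD_eq.
  have r1 : 0 < r - nm (v - z) by rewrite subr_gt0.
  have H := cauchy_param xx yy rc (rctn_id _ _ _ _) (off v vr).
  have H2 := iscder_mul (iscder_cst (kc R)^-1 v) H.
  apply: (iscder_near (d := r - nm (v - z)) r1 _ (iscder_eq H2 _)); last first.
    by rewrite mulr0 addr0.
  move=> w wv /=; have wr : nm (w - z) < r.
    by apply: (le_lt_trans (nm_tri w v z)); rewrite -ltrBrDr.
  have [h1 h2] := near_z w wr.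
  by rewrite (cauchy_formulaz hi h1 h2) mulKf// kc_neq0.
apply: (cder_near (f := fun v => (kc R)^-1 * F v) r0); last first.
  exact: cder_mul (cder_cst _ _) (cF z zz).
by move=> w /Df ->.
Qed.

Lemma rctn_kernel h a b c d (z : C) : rctn h a b c d ->
  a < complex.Re z < b -> c < complex.Im z < d ->
  rctn (fun w => h w / (w - z)) a b c d.
Proof.
move=> [h1 h2] ab cd; have [e1 e2] := offbd_id ab cd.
have K w : w != z -> ctn h w -> ctn (fun w => h w / (w - z)) w.
  move=> wz ch; have wz0 : w - z != 0 by rewrite subr_eq0.
  exact: (ctn_mul ch (@ctn_inv _ (fun w => w - z) w wz0 (ctn_sub (ctn_id w) (ctn_cst z w)))).
by split=> t tab; split; apply: K;
  [exact: (e1 t tab).1|exact: (h1 t tab).1|exact: (e1 t tab).2|exact: (h1 t tab).2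
  |exact: (e2 t tab).1|exact: (h2 t tab).1|exact: (e2 t tab).2|exact: (h2 t tab).2].
Qed.

Lemma rect_away g a b c d w : rctn g a b c d -> offbd g a b c d w ->
  exists2 m : R, 0 < m & (forall t, a <= t <= b ->
        m <= nm (g (t +i* c) - w) /\ m <= nm (g (t +i* d) - w)) /\
      (forall t, c <= t <= d -> m <= nm (g (a +i* t) - w) /\ m <= nm (g (b +i* t) - w)).
Proof.
move=> rg [e1 e2]; have [i1 i2 i3 i4] := rctn_sctn rg.
have u1 t : a <= t <= b -> g ('i * c%:C + t%:C * 1) != w.
  by move=> t12; rewrite hptE; exact: (e1 t t12).1.
have u2 t : c <= t <= d -> g (b%:C + t%:C * 'i) != w.
  by move=> t12; rewrite vptE; exact: (e2 t t12).2.
have u3 t : a <= t <= b -> g ('i * d%:C + t%:C * 1) != w.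
  by move=> t12; rewrite hptE; exact: (e1 t t12).2.
have u4 t : c <= t <= d -> g (a%:C + t%:C * 'i) != w.
  by move=> t12; rewrite vptE; exact: (e2 t t12).1.
have [m1 m10 m1P] := scont_away i1 u1; have [m2 m20 m2P] := scont_away i2 u2.
have [m3 m30 m3P] := scont_away i3 u3; have [m4 m40 m4P] := scont_away i4 u4.
exists (Num.min (Num.min m1 m2) (Num.min m3 m4)); first by rewrite !lt_min m10 m20 m30.
split=> t tx; rewrite !ge_min.
  by have := m1P t tx; have := m3P t tx; rewrite !hptE => -> ->; rewrite !orbT.
by have := m2P t tx; have := m4P t tx; rewrite !vptE => -> ->; rewrite !orbT.
Qed.

(** A uniform limit is continuous, and Cauchy's formula passes to the limit on a small square. So
    near z the function is a Cauchy integral with a continuous density, which is differentiable. *)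
Lemma weierstrass f z r : 0 < r ->
  (forall e, 0 < e -> exists g, forall w, nm (w - z) < r -> cder g w /\ nm (f w - g w) <= e) ->
  cder f z.
Proof.
move=> r0 lim; set x := complex.Re z; set y := complex.Im z.
(* The closed square of half side q lies within distance 2 q of z, hence inside the disc of radius
   r. *)
pose q := r / 4.
have q0 : 0 < q by rewrite divr_gt0.
have zE : z = x +i* y by rewrite complex_eta.
have inQ s t : sq x y q s t -> nm ((s +i* t) - z) < r.
  by move=> /sq_nm; rewrite -zE => h; apply: (le_lt_trans h); rewrite /q; move: r0; clear; lra.
have cf w : nm (w - z) < r -> ctn f w.
  move=> wr; apply/ctnP => e e0.
  have e3 : 0 < e / 4 by rewrite divr_gt0.
  have [g gP] := lim _ e3; have [/cder_ctn/ctnP/(_ _ e3)[d d0 dP] gw] := gP w wr.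
  exists (Num.min d (r - nm (w - z))); first by rewrite lt_min d0 subr_gt0.
  move=> v; rewrite lt_min => /andP[/dP vd vr].
  have [_ gv] : cder g v /\ nm (f v - g v) <= e / 4.
    by apply: gP; apply: (le_lt_trans (nm_tri v w z)); rewrite -ltrBrDr.
  have -> : f v - f w = (f v - g v) + (g v - g w) + (g w - f w) by ring.
  apply: (le_lt_trans (nmD _ _)); rewrite [nm (g w - f w)]nm_sym.
  apply: (le_lt_trans (lerD (nmD _ _) (lexx _))).
  move: e0 vd gv gw; move: (nm _) (nm _) (nm _); clear => *; lra.
have [hx xx] := sq_bounds x q0; have [hy yy] := sq_bounds y q0.
have rcf : rctn f (x - q) (x + q) (y - q) (y + q).
  by split=> t tx; split; apply/cf/inQ; rewrite /sq tx ?lexx ?xx ?yy.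
have near_z v : nm (v - z) < q -> x - q < complex.Re v < x + q /\ y - q < complex.Im v < y + q.
  by move=> vr; apply: nm_sq; rewrite complex_eta.
have zz : nm (z - z) < q by rewrite subrr nm0.
have [hx' hy'] := near_z z zz.
have H := cauchy_param xx yy rcf (rctn_id _ _ _ _) (offbd_id hx' hy').
have key v : nm (v - z) < q ->
    (kc R)^-1 * rectint (fun w => f w / (w - v)) (x - q) (x + q) (y - q) (y + q) = f v.
  move=> vq; have [vx vy] := near_z v vq.
  have [m m0 [mP1 mP2]] := rect_away (rctn_id _ _ _ _) (offbd_id vx vy).
  have rk := rctn_kernel rcf vx vy.
  have vr : nm (v - z) < r by apply: (lt_le_trans vq); rewrite /q; move: r0; clear; lra.
  suff -> : rectint (fun w => f w / (w - v)) (x - q) (x + q) (y - q) (y + q) = kc R * f v.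
    by rewrite mulKf// kc_neq0.
  apply/eqP; rewrite -subr_eq0 -nm_eq0 eq_le nm_ge0 andbT.
  apply/ler_addgt0Pr => e e0; rewrite add0r.
  (* The first summand accounts for the contour integral of (f - g) / (w - v), bounded by 4 * (e / M
     / m) * 4 q; the second for the error of g at v itself. *)
  pose M := 16 * q / m + nm (kc R).
  have M0 : 0 < M by rewrite /M ltr_wpDr ?nm_ge0// divr_gt0// mulr_gt0.
  have e1 : 0 < e / M by rewrite divr_gt0.
  have [g gP] := lim _ e1.
  have hg : indom g (x - q) (x + q) (y - q) (y + q).
    by move=> s t sx ty; have [] := gP _ (inQ s t _) => //; rewrite /sq sx ty.
  have rg := rctn_kernel (indom_rctn xx yy hg) vx vy.
  have E : rectint (fun w => f w / (w - v)) (x - q) (x + q) (y - q) (y + q) - kc R * f v =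
    rectint (fun w => f w / (w - v) - g w / (w - v)) (x - q) (x + q) (y - q) (y + q)
     - kc R * (f v - g v).
    by rewrite (rectintB rk rg) (cauchy_formulaz hg vx vy); ring.
  rewrite E; apply: (le_trans (nmB _ _)); rewrite nmM.
  have [_ fgv] := gP v vr.
  have B1 w : nm (w - z) < r -> m <= nm (w - v) -> nm (f w / (w - v) - g w / (w - v)) <= e / M / m.
    move=> wr mw; have [_ fgw] := gP w wr.
    rewrite -mulrBl nmM nmV; apply: ler_pM; rewrite ?invr_ge0 ?nm_ge0//.
    by rewrite lef_pV2 ?posrE// (lt_le_trans m0 mw).
  have P1 t : x - q <= t <= x + q ->
     nm (f (t +i* (y - q)) / (t +i* (y - q) - v) - g (t +i* (y - q)) / (t +i* (y - q) - v)) <= e / M / m /\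
     nm (f (t +i* (y + q)) / (t +i* (y + q) - v) - g (t +i* (y + q)) / (t +i* (y + q) - v)) <= e / M / m.
    move=> tx; have [k1 k2] := mP1 t tx.
    by split; apply: B1 => //; apply: inQ; rewrite /sq tx ?lexx ?yy.
  have P2 t : y - q <= t <= y + q ->
     nm (f ((x - q) +i* t) / ((x - q) +i* t - v) - g ((x - q) +i* t) / ((x - q) +i* t - v)) <= e / M / m /\
     nm (f ((x + q) +i* t) / ((x + q) +i* t - v) - g ((x + q) +i* t) / ((x + q) +i* t - v)) <= e / M / m.
    move=> tx; have [k1 k2] := mP2 t tx.
    by split; apply: B1 => //; apply: inQ; rewrite /sq tx ?lexx ?xx.
  have := rectint_bound xx yy (rctn_sub rk rg) P1 P2.
  move=> B2; apply: (le_trans (lerD B2 (ler_wpM2l (nm_ge0 _) fgv))).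
  have -> : 4 * (e / M / m) * (x + q - (x - q) + (y + q - (y - q))) + nm (kc R) * (e / M) =
     e / M * M by rewrite {4}/M; field; rewrite !lt0r_neq0.
  by rewrite divfK// lt0r_neq0.
apply: (cder_near (f := fun v => (kc R)^-1 * rectint (fun w => f w / (w - v))
   (x - q) (x + q) (y - q) (y + q)) q0 key).
exact: (cder_mul (cder_cst _ _) (iscder_der H)).
Qed.

End Holomorphy.

(** * Inverses of injective holomorphic functions *)

Section InverseFunction.
Variable R : realType.
Local Notation C := R[i].
Implicit Types (f g h : C -> C) (z w : C) (a b c d r x y : R) (G : set (Cplx R)).

Lemma ctn_slope f z k : iscder f z k ->
  ctn (fun w => if w == z then k else (f w - f z) / (w - z)) z.
Proof.
move=> /iscderP h; apply/ctnP => e e0.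
have e2 : 0 < e / 2 by rewrite divr_gt0.
have [r r0 rP] := h _ e2; exists r => // w wr; rewrite eqxx.
case: eqVneq => [_|wz]; first by rewrite subrr nm0.
have wz0 : w - z != 0 by rewrite subr_eq0.
have -> : (f w - f z) / (w - z) - k = (f w - f z - k * (w - z)) / (w - z) by field.
rewrite nmM nmV ltr_pdivrMr ?nm_gt0//; apply: (le_lt_trans (rP w wr)).
by rewrite ltr_pM2r ?nm_gt0// ltr_pdivrMr// ltr_pMr// ltr1n.
Qed.

(** Its use is to contradict injectivity: an injective holomorphic function has points with nonzero
    derivative arbitrarily close to any given point. *)
Lemma zero_deriv_step f z r : 0 < r -> (forall w, nm (w - z) < r -> iscder f w 0) ->
  f (z + (r / 2)%:C) = f z.
Proof.
move=> r0 h.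
have s0 : scont (fun=> 0 : C) z 1 0 (r / 2) by move=> t _; exact: ctn_cst.
have r2 : 0 <= r / 2 by rewrite divr_ge0// ltW.
have D t : 0 <= t <= r / 2 -> iscder f (z + t%:C * 1) 0.
  move=> /andP[t0 tr]; apply: h; rewrite mulr1 addrAC subrr add0r nm_real ger0_norm//.
  by apply: (le_lt_trans tr); move: r0; clear; lra.
have E := sint_FTC r2 s0 D.
have Z : sint (fun=> 0 : C) z 1 0 (r / 2) = 0.
  apply/eqP; rewrite -nm_eq0 eq_le nm_ge0 andbT.
  have := sint_bound (M := 0) r2 s0; rewrite nm1 mul1r mulr0 mul0r; apply.
  by move=> t _; rewrite nm0.
by apply/eqP; rewrite -subr_eq0 -Z E mulr1 mul0r addr0.
Qed.

Section InverseLocal.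
Variables (G : set (Cplx R)) (phi : C -> C).
Hypothesis oG : open G.
Hypothesis hphi : forall z, G z -> cder phi z.
Hypothesis iphi : forall z w, G z -> G w -> phi z = phi w -> z = w.

Variables (x y r : R).
Hypothesis r0 : 0 < r.
Hypothesis inG : forall s t, sq x y r s t -> G (s +i* t).

Let a := x - r. Let b := x + r. Let c := y - r. Let d := y + r.

Let hD z : G z -> cder (cD phi) z.
Proof. exact: deriv_cder. Qed.

Let ab : a <= b. Proof. by have [] := sq_bounds x r0. Qed.
Let cd : c <= d. Proof. by have [] := sq_bounds y r0. Qed.

Let inQ s t : a <= s <= b -> c <= t <= d -> G (s +i* t).
Proof. by move=> sa tc; apply: inG; rewrite /sq sa tc. Qed.

Lemma inj_off z : a < complex.Re z < b -> c < complex.Im z < d -> offbd phi a b c d (phi z).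
Proof.
move=> zx zy; have Gz : G z.
  by rewrite -(complex_eta z); apply: inQ; [case/andP: zx|case/andP: zy] => /ltW -> /ltW ->.
have [e1 e2] := offbd_id zx zy.
split=> t tx; split; apply/negP => /eqP/iphi E.
- by have := (e1 t tx).1; rewrite E ?eqxx//; apply: inQ; rewrite // lexx cd.
- by have := (e1 t tx).2; rewrite E ?eqxx//; apply: inQ; rewrite // lexx cd.
- by have := (e2 t tx).1; rewrite E ?eqxx//; apply: inQ; rewrite // lexx ab.
- by have := (e2 t tx).2; rewrite E ?eqxx//; apply: inQ; rewrite // lexx ab.
Qed.

(** Injectivity makes z the only zero of phi - phi z. As phi'(z) is nonzero it is a simple pole of
    the integrand, with residue g(z), because (phi w - phi z) / (w - z) tends to phi'(z). *)
Lemma inj_cauchy1 g z : (forall w, G w -> cder g w) ->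
  a < complex.Re z < b -> c < complex.Im z < d -> cD phi z != 0 ->
  rectint (fun w => g w * cD phi w / (phi w - phi z)) a b c d = kc R * g z.
Proof.
move=> hg zx zy D0; have Gz : G z.
  by rewrite -(complex_eta z); apply: inQ; [case/andP: zx|case/andP: zy] => /ltW -> /ltW ->.
rewrite -(complex_eta z) in zx zy D0 Gz *.
move: (complex.Re z) (complex.Im z) zx zy D0 Gz => u v /= zx zy D0 Gz; clear z.
set z := u +i* v in D0 Gz *.
have ne w : G w -> w != z -> phi w - phi z != 0.
  by move=> Gw; apply: contra; rewrite subr_eq0 => /eqP/iphi -> //.
have hh w : G w -> w != z -> cder (fun w => g w * cD phi w / (phi w - phi z)) w.
  move=> Gw wz.
  exact: (cder_mul (cder_mul (hg w Gw) (hD Gw))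
    (@cder_inv _ (fun w => phi w - phi z) w (ne w Gw wz)
       (cder_sub (hphi Gw) (cder_cst _ _)))).
have hp : pdom (fun w => g w * cD phi w / (phi w - phi z)) a b c d z.
  by move=> s t sx ty wz; apply: hh => //; exact: inQ.
apply: (cauchy_gen hp zx zy) => e e0.
pose q w := if w == z then cD phi z else (phi w - phi z) / (w - z).
have cq : ctn q z by exact: ctn_slope (iscderD (hphi Gz)).
have qz : q z = cD phi z by rewrite /q eqxx.
have qz0 : q z != 0 by rewrite qz.
have qE w : w != z -> q w = (phi w - phi z) / (w - z) by rewrite /q => /negPf ->.
move: (q) cq qz qz0 qE => {}q cq qz qz0 qE.
have H : ctn (fun w => g w * cD phi w * (q w)^-1) z.
  exact: (ctn_mul (ctn_mul (cder_ctn (hg z Gz)) (cder_ctn (hD Gz))) (ctn_inv qz0 cq)).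
have /ctnP/(_ e e0)[d1 d10 d1P] := H.
have [d2 d20 d2P] := (proj1 (openCP G) oG) z Gz.
exists (Num.min d1 d2); first by rewrite lt_min d10.
move=> w wz; rewrite lt_min => /andP[w1 w2].
have H1 : nm (g w * cD phi w * (q w)^-1 - g z * cD phi z * (q z)^-1) <= e := ltW (d1P w w1).
rewrite qz (mulfK D0) (qE w wz) in H1.
have wz0 : w - z != 0 by rewrite subr_eq0.
have pw0 := ne w (d2P w w2) wz.
suff E : (w - z) * (g w * cD phi w / (phi w - phi z)) =
    g w * cD phi w * ((phi w - phi z) / (w - z))^-1 by rewrite E.
by field; rewrite ?pw0 ?wz0.
Qed.

Let rphi : rctn phi a b c d.
Proof. by apply: indom_rctn ab cd _ => s t sx ty; exact: hphi (inQ sx ty). Qed.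

Let rh g : (forall w, G w -> cder g w) -> rctn (fun w => g w * cD phi w) a b c d.
Proof.
move=> hg; apply: indom_rctn ab cd _ => s t sx ty.
exact: cder_mul (hg _ (inQ sx ty)) (hD (inQ sx ty)).
Qed.

(** Extension of [inj_cauchy1] to possible zeros of phi': both sides are continuous in z, and points
    v with phi'(v) nonzero exist arbitrarily close to z. *)
Lemma inj_cauchy g z : (forall w, G w -> cder g w) ->
  a < complex.Re z < b -> c < complex.Im z < d ->
  rectint (fun w => g w * cD phi w / (phi w - phi z)) a b c d = kc R * g z.
Proof.
move=> hg zx zy; have Gz : G z.
  by rewrite -(complex_eta z); apply: inQ; [case/andP: zx|case/andP: zy] => /ltW -> /ltW ->.
have off := inj_off zx zy.
have cF := iscder_der (cauchy_param ab cd (rh hg) rphi off).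
have cD1 : ctn (fun v => rectint (fun w => g w * cD phi w / (phi w - phi v)) a b c d - kc R * g v) z.
  apply: (ctn_sub (f := fun v => rectint (fun w => g w * cD phi w / (phi w - phi v)) a b c d)
     (g := fun v => kc R * g v)).
    exact: (@ctn_comp _ phi (fun u => rectint (fun w => g w * cD phi w / (phi w - u)) a b c d) z
        (cder_ctn (hphi Gz)) (cder_ctn cF)).
  exact: (ctn_mul (ctn_cst _ _) (cder_ctn (hg z Gz))).
apply/eqP; rewrite -subr_eq0 -nm_eq0 eq_le nm_ge0 andbT.
apply/ler_addgt0Pr => e e0; rewrite add0r.
have /ctnP/(_ e e0)[d1 d10 d1P] := cD1.
have [d2 d20 d2P] := (proj1 (openCP G) oG) z Gz.
case/andP: (zx) => zx1 zx2; case/andP: (zy) => zy1 zy2.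
have [q q0 [h1 h2 h3 h4]] := inner_radius zx zy.
pose m := Num.min (Num.min d1 d2) q.
have m0 : 0 < m by rewrite !lt_min d10 d20.
have [v vm vD] : exists2 v, nm (v - z) < m & cD phi v != 0.
  (* If phi' vanished on the whole disc of radius m, phi would take the same value at z and at z + m
     / 2. *)
  apply: contrapT => N.
  have D0 w : nm (w - z) < m -> iscder phi w 0.
    move=> wm; have Gw : G w by apply: d2P; apply: (lt_le_trans wm); rewrite !ge_min lexx !orbT.
    have [<-|D1] := eqVneq (cD phi w) 0; first exact: iscderD (hphi Gw).
    by exfalso; apply: N; exists w.
  have E := zero_deriv_step m0 D0.
  have m2 : nm (z + (m / 2)%:C - z) < m.
    rewrite addrAC subrr add0r nm_real ger0_norm ?divr_ge0// ?ltW//.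
    by rewrite ltr_pdivrMr// ltr_pMr// ltr1n.
  have Gm : G (z + (m / 2)%:C) by apply: d2P; apply: (lt_le_trans m2); rewrite !ge_min lexx !orbT.
  have := iphi Gm Gz E => /(congr1 (fun w => w - z)); rewrite addrAC subrr add0r.
  by move/(congr1 (@complex.Re R)) => /= /eqP; rewrite gt_eqF// divr_gt0.
have vq : nm (v - z) < q by apply: (lt_le_trans vm); rewrite !ge_min lexx !orbT.
have [vx vy] : a < complex.Re v < b /\ c < complex.Im v < d.
  have [] := @nm_sq _ (complex.Re z) (complex.Im z) q v; first by rewrite complex_eta.
  by move=> /andP[u1 u2] /andP[u3 u4]; split; apply/andP; split;
    [exact: le_lt_trans u1|exact: lt_le_trans h2|exact: le_lt_trans u3|exact: lt_le_trans h4].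
have v1 : nm (v - z) < d1 by apply: (lt_le_trans vm); rewrite !ge_min lexx.
have := d1P v v1; rewrite (inj_cauchy1 hg vx vy vD) subrr sub0r nmN; exact: ltW.
Qed.

(* The inverse is w |-> kc^-1 * oint v phi'(v) / (phi v - w) dv; the same integral without the
   factor v vanishes when w is not a value of phi, by Goursat, and is close to kc near phi z. *)
Lemma inj_local : exists2 e : R, 0 < e & exists psi : C -> C, forall w,
  nm (w - phi (x +i* y)) < e -> [/\ G (psi w), phi (psi w) = w & cder psi w].
Proof.
have zx : a < complex.Re (x +i* y) < b by have [] := sq_bounds x r0.
have zy : c < complex.Im (x +i* y) < d by have [] := sq_bounds y r0.
set z := x +i* y in zx zy *.
have off := inj_off zx zy.
have [m m0 [mP1 mP2]] := rect_away rphi off.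
have off' w : nm (w - phi z) < m -> offbd phi a b c d w.
  move=> wm; split=> t tx; split; apply/negP => /eqP E.
  - by have := (mP1 t tx).1; rewrite E leNgt wm.
  - by have := (mP1 t tx).2; rewrite E leNgt wm.
  - by have := (mP2 t tx).1; rewrite E leNgt wm.
  - by have := (mP2 t tx).2; rewrite E leNgt wm.
pose N w := rectint (fun v => 1 * cD phi v / (phi v - w)) a b c d.
have h1 w : G w -> cder (fun=> 1 : C) w by move=> _; exact: cder_cst.
have Nz : N (phi z) = kc R by rewrite -[RHS]mulr1; exact: (inj_cauchy h1 zx zy).
have cN : ctn N (phi z).
  exact: (cder_ctn (iscder_der (cauchy_param ab cd (rh h1) rphi off))).
have k0 : 0 < nm (kc R) by rewrite nm_gt0 kc_neq0.
have /ctnP/(_ _ k0)[e1 e10 e1P] := cN.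
exists (Num.min m e1); first by rewrite lt_min m0.
exists (fun w => (kc R)^-1 * rectint (fun v => v * cD phi v / (phi v - w)) a b c d).
move=> w; rewrite lt_min => /andP[wm we].
have ow := off' w wm.
have hid u : G u -> cder (fun v : C => v) u by move=> _; exact: cder_id.
have [s [t [sx ty E]]] : exists s t, [/\ a <= s <= b, c <= t <= d & phi (s +i* t) = w].
  apply: contrapT => NE; have := e1P w we.
  have -> : N w = 0.
    apply: goursat ab cd _ => s t sx ty.
    have pw : phi (s +i* t) - w != 0.
      by rewrite subr_eq0; apply/negP => /eqP E; apply: NE; exists s, t.
    have Gst := inQ sx ty.
    exact: (cder_mul (cder_mul (cder_cst 1 _) (hD Gst))
      (@cder_inv _ (fun v => phi v - w) _ pw (cder_sub (hphi Gst) (cder_cst _ _)))).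
  by rewrite Nz sub0r nmN ltxx.
have [sx' ty'] : a < s < b /\ c < t < d.
  have [e2 e3] := ow.
  have sa : s != a by apply/negP => /eqP F; have := (e3 t ty).1; rewrite -F E eqxx.
  have sb : s != b by apply/negP => /eqP F; have := (e3 t ty).2; rewrite -F E eqxx.
  have tc : t != c by apply/negP => /eqP F; have := (e2 s sx).1; rewrite -F E eqxx.
  have td : t != d by apply/negP => /eqP F; have := (e2 s sx).2; rewrite -F E eqxx.
  case/andP: sx => s1 s2; case/andP: ty => t1 t2.
  by split; rewrite !lt_neqAle ?s1 ?s2 ?t1 ?t2 ?sb ?td ?andbT/= 1?eq_sym.
have W := inj_cauchy hid (z := s +i* t) sx' ty'.
rewrite E in W; cbv beta; rewrite W (mulKf (kc_neq0 R)).
split; [exact: inQ | exact: E |].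
exact: (cder_mul (cder_cst _ _) (iscder_der (cauchy_param ab cd (rh hid) rphi ow))).
Qed.

End InverseLocal.

Lemma inj_inverse G phi z0 : open G -> (forall z, G z -> cder phi z) ->
  (forall z w, G z -> G w -> phi z = phi w -> z = w) -> G z0 ->
  exists2 e : R, 0 < e & exists psi : C -> C, forall w,
    nm (w - phi z0) < e -> [/\ G (psi w), phi (psi w) = w & cder psi w].
Proof.
move=> oG hphi iphi Gz; have [r r0 rP] := open_sq oG Gz.
have := inj_local oG hphi iphi r0 rP.
by rewrite complex_eta.
Qed.

End InverseFunction.

(** * Polynomial hulls and Runge's theorem *)

Section PlaneTopology.
Variable R : realType.
Local Notation C := R[i].
Implicit Types (f g h : C -> C) (z w a b : C) (E U W G : set (Cplx R)).

Definition cbounded E := exists M : R, forall z, E z -> nm (z : C) <= M.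

Lemma cboundedS E U : E `<=` U -> cbounded U -> cbounded E.
Proof. by move=> EU [M MP]; exists M => z /EU /MP. Qed.

Lemma cboundedU E U : cbounded E -> cbounded U -> cbounded (E `|` U).
Proof.
move=> [M MP] [N NP]; exists (Num.max M N) => z [/MP|/NP] h; rewrite le_max h ?orbT//.
Qed.

Lemma nm_continuous : continuous (fun z : Cplx R => nm (z : C)).
Proof.
move=> z A /nbhs_ballP[e e0 eA]; apply/nbhsCP; exists e => // w wz; apply: eA.
rewrite -(@ball_normE _ R^o) /= distrC.
apply: le_lt_trans wz; rewrite ler_norml; apply/andP; split.
  by have := nm_leD z w; rewrite (nm_sym z w); move: (nm w) (nm z) (nm _) => *; lra.
by have := nm_leD w z; move: (nm w) (nm z) (nm _) => *; lra.
Qed.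

Lemma compact_cbounded E : compact E -> cbounded E.
Proof.
move=> cE; have [->|/set0P[z0 Ez0]] := eqVneq E set0; first by exists 0.
have [c _ cP] := @compact_EVT_max _ R (fun z : Cplx R => nm (z : C)) E (ex_intro _ z0 Ez0) cE
  (continuous_subspaceT nm_continuous).
by exists (nm (c : C)) => z Ez; apply: cP; rewrite inE.
Qed.

Lemma compact_cclosed E : compact E -> closed E.
Proof. apply: compact_closed; exact: (@norm_hausdorff R[i] (Cplx R)). Qed.

Lemma mkC_continuous : continuous (fun p : R * R => (p.1 +i* p.2 : Cplx R)).
Proof.
move=> [x y] A /nbhsCP[d d0 dA].
have d2 : 0 < d / 2 by rewrite divr_gt0.
exists (ball x (d / 2), ball y (d / 2)).
  by split; apply: nbhsx_ballx.
move=> [u v] [/= xu yv]; apply: dA; apply: (le_lt_trans (nm_ReIm _)) => /=.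
by rewrite (splitr d) ltrD// distrC.
Qed.

Lemma closed_cbounded_compact E : closed E -> cbounded E -> compact E.
Proof.
move=> cE [M MP].
have cK : compact ((fun p : R * R => (p.1 +i* p.2 : Cplx R)) @` (`[- M, M] `*` `[- M, M])).
  apply: continuous_compact; last by apply: compact_setX; exact: segment_compact.
  exact: (continuous_subspaceT mkC_continuous).
apply: (subclosed_compact cE cK) => z /MP zM; exists (complex.Re z, complex.Im z); last by rewrite /= complex_eta.
split; rewrite /= in_itv /= -ler_norml; apply: le_trans zM; [exact: nm_Re | exact: nm_Im].
Qed.

Lemma compact_nbhd E U : compact E -> open U -> E `<=` U ->
  exists2 d : R, 0 < d & forall z w, E z -> nm (w - z) < d -> U w.
Proof.
move=> cE /openCP oU EU.
have := (proj1 (compact_near_coveringP E)) cE R (0^'+)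
  (fun d z => forall w : C, nm (w - z) < d -> U w) _ _.
case.
  move=> z /EU/oU[d d0 dP]; exists (([set v : Cplx R | nm ((v : C) - z) < d / 2]), [set e : R | e < d / 2]).
    split; first by apply/nbhsCP; exists (d / 2) => //; rewrite divr_gt0.
    by apply: nbhs_right_lt; rewrite divr_gt0.
  move=> [v e] [/= vz ed] w wv; apply: dP; apply: (le_lt_trans (nm_tri w v z)).
  by rewrite [d]splitr ltrD// (lt_trans wv).
move=> d /= d0 dP; exists (d / 2); first by rewrite divr_gt0.
have h : ball (0 : R) d (d / 2).
  rewrite -(@ball_normE _ R^o) /= sub0r normrN gtr0_norm ?divr_gt0//.
  by rewrite ltr_pdivrMr// ltr_pMr// ltr1n.
by move=> z w Ez; apply: (dP _ h) => //; rewrite divr_gt0.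
Qed.

Lemma closed_outside E z : closed E -> ~ E z ->
  exists2 d : R, 0 < d & forall w, E w -> d <= nm (w - z).
Proof.
move=> /closed_openC/openCP oE /oE[d d0 dP]; exists d => // w Ew.
by rewrite leNgt; apply/negP => /dP.
Qed.

(** The horizontal line through a point of W is connected, so it would lie in W entirely. *)
Lemma clopen_cbounded W : open W -> closed W -> cbounded W -> W = set0.
Proof.
move=> oW cW [M MP]; apply/seteqP; split => // a Wa; exfalso.
pose l (t : R) : Cplx R := a + t%:C.
have lE (s t : R) : l s - l t = (s - t)%:C :> C by rewrite /l rmorphB; ring.
have cl : continuous l.
  move=> t A /nbhsCP[d d0 dA]; apply/nbhs_ballP; exists d => // s st; apply: dA.
  by rewrite lE nm_real distrC.
have cR : connected [set: R] by apply/connected_intervalP.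
have E : l @^-1` W = setT.
  apply: (cR (l @^-1` W)).
  - by exists 0; rewrite /preimage /= /l addr0.
  - by exists (l @^-1` W); rewrite ?setTI//; apply: open_comp.
  - by exists (l @^-1` W); rewrite ?setTI//; apply: closed_comp.
have M0 : 0 <= M by apply: le_trans (MP _ Wa); exact: nm_ge0.
have a0 := nm_ge0 a; pose t := nm a + M + 1.
have /MP hM : (l @^-1` W) t by rewrite E.
have := nm_leD t%:C (- a); have -> : t%:C - - a = l t by rewrite /l; ring.
rewrite nm_real nmN ger0_norm ?addr_ge0// => h.
by move: (le_trans h (lerD (lexx _) hM)); rewrite /t gerDl ler10.
Qed.

End PlaneTopology.

(** * Separation by polynomials, hulls and holes *)

Section Hull.
Variable R : realType.
Local Notation C := R[i].
Implicit Types (z w a b : C) (E U W G : set (Cplx R)) (p q : {poly R[i]}).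

(* Points separated from E by a polynomial; taking powers, any bound below 1 would do. *)
Definition sep E (a : C) := exists q : {poly R[i]},
  q.[a] = 1 /\ forall z : C, E z -> nm q.[z] <= 1 / 2.

Definition hull E : set (Cplx R) := ~` [set a | sep E a].

(* W is a union of bounded connected components of the complement of E. *)
Definition hole E W := [/\ open W, cbounded W, W `&` E = set0 & closed (W `|` E)].

Definition full E := forall W, hole E W -> W = set0.

Lemma sep_sub E U a : E `<=` U -> sep U a -> sep E a.
Proof. by move=> EU [q [qa qU]]; exists q; split=> // z /EU; exact: qU. Qed.

Lemma hullS E U : E `<=` U -> hull E `<=` hull U.
Proof. by move=> EU z h /(sep_sub EU). Qed.

Lemma sep_notin E a : sep E a -> ~ E a.
Proof.
by move=> [q [qa qE]] /qE; rewrite qa nm1 => h; move: (lt_irreflexive (1 : R)); lra.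
Qed.

Lemma sub_hull E : E `<=` hull E.
Proof. by move=> z Ez /sep_notin. Qed.

Lemma sep_pow E a n : sep E a -> exists q : {poly R[i]},
  q.[a] = 1 /\ forall z : C, E z -> nm q.[z] <= (1 / 2) ^+ n.
Proof.
move=> [q [qa qE]]; exists (q ^+ n); split; first by rewrite horner_exp qa expr1n.
by move=> z /qE h; rewrite horner_exp nmX lerXn2r ?nnegrE ?nm_ge0//; lra.
Qed.

Lemma sep_open E : open ([set a | sep E a] : set (Cplx R)).
Proof.
apply/openCP => a [q [qa qE]].
have /ctnP/(_ (1 / 4))[|d d0 dP] := cder_ctn (cder_horner q a); first by lra.
exists d => // b /dP; rewrite qa => qb.
have qb34 : 3 / 4 <= nm q.[b].
  have := nm_leD 1 q.[b]; rewrite nm1 nm_sym; move: qb; move: (nm _) (nm _) => *; lra.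
have qb0 : 0 < nm q.[b] by lra.
(* Dividing by q(b), of modulus at least 3/4, spoils the bound 1/2 to 2/3; squaring brings it to
   4/9. *)
exists ((q.[b]^-1 *: q) ^+ 2); rewrite horner_exp hornerZ mulVf ?expr1n -?nm_gt0//; split=> // z Ez.
rewrite horner_exp hornerZ nmX nmM nmV.
have : (nm q.[b])^-1 * nm q.[z] <= 2 / 3.
  rewrite mulrC ler_pdivrMr//; have := qE z Ez; move: qb34; move: (nm _) (nm _) => *; lra.
have : 0 <= (nm q.[b])^-1 * nm q.[z] by rewrite mulr_ge0 ?invr_ge0 ?nm_ge0.
by set t := _ * _; move: t => t t0 t1; rewrite expr2; nra.
Qed.

(** Pole pushing in polynomial form. Take q with q(b) = 1 and |q| <= 1/8 on E, write 1 - q = (z - b)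
    r and put u = (a - b) r, an approximation of (a - b) / (z - b). Since q(a) = 1 - u(a), the
    polynomial u^2 + q (1 + u) equals 1 at a. On E one has |u| <= 1/2, hence the bound 1/4 +
    3/16. *)
Lemma sep_push E b a (d : R) : 0 < d -> (forall z, E z -> 3 * d <= nm (z - b)) ->
  nm (a - b) <= d -> sep E b -> sep E a.
Proof.
move=> d0 far ab sb; have [q [qb qE]] := sep_pow 3 sb.
have /factor_theorem[r rE] : root (1 - q) b by rewrite /root hornerD hornerN hornerC qb subrr.
have [u uE] : exists u : {poly R[i]}, forall z, u.[z] = (a - b) * r.[z].
  by exists ((a - b) *: r) => z; rewrite hornerZ.
exists (u ^+ 2 + q * (1 + u)).
have qr z : q.[z] = 1 - (z - b) * r.[z].
  have /(congr1 (fun p => p.[z])) : 1 - q = r * ('X - b%:P) := rE.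
  by rewrite !hornerE => h; rewrite [(z - b) * _]mulrC -h; ring.
split=> [|z Ez].
  rewrite !hornerE qr uE; ring.
have zb : z - b != 0 by rewrite -nm_gt0 (lt_le_trans _ (far z Ez))// mulr_gt0.
have q8 : nm q.[z] <= 1 / 8 by have := qE z Ez; rewrite expr_div_n expr1n; congr (_ <= _ / _); ring.
have uz : nm u.[z] <= 1 / 2.
  have -> : u.[z] = (a - b) * (1 - q.[z]) / (z - b) by rewrite qr uE; field.
  rewrite nmM nmM nmV ler_pdivrMr ?nm_gt0//.
  have h1 : nm (1 - q.[z]) <= 9 / 8 by have := nmB 1 q.[z]; rewrite nm1; lra.
  have := far z Ez; have := ler_pM (nm_ge0 _) (nm_ge0 _) ab h1; lra.
rewrite !hornerE; apply: (le_trans (nmD _ _)); rewrite !nmM ?nmX.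
have h1 : nm (1 + u.[z]) <= 3 / 2 by have := nmD 1 u.[z]; rewrite nm1; lra.
have := ler_pM (nm_ge0 _) (nm_ge0 _) uz uz.
have := ler_pM (nm_ge0 _) (nm_ge0 _) q8 h1; lra.
Qed.

Lemma sep_far E (M : R) a : 0 < M -> (forall z, E z -> nm (z : C) <= M) -> 2 * M <= nm a -> sep E a.
Proof.
move=> M0 EM Ma; have a0 : 0 < nm a by rewrite (lt_le_trans _ Ma)// mulr_gt0.
exists (a^-1 *: 'X); rewrite hornerZ hornerX mulVf -?nm_gt0//; split=> // z /EM zM.
rewrite hornerZ hornerX nmM nmV mulrC ler_pdivrMr//; lra.
Qed.

Lemma hull_cclosed E : closed (hull E).
Proof. exact/open_closedC/sep_open. Qed.

Lemma hull_cbounded E : cbounded E -> cbounded (hull E).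
Proof.
move=> [M MP]; pose N := Num.max M 1.
have N0 : 0 < N by rewrite lt_max ltr01 orbT.
exists (2 * N) => a ha; rewrite leNgt; apply/negP => aN; apply: ha.
apply: (sep_far N0) (ltW aN) => z /MP zM; by rewrite le_max zM.
Qed.

Lemma hull_compact E : compact E -> compact (hull E).
Proof.
by move=> /compact_cbounded/hull_cbounded h; apply: closed_cbounded_compact h; exact: hull_cclosed.
Qed.

(** Near a point a off E all distances to E are comparable, so a separated b close to a would make a
    separated by [sep_push]. *)
Lemma outside_hull_open E : closed E -> open (hull E `\` E).
Proof.
move=> cE; apply/openCP => a [ha Ea]; have [d d0 dP] := closed_outside cE Ea.
exists (d / 4) => [|b ba]; first by rewrite divr_gt0.
have d4 : 0 < d / 4 by rewrite divr_gt0.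
have far z : E z -> 3 * (d / 4) <= nm (z - b).
  move=> /dP; have := nm_tri z b a; move: ba; move: (nm _) (nm _) (nm _) => *; lra.
split; last by move=> /far; rewrite subrr nm0; lra.
move=> sb; apply: ha; apply: (sep_push d4 far) sb.
by rewrite nm_sym ltW.
Qed.

Lemma hull_hole E : compact E -> hole E (hull E `\` E).
Proof.
move=> cE; have clE := compact_cclosed cE; split.
- exact: outside_hull_open.
- by apply: cboundedS (hull_cbounded (compact_cbounded cE)) => z [].
- by apply/seteqP; split => // z [[_ ?]].
- suff -> : hull E `\` E `|` E = hull E by exact: hull_cclosed.
  by rewrite setUC setDUK//; exact: sub_hull.
Qed.

Lemma full_sep E a : compact E -> full E -> ~ E a -> sep E a.
Proof.
move=> cE fE Ea; apply: contrapT => ha.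
have : (hull E `\` E) a by [].
by rewrite (fE _ (hull_hole cE)).
Qed.

(** A nonempty hole is clopen in the connected complement, hence equal to it. The plane would then
    be the union of two bounded sets. *)
Lemma connected_full E : compact E -> connected (~` E) -> full E.
Proof.
move=> cE cc W [oW bW WE cW].
have [//|/set0P W0] := eqVneq W set0; exfalso.
have WnE : W `<=` ~` E by move=> z Wz Ez; have : (W `&` E) z by []; rewrite WE.
have WE1 : W = ~` E.
  apply: cc => //.
    by exists W => //; apply/seteqP; split=> [z Wz|z []//]; split => //; exact: WnE.
  exists (W `|` E) => //; apply/seteqP; split=> z; first by move=> Wz; split; [exact: WnE|left].
  by move=> [nE [//|]].
have bT : cbounded [set: Cplx R].
  apply: (cboundedS (U := W `|` E)); last by apply: cboundedU => //; exact: compact_cbounded.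
  by move=> z _; rewrite WE1; have [Ez|nEz] := pselect (E z); [right|left].
have : [set: Cplx R] = set0 by apply: clopen_cbounded bT; [exact: openT|exact: closedT].
by move=> /seteqP[/(_ 0 I)].
Qed.

(** If W is a hole of E, then W minus U is a hole of the full set E u U, so W lies in U. Then W = (W
    u E) n U is closed as well as open and bounded. *)
Lemma clopen_full E U : compact E -> full (E `|` U) -> closed E -> closed U -> E `&` U = set0 ->
  cbounded U -> full E.
Proof.
move=> cE fEU clE clU EU bU W [oW bW WE cW].
have H : W `\` U = set0.
  apply: fEU; split.
  - by rewrite setDE; apply: openI => //; exact: closed_openC.
  - by apply: cboundedS bW => z [].
  - apply/seteqP; split=> // z [[Wz nU] [Ez|//]].
    by have : (W `&` E) z by []; rewrite WE.
  - suff -> : W `\` U `|` (E `|` U) = (W `|` E) `|` U by exact: closedU.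
    apply/seteqP; split=> z; first by move=> [[Wz _]|[Ez|Uz]]; [left;left|left;right|right].
    move=> [[Wz|Ez]|Uz]; [|by right; left|by right; right].
    by have [Uz|nUz] := pselect (U z); [right; right|left].
have WU : W `<=` U.
  by move=> z Wz; apply: contrapT => nU; have : (W `\` U) z by []; rewrite H.
apply: clopen_cbounded => //.
suff -> : W = (W `|` E) `&` U by exact: closedI.
apply/seteqP; split=> [z Wz|z [[//|Ez] Uz]]; first by split; [left|exact: WU].
by have : (E `&` U) z by []; rewrite EU.
Qed.

End Hull.

(** * Contours along a square grid *)

Section GridSum.
Variable R : realType.
Local Notation C := R[i].

Lemma shift_sum (B h : nat -> C) N : B 0%N = 0 -> B N = 0 ->
  \sum_(l < N) B l * h l = \sum_(l < N) B l.+1 * h l.+1.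
Proof.
case: N => [|N] B0 BN; first by rewrite !big_ord0.
rewrite big_ord_recl /= B0 mul0r add0r big_ord_recr /= BN mul0r addr0.
by apply: eq_bigr => i _.
Qed.

(** Summation by parts. An edge shared by two cells is run in opposite directions in their
    boundaries, so its total coefficient is the difference of the two weights; the weights vanish on
    the border of the grid. *)
Lemma grid_sum (B h v : nat -> nat -> C) N :
  (forall l, B 0%N l = 0) -> (forall l, B N l = 0) ->
  (forall k, B k 0%N = 0) -> (forall k, B k N = 0) ->
  \sum_(k < N) \sum_(l < N) B k l * (h k l + v k.+1 l - h k l.+1 - v k l) =
  \sum_(k < N) \sum_(l < N) ((B k l.+1 - B k l) * h k l.+1 + (B k l - B k.+1 l) * v k.+1 l).
Proof.
move=> B0 BN B0' BN'.
have H : \sum_(k < N) \sum_(l < N) B k l * h k l =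
         \sum_(k < N) \sum_(l < N) B k l.+1 * h k l.+1.
  by apply: eq_bigr => k _; exact: (@shift_sum (B k) (h k) N (B0' k) (BN' k)).
have V : \sum_(k < N) \sum_(l < N) B k l * v k l =
         \sum_(k < N) \sum_(l < N) B k.+1 l * v k.+1 l.
  rewrite exchange_big /= [RHS]exchange_big /=; apply: eq_bigr => l _.
  exact: (@shift_sum (fun k => B k l) (fun k => v k l) N (B0 l) (BN l)).
have E1 : \sum_(k < N) \sum_(l < N) B k l * (h k l + v k.+1 l - h k l.+1 - v k l) =
  \sum_(k < N) \sum_(l < N) B k l * h k l + \sum_(k < N) \sum_(l < N) B k l * v k.+1 l
  - \sum_(k < N) \sum_(l < N) B k l * h k l.+1 - \sum_(k < N) \sum_(l < N) B k l * v k l.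
  rewrite -big_split /= -!sumrB; apply: eq_bigr => k _.
  rewrite -big_split /= -!sumrB; apply: eq_bigr => l _; ring.
rewrite E1 H V -big_split /= -!sumrB; apply: eq_bigr => k _.
rewrite -big_split /= -!sumrB; apply: eq_bigr => l _; ring.
Qed.

End GridSum.

Section Chains.
Variable R : realType.
Local Notation C := R[i].
Implicit Types (f g L : C -> C) (z w : C).

Record edge := Edge { ecoef : C; epos : C; edir : C; elo : R; ehi : R }.

Definition eint g (e : edge) : C := ecoef e * sint g (epos e) (edir e) (elo e) (ehi e).

Definition on_edge (e : edge) (w : C) :=
  exists2 t, elo e <= t <= ehi e & w = epos e + t%:C * edir e.

Definition chint (s : seq edge) g : C := \sum_(e <- s) eint g e.

End Chains.

Section Grid.
Variable R : realType.
Local Notation C := R[i].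
Implicit Types (f g L : C -> C) (z w : C).
Variables (X : set (Cplx R)) (o dl : R) (N : nat).
Hypothesis dl0 : 0 < dl.

Let gr (k : nat) : R := o + k%:R * dl.

Hypothesis X1 : forall z : C, X z -> gr 1 < complex.Re z < gr N /\ gr 1 < complex.Im z < gr N.

Let grS k : gr k.+1 = gr k + dl.
Proof. by rewrite /gr -natr1; ring. Qed.

Let gr_le k : gr k <= gr k.+1.
Proof. by rewrite grS lerDl ltW. Qed.

Let gr_lt k : gr k < gr k.+1.
Proof. by rewrite grS ltrDl. Qed.

Let gr_mono k l : (k <= l)%N -> gr k <= gr l.
Proof. by move=> kl; rewrite /gr lerD2l ler_pM2r// ler_nat. Qed.

Let cell k l (w : C) := gr k <= complex.Re w <= gr k.+1 /\ gr l <= complex.Im w <= gr l.+1.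

Let b k l : bool := `[< exists2 w : C, cell k l w & X w >].

Let B k l : C := (b k l)%:R.

Let bP k l w : cell k l w -> X w -> b k l.
Proof. by move=> cw Xw; apply/asboolP; exists w. Qed.

Let B0 k l : (forall w : C, cell k l w -> ~ X w) -> B k l = 0.
Proof. by move=> h; rewrite /B /b asboolF// => -[w cw /(h w cw)]. Qed.

Let b0 l : B 0%N l = 0.
Proof.
apply: B0 => w [/andP[_ h] _] /X1[/andP[h' _] _].
by move: (lt_le_trans h' h); rewrite ltxx.
Qed.

Let b0' l : B l 0%N = 0.
Proof.
apply: B0 => w [_ /andP[_ h]] Xw; have [_ /andP[h' _]] := X1 Xw.
by move: (lt_le_trans h' h); rewrite ltxx.
Qed.

Let bN l : B N l = 0.
Proof.
apply: B0 => w [/andP[h _] _] Xw; have [/andP[_ h'] _] := X1 Xw.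
by move: (lt_le_trans h' h); rewrite ltxx.
Qed.

Let bN' l : B l N = 0.
Proof.
apply: B0 => w [_ /andP[h _]] Xw; have [_ /andP[_ h']] := X1 Xw.
by move: (lt_le_trans h' h); rewrite ltxx.
Qed.

Let hedge k l := Edge (B k l.+1 - B k l) ('i * (gr l.+1)%:C) 1 (gr k) (gr k.+1).
Let vedge k l := Edge (B k l - B k.+1 l) (gr k.+1)%:C 'i (gr l) (gr l.+1).

Let alledges := flatten [seq [:: hedge p.1 p.2; vedge p.1 p.2] |
  p <- [seq (k, l) | k <- iota 0 N, l <- iota 0 N]].

(** An edge is kept only if exactly one of its two adjacent cells meets X. It then lies in a closed
    cell disjoint from X and in one that meets X, which is why it avoids X but stays close to it. *)
Definition gridchain := [seq e <- alledges | ecoef e != 0].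

Let sum_edges (F : edge R -> C) : \sum_(e <- alledges) F e =
  \sum_(k < N) \sum_(l < N) (F (hedge k l) + F (vedge k l)).
Proof.
rewrite /alledges big_flatten /= big_map big_allpairs /=.
rewrite -[X in iota 0 X]subn0 -/(index_iota 0 N) big_mkord.
apply: eq_bigr => k _; rewrite big_mkord.
by apply: eq_bigr => l _; rewrite !big_cons big_nil addr0.
Qed.

Let sum_chain (F : edge R -> C) : (forall e, ecoef e = 0 -> F e = 0) ->
  \sum_(e <- gridchain) F e = \sum_(k < N) \sum_(l < N) (F (hedge k l) + F (vedge k l)).
Proof.
move=> F0; rewrite /gridchain big_filter -sum_edges [in RHS]big_mkcond [in LHS]big_mkcond /=.
by apply: eq_bigr => e _; case: eqP => // /F0.
Qed.

Let mem_chain (P : edge R -> Prop) :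
  (forall k l, ecoef (hedge k l) != 0 -> P (hedge k l)) ->
  (forall k l, ecoef (vedge k l) != 0 -> P (vedge k l)) ->
  forall e, List.In e gridchain -> P e.
Proof.
move=> Ph Pv e; rewrite /gridchain.
rewrite /alledges; move: [seq (k, l) | k <- _, l <- _] => s.
elim: s => //= -[k l] s IH /=.
case: ifPn => hk; case: ifPn => vk /=.
- by move=> [<-|[<-|/IH //]]; [exact: Ph|exact: Pv].
- by move=> [<-|/IH //]; exact: Ph.
- by move=> [<-|/IH //]; exact: Pv.
- exact: IH.
Qed.

Lemma grid_edges (e : edge R) : List.In e gridchain ->
  [/\ elo e <= ehi e, (edir e = 1 \/ edir e = 'i) &
   forall w, on_edge e w -> ~ X w /\ exists2 z : C, X z & nm (w - z) <= 2 * dl].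
Proof.
have diam k l (w z : C) : cell k l w -> cell k l z -> nm (w - z) <= 2 * dl.
  move=> [w1 w2] [z1 z2]; rewrite -(complex_eta w) -(complex_eta z).
  apply: (le_trans (rect_dist w1 w2 z1 z2)); rewrite !grS; lra.
have key k l k' l' (w : C) : B k l - B k' l' != 0 -> cell k l w -> cell k' l' w ->
    ~ X w /\ exists2 z : C, X z & nm (w - z) <= 2 * dl.
  rewrite /B => ne cw cw'; split.
    by move=> Xw; move: ne; rewrite (bP cw Xw) (bP cw' Xw) subrr eqxx.
  move: ne; rewrite /b; case: (asboolP (exists2 w, cell k l w & X w)) => [[z cz Xz] _|_].
    by exists z => //; exact: diam cw cz.
  case: (asboolP (exists2 w, cell k' l' w & X w)) => [[z cz Xz] _|_]; last by rewrite subrr eqxx.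
  by exists z => //; exact: diam cw' cz.
apply: (mem_chain (P := fun e => [/\ elo e <= ehi e, (edir e = 1 \/ edir e = 'i) &
   forall w, on_edge e w -> ~ X w /\ exists2 z : C, X z & nm (w - z) <= 2 * dl])) => k l ne.
  split => [||w [t tk ->]]; [exact: gr_le|by left|]; apply: (key _ _ _ _ _ ne); rewrite /= hptE;
    by split => //=; rewrite ?lexx ?gr_le.
split => [||w [t tk ->]]; [exact: gr_le|by right|]; apply: (key _ _ _ _ _ ne); rewrite /= vptE;
  by split => //=; rewrite ?lexx ?gr_le.
Qed.

(** Each edge contributes the difference of L at its endpoints. Regrouped by cells through
    [grid_sum], these differences cancel around every cell, although L is a primitive only along the
    chain. *)
Lemma grid_exact L g : (forall e w, List.In e gridchain -> on_edge e w ->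
    iscder L w (g w) /\ ctn g w) -> chint gridchain g = 0.
Proof.
move=> H; pose hL k l := L ((gr k.+1) +i* (gr l)) - L ((gr k) +i* (gr l)).
pose vL k l := L ((gr k) +i* (gr l.+1)) - L ((gr k) +i* (gr l)).
pose F (e : edge R) := ecoef e * (L (epos e + (ehi e)%:C * edir e) - L (epos e + (elo e)%:C * edir e)).
have -> : chint gridchain g = \sum_(e <- gridchain) F e.
  have : forall e, List.In e gridchain -> eint g e = F e.
    move=> e ein; rewrite /eint /F; congr (_ * _).
    have [le _ _] := grid_edges ein.
    have D t : elo e <= t <= ehi e -> on_edge e (epos e + t%:C * edir e) by exists t.
    by apply: sint_FTC => // t /D /(H _ _ ein)[].
  rewrite /chint; elim: gridchain => [|e s IH] Hs; first by rewrite !big_nil.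
  rewrite !big_cons Hs ?IH//; first by move=> e' ?; apply: Hs; right.
  by left.
rewrite sum_chain => [|e e0]; last by rewrite /F e0 mul0r.
have -> : \sum_(k < N) \sum_(l < N) (F (hedge k l) + F (vedge k l)) =
  \sum_(k < N) \sum_(l < N) ((B k l.+1 - B k l) * hL k l.+1 + (B k l - B k.+1 l) * vL k.+1 l).
  by apply: eq_bigr => k _; apply: eq_bigr => l _; rewrite /F /= !hptE !vptE.
rewrite -(grid_sum _ _ b0 bN b0' bN') big1// => k _; rewrite big1// => l _.
by rewrite /hL /vL; ring.
Qed.

Lemma grid_cells g : chint gridchain g =
  \sum_(k < N) \sum_(l < N) B k l * rectint g (gr k) (gr k.+1) (gr l) (gr l.+1).
Proof.
pose h k l := sint g ('i * (gr l)%:C) 1 (gr k) (gr k.+1).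
pose v k l := sint g (gr k)%:C 'i (gr l) (gr l.+1).
rewrite /chint sum_chain => [|e e0]; last by rewrite /eint e0 mul0r.
transitivity (\sum_(k < N) \sum_(l < N)
   ((B k l.+1 - B k l) * h k l.+1 + (B k l - B k.+1 l) * v k.+1 l)) => //.
by rewrite -(grid_sum _ _ b0 bN b0' bN').
Qed.

Lemma grid_index (t : R) : gr 1 < t < gr N -> exists2 k, (k < N)%N & gr k <= t < gr k.+1.
Proof.
move=> /andP[t1 tN].
have ex : exists k, t < gr k.+1 by exists N; exact: lt_trans (gr_lt N).
case: (ex_minnP ex) => k tk kmin; exists k.
  have /kmin h : t < gr N.-1.+1.
    case: N tN => [|//] h; rewrite /= (lt_trans h)// -[X in X < _]/(gr 0) gr_lt//.
  case: N tN h t1 => [|n] tN h t1; last by rewrite ltnS.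
  have := lt_trans t1 tN; rewrite ltNge => /negP[]; exact: gr_mono.
rewrite tk andbT; case: k kmin tk => [|k] kmin _.
  by rewrite (le_trans _ (ltW t1))//; exact: gr_mono.
by rewrite leNgt; apply/negP => /kmin; rewrite ltnn.
Qed.

(* Only the cell around z contributes. *)
Lemma grid_cauchy_off f z k0 l0 : (k0 < N)%N -> (l0 < N)%N ->
  gr k0 < complex.Re z < gr k0.+1 -> gr l0 < complex.Im z < gr l0.+1 -> b k0 l0 ->
  (forall w w', X w' -> nm (w - w') <= 2 * dl -> cder f w) ->
  chint gridchain (fun w => f w / (w - z)) = kc R * f z.
Proof.
move=> k0N l0N zk zl bkl hf; rewrite grid_cells.
have inb k l : b k l -> indom f (gr k) (gr k.+1) (gr l) (gr l.+1).
  move=> /asboolP[w [w1 w2] Xw] s t sk tl; apply: (hf _ w Xw).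
  rewrite -(complex_eta w); apply: (le_trans (rect_dist sk tl w1 w2)); rewrite !grS; lra.
rewrite (bigD1 (Ordinal k0N))//= (bigD1 (Ordinal l0N))//=.
have z0 k l : (k != k0) || (l != l0) ->
    B k l * rectint (fun w => f w / (w - z)) (gr k) (gr k.+1) (gr l) (gr l.+1) = 0.
  move=> kl; rewrite /B; case: (boolP (b k l)) => bk; last by rewrite mul0r.
  rewrite (goursat (gr_le k) (gr_le l)) ?mulr0// => s t sk tl.
  have ne : s +i* t - z != 0.
    rewrite subr_eq0; apply/negP => /eqP E; move: kl zk zl; rewrite -E /=.
    case/orP; rewrite neq_ltn => /orP[h|h] /andP[h1 h2] /andP[h3 h4].
    - by case/andP: sk => _ h5; move: (lt_le_trans h1 h5); rewrite ltNge gr_mono.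
    - by case/andP: sk => h5 _; move: (le_lt_trans h5 h2); rewrite ltNge gr_mono.
    - by case/andP: tl => _ h5; move: (lt_le_trans h3 h5); rewrite ltNge gr_mono.
    - by case/andP: tl => h5 _; move: (le_lt_trans h5 h4); rewrite ltNge gr_mono.
  exact: (cder_mul (inb k l bk s t sk tl)
    (@cder_inv _ (fun w => w - z) _ ne (cder_sub (cder_id _) (cder_cst z _)))).
rewrite (cauchy_formulaz (inb _ _ bkl) zk zl) /B bkl mul1r big1 => [|l ll]; last first.
  by apply: z0; rewrite orbC; move: ll; rewrite -val_eqE /= => ->.
rewrite big1 ?addr0// => k kk; rewrite big1// => l _; apply: z0.
by move: kk; rewrite -val_eqE /= => ->.
Qed.

Lemma chint_ctn f z : (forall e w, List.In e gridchain -> on_edge e w -> w != z /\ ctn f w) ->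
  ctn (fun v => chint gridchain (fun w => f w / (w - v))) z.
Proof.
have : forall e, List.In e gridchain -> elo e <= ehi e by move=> e /grid_edges[].
rewrite /chint; elim: gridchain => [|e s IH] le H.
  have -> : (fun v => \sum_(e <- [::]) eint (fun w => f w / (w - v)) e) = fun=> 0.
    by apply/funext => v; rewrite big_nil.
  exact: ctn_cst.
have -> : (fun v => \sum_(e <- e :: s) eint (fun w => f w / (w - v)) e) =
  fun v => eint (fun w => f w / (w - v)) e + \sum_(e <- s) eint (fun w => f w / (w - v)) e.
  by apply/funext => v; rewrite big_cons.
apply: (ctn_add (f := fun v => eint (fun w => f w / (w - v)) e)
  (g := fun v => \sum_(e <- s) eint (fun w => f w / (w - v)) e)); last first.
  by apply: IH => [e' ?|e' w ?]; [apply: le|apply: H]; right.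
have ein : List.In e (e :: s) by left.
have D t : elo e <= t <= ehi e -> on_edge e (epos e + t%:C * edir e) by exists t.
have sf : scont f (epos e) (edir e) (elo e) (ehi e) by move=> t /D /(H _ _ ein)[].
have si : scont (fun w => w) (epos e) (edir e) (elo e) (ehi e) by move=> t _; exact: ctn_id.
have sz t : elo e <= t <= ehi e -> epos e + t%:C * edir e != z by move=> /D /(H _ _ ein)[].
have P := sint_param (le e ein) (@kernel1 R) (@kctn1 R) (@kctn2 R) sf si sz.
exact: (ctn_mul (ctn_cst (ecoef e) z) (cder_ctn (iscder_der P))).
Qed.

(** A point z on a grid line is a singularity on the boundary of single cells. The chain as a whole
    avoids X, so both sides are continuous at z and the formula follows from nearby points in the
    interior of a cell. *)
Lemma grid_cauchy f z : X z ->
  (forall w w', X w' -> nm (w - w') <= 2 * dl -> cder f w) ->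
  chint gridchain (fun w => f w / (w - z)) = kc R * f z.
Proof.
move=> Xz hf; have [zx zy] := X1 Xz.
have [k kN /andP[k1 k2]] := grid_index zx; have [l lN /andP[l1 l2]] := grid_index zy.
have ck : cell k l z by split; apply/andP; split => //; exact: ltW.
have fz : cder f z by apply: (hf z z Xz); rewrite subrr nm0 mulr_ge0// ltW.
have cF : ctn (fun v => chint gridchain (fun w => f w / (w - v))) z.
  apply: chint_ctn => e w /grid_edges[_ _ /(_ w)] H /H[nX [w' Xw' ww']]; split.
    by apply/negP => /eqP E; apply: nX; rewrite E.
  exact/cder_ctn/(hf w w').
have cG : ctn (fun v => chint gridchain (fun w => f w / (w - v)) - kc R * f v) z.
  exact: (ctn_sub cF (ctn_mul (ctn_cst (kc R) z) (cder_ctn fz))).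
apply/eqP; rewrite -subr_eq0 -nm_eq0 eq_le nm_ge0 andbT.
apply/ler_addgt0Pr => e e0; rewrite add0r.
have /ctnP/(_ e e0)[d d0 dP] := cG.
(* [grid_index] puts z in a half-open cell, so a small diagonal shift up and to the right reaches
   the interior of that same cell, which meets X at z. *)
pose m := Num.min (d / 4) (Num.min ((gr k.+1 - complex.Re z) / 2) ((gr l.+1 - complex.Im z) / 2)).
have m0 : 0 < m by rewrite !lt_min !divr_gt0// subr_gt0.
have md : m <= d / 4 by rewrite ge_min lexx.
have mx : m <= (gr k.+1 - complex.Re z) / 2 by rewrite !ge_min lexx orbT.
have my : m <= (gr l.+1 - complex.Im z) / 2 by rewrite !ge_min lexx !orbT.
pose v : C := (complex.Re z + m) +i* (complex.Im z + m).
have vz : nm (v - z) < d.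
  apply: (le_lt_trans (nm_ReIm _)); rewrite creB cimB /= !(addrC _ m) !addrK.
  rewrite gtr0_norm//; move: m0 md; move: (m) => *; lra.
have := dP v vz; rewrite (grid_cauchy_off kN lN _ _ (bP ck Xz) hf) /=.
- by rewrite subrr sub0r nmN; exact: ltW.
- by move: m0 mx k1 k2; move: (m) (gr k) (gr k.+1) => *; apply/andP; split; lra.
- by move: m0 my l1 l2; move: (m) (gr l) (gr l.+1) => *; apply/andP; split; lra.
Qed.

End Grid.

(* The boundary of the union of the closed grid squares meeting X, as an oriented chain. *)
Lemma grid_chain (R : realType) (X : set (Cplx R)) (d : R) : cbounded X -> 0 < d ->
  exists s : seq (edge R),
  [/\ forall e, List.In e s ->
       [/\ elo e <= ehi e, (edir e = 1 \/ edir e = 'i) &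
        forall w, on_edge e w -> ~ X w /\ exists2 z : R[i], X z & nm (w - z) < d],
     forall L g, (forall e w, List.In e s -> on_edge e w -> iscder L w (g w) /\ ctn g w) ->
       chint s g = 0 &
     forall f z, X z -> (forall w w', X w' -> nm (w - w') < d -> cder f w) ->
       chint s (fun w => f w / (w - z)) = kc R * f z].
Proof.
move=> [M0 M0P] d0; pose M := Num.max M0 0.
have MP z : X z -> nm (z : R[i]) <= M by move=> /M0P h; rewrite le_max h.
have Mge : 0 <= M by rewrite le_max lexx orbT.
pose dl := d / 4; have dl0 : 0 < dl by rewrite divr_gt0.
pose o := - M - 2 * dl.
have [N NP] : exists N : nat, M < o + N%:R * dl.
  have [n _ nP] : \forall n \near \oo, (M - o) / dl < n%:R by apply: nbhs_infty_gtr.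
  exists n; have := nP n (leqnn n); rewrite ltr_pdivrMr//; lra.
have d2 : 2 * dl < d by rewrite /dl; lra.
have X1 (z : R[i]) : X z -> o + 1%:R * dl < complex.Re z < o + N%:R * dl /\
    o + 1%:R * dl < complex.Im z < o + N%:R * dl.
  move=> /MP zM; have := le_trans (nm_Re z) zM; have := le_trans (nm_Im z) zM.
  rewrite !ler_norml => /andP[h1 h2] /andP[h3 h4].
  have o1 : o + 1%:R * dl < - M by rewrite /o; lra.
  by split; apply/andP; split; lra.
exists (gridchain X o dl N); split.
- move=> e /(grid_edges dl0)[h1 h2 h3]; split => // w /h3[h4 [z Xz zd]]; split => //.
  by exists z => //; exact: le_lt_trans d2.
- by move=> L g; exact: (@grid_exact _ X o dl N dl0 X1 L g).
- move=> f z Xz hf; apply: (grid_cauchy dl0 X1 Xz) => w w' Xw' h.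
  exact: (hf w w' Xw' (le_lt_trans h d2)).
Qed.

(** * Runge's theorem *)

Section PolynomialApproximation.
Variable R : realType.
Local Notation C := R[i].
Implicit Types (f g h L : C -> C) (z w a : C) (E U W K : set (Cplx R)) (p q r : {poly R[i]}).

Definition papprox E g := forall e : R, 0 < e ->
  exists p : {poly R[i]}, forall z, E z -> nm (g z - p.[z]) <= e.

Lemma papprox_ext E g h : (forall z, E z -> g z = h z) -> papprox E g -> papprox E h.
Proof. by move=> gh ag e /ag[p pP]; exists p => z Ez; rewrite -gh//; exact: pP. Qed.

Lemma papprox_add E g h : papprox E g -> papprox E h -> papprox E (fun z => g z + h z).
Proof.
move=> ag ah e e0; have e2 : 0 < e / 2 by rewrite divr_gt0.
have [p pP] := ag _ e2; have [q qP] := ah _ e2; exists (p + q) => z Ez.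
rewrite hornerD opprD addrACA (splitr e) (le_trans (nmD _ _))//.
by rewrite lerD ?pP ?qP.
Qed.

Lemma papprox_scale E (k : C) g : papprox E g -> papprox E (fun z => k * g z).
Proof.
move=> ag e e0; have k1 : 0 < nm k + 1 by rewrite ltr_wpDl ?nm_ge0.
have [p pP] := ag _ (divr_gt0 e0 k1); exists (k *: p) => z Ez.
rewrite hornerZ -mulrBr nmM; apply: (le_trans (ler_wpM2l (nm_ge0 _) (pP z Ez))).
by rewrite mulrCA ger_pMr// ler_pdivrMr// mul1r lerDl ler01.
Qed.

Lemma papprox0 E : papprox E (fun=> 0).
Proof. by move=> e e0; exists 0 => z _; rewrite horner0 subrr nm0 ltW. Qed.

Lemma papprox_lim E g : (forall e : R, 0 < e -> exists2 h, papprox E h &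
  forall z, E z -> nm (g z - h z) <= e) -> papprox E g.
Proof.
move=> lim e e0; have e2 : 0 < e / 2 by rewrite divr_gt0.
have [h ah hP] := lim _ e2; have [p pP] := ah _ e2; exists p => z Ez.
have -> : g z - p.[z] = (g z - h z) + (h z - p.[z]) by ring.
by rewrite (splitr e) (le_trans (nmD _ _))// lerD ?hP ?pP.
Qed.

Lemma pow_small (x e : R) : 0 <= x < 1 -> 0 < e -> exists n, x ^+ n <= e.
Proof.
move=> /andP[x0 x1] e0.
have /cvgrPdist_le/(_ e e0)[n _ nP] : x ^+ n @[n --> \oo] --> (0 : R).
  by apply: cvg_expr; rewrite ger0_norm.
exists n; have := nP n (leqnn n); rewrite /= sub0r normrN ger0_norm//.
exact: exprn_ge0.
Qed.

Lemma sep_factor q a : q.[a] = 1 -> exists r, forall z, 1 - q.[z] = (a - z) * r.[z].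
Proof.
move=> qa; have /factor_theorem[r rE] : root (1 - q) a.
  by rewrite /root hornerD hornerN hornerC qa subrr.
exists (- r) => z; have /(congr1 (fun p => p.[z])) : 1 - q = r * ('X - a%:P) := rE.
by rewrite !hornerE => ->; ring.
Qed.

(** If q(a) = 1 and q is tiny on E, then 1 - q is divisible by a - z, and the quotient differs from
    1 / (a - z) by q / (a - z). *)
Lemma papprox_kernel E a : closed E -> sep E a -> papprox E (fun z => (a - z)^-1).
Proof.
move=> cE sE e e0; have [d d0 dP] := closed_outside cE (sep_notin sE).
have h01 : 0 <= (1 / 2 : R) < 1 by lra.
have [n nP] := @pow_small (1 / 2) (e * d) h01 (mulr_gt0 e0 d0).
have [q [qa qE]] := sep_pow n sE; have [r rE] := sep_factor qa.
exists r => z Ez; have dz : d <= nm (a - z) by rewrite nm_sym dP.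
have az : a - z != 0 by rewrite -nm_gt0 (lt_le_trans d0).
have -> : (a - z)^-1 - r.[z] = q.[z] / (a - z).
  have -> : r.[z] = (1 - q.[z]) / (a - z) by rewrite rE mulrAC mulfV ?mul1r.
  by field.
rewrite nmM nmV ler_pdivrMr ?nm_gt0//; apply: (le_trans (qE z Ez)).
by apply: (le_trans nP); rewrite ler_pM2l.
Qed.

Definition esupp (e : edge R) : set (Cplx R) := [set w | on_edge e w].

Lemma esupp_compact (e : edge R) : compact (esupp e).
Proof.
pose l (t : R) : Cplx R := epos e + t%:C * edir e.
have -> : esupp e = l @` `[elo e, ehi e].
  apply/seteqP; split=> [w [t tab ->]|_ [t tab <-]].
    by exists t => //; rewrite /= in_itv.
  by exists t => //; move: tab; rewrite /= in_itv.
apply: continuous_compact; last exact: segment_compact.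
apply: continuous_subspaceT => t A /nbhsCP[d d0 dA].
have d1 : 0 < nm (edir e) + 1 by rewrite ltr_wpDl ?nm_ge0.
apply/nbhs_ballP; exists (d / (nm (edir e) + 1)) => [|s]; first exact: divr_gt0.
rewrite -(@ball_normE _ R^o) /= ltr_pdivlMr// => st; apply: dA.
have -> : l s - l t = (s - t)%:C * edir e :> C by rewrite /l rmorphB; ring.
rewrite nmM nm_real distrC; apply: le_lt_trans st.
by rewrite ler_wpM2l// lerDl ler01.
Qed.

Lemma scont_edge g (e : edge R) : (forall w, on_edge e w -> ctn g w) ->
  scont g (epos e) (edir e) (elo e) (ehi e).
Proof. by move=> h t tab; apply: h; exists t. Qed.

Lemma kernel_diff (k w b z : C) : w - z != 0 -> b - z != 0 ->
  k / (w - z) - (b - z)^-1 * k = k * ((b - w) * ((w - z)^-1 * (b - z)^-1)).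
Proof. by move=> h1 h2; field; rewrite h1 h2. Qed.

(** Riemann sums in which only the kernel 1 / (w - z) is frozen, at the left end of each piece,
    while f is integrated exactly. The edge keeps a positive distance m from E, so a piece of length
    h costs at most K h^2, uniformly in z. *)
Lemma papprox_sint E f (e : edge R) : closed E -> elo e <= ehi e ->
  (forall w, on_edge e w -> sep E w /\ ctn f w) ->
  papprox E (fun z => sint (fun w => f w / (w - z)) (epos e) (edir e) (elo e) (ehi e)).
Proof.
case: e => k0 p d lo hi /= cE lohi H.
set e := Edge k0 p d lo hi in H.
have cf : scont f p d lo hi by apply: (@scont_edge f e) => w /H[].
have [M M0 MP] := scont_bounded cf.
have [m m0 mP] : exists2 m : R, 0 < m & forall z t, E z -> lo <= t <= hi -> m <= nm (p + t%:C * d - z).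
  have [m m0 mP] := compact_nbhd (@esupp_compact e) (closed_openC cE)
    (fun w (we : on_edge e w) => sep_notin (proj1 (H w we))).
  exists m => // z t Ez tab; rewrite leNgt; apply/negP; rewrite nm_sym => lt.
  by apply: (mP _ z _ lt Ez); exists t.
have on t : lo <= t <= hi -> on_edge e (p + t%:C * d) by exists t.
have cz z : E z -> scont (fun w => f w / (w - z)) p d lo hi.
  move=> Ez t tab.
  have ne : p + t%:C * d - z != 0 by rewrite -nm_gt0 (lt_le_trans m0)// mP.
  exact: (ctn_mul (cf t tab) (@ctn_inv _ (fun w => w - z) _ ne
     (ctn_sub (ctn_id _) (ctn_cst z _)))).
pose K := nm d * (2 * (M * (nm d / m ^+ 2))).
have K0 : 0 <= K by rewrite !mulr_ge0 ?nm_ge0// invr_ge0 exprn_ge0// ltW.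
have step (h : R) : 0 <= h -> forall n : nat, lo + n%:R * h <= hi ->
  exists2 A : C -> C, papprox E A & forall z, E z ->
   nm (sint (fun w => f w / (w - z)) p d lo (lo + n%:R * h) - A z) <= n%:R * (K * h ^+ 2).
  move=> h0; elim=> [_|n IH].
    exists (fun=> 0); first exact: papprox0.
    move=> z Ez; rewrite !mul0r addr0 subr0.
    have c0 := scontS (lexx lo) lohi (cz z Ez).
    have [N _ NP] := scont_bounded c0.
    by have := sint_bound (lexx lo) c0 NP; rewrite subrr !mulr0.
  set u := lo + n%:R * h; set v := lo + n.+1%:R * h => vhi.
  have vE : v = u + h by rewrite /v /u -natr1; ring.
  have uv : u <= v by rewrite vE lerDl.
  have lou : lo <= u by rewrite /u lerDl mulr_ge0.
  have uhi : u <= hi by rewrite (le_trans uv).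
  have [A aA AP] := IH uhi.
  have uin : lo <= u <= hi by rewrite lou uhi.
  pose w0 := p + u%:C * d.
  have [sw _] := H w0 (on u uin).
  exists (fun z => A z + sint f p d u v * (w0 - z)^-1).
    exact: (papprox_add aA (papprox_scale (sint f p d u v) (papprox_kernel cE sw))).
  move=> z Ez; have cuv := scontS lou vhi (cz z Ez).
  have cfuv := scontS lou vhi cf.
  rewrite (sint_chasles lou uv (scontS (lexx lo) vhi (cz z Ez))).
  set I1 := sint _ _ _ lo u; set I2 := sint _ _ _ u v.
  have -> : I1 + I2 - (A z + sint f p d u v * (w0 - z)^-1) =
    (I1 - A z) + (I2 - (w0 - z)^-1 * sint f p d u v) by ring.
  apply: (le_trans (nmD _ _)); rewrite -natr1 mulrDl mul1r; apply: lerD; first exact: AP.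
  have ck : scont (fun w => (w0 - z)^-1 * f w) p d u v.
    by move=> t tuv; exact: ctn_mul (ctn_cst _ _) (cfuv t tuv).
  have cd' : scont (fun w => f w / (w - z) - (w0 - z)^-1 * f w) p d u v.
    by move=> t tuv; exact: ctn_sub (cuv t tuv) (ck t tuv).
  rewrite /I2 -(sintZ _ cfuv) -(sintB cuv ck).
  have B t : u <= t <= v -> nm (f (p + t%:C * d) / (p + t%:C * d - z) -
      (w0 - z)^-1 * f (p + t%:C * d)) <= M * (h * nm d / m ^+ 2).
    move=> /andP[ut tv]; have tin : lo <= t <= hi by rewrite (le_trans lou ut) (le_trans tv vhi).
    have m1 := mP z t Ez tin; have m2 : m <= nm (w0 - z) := mP z u Ez uin.
    have n1 : p + t%:C * d - z != 0 by rewrite -nm_gt0 (lt_le_trans m0).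
    have n2 : w0 - z != 0 by rewrite -nm_gt0 (lt_le_trans m0).
    have -> : f (p + t%:C * d) / (p + t%:C * d - z) - (w0 - z)^-1 * f (p + t%:C * d) =
      f (p + t%:C * d) * ((w0 - (p + t%:C * d)) * ((p + t%:C * d - z)^-1 * (w0 - z)^-1)).
      exact: kernel_diff.
    rewrite nmM; apply: ler_pM; rewrite ?nm_ge0// ?MP// nmM; apply: ler_pM; rewrite ?nm_ge0//.
      have -> : w0 - (p + t%:C * d) = (u - t)%:C * d by rewrite /w0 rmorphB; ring.
      rewrite nmM nm_real ler_wpM2r ?nm_ge0// distrC ger0_norm ?subr_ge0// lerBlDl -vE//.
    have i1 : (nm (p + t%:C * d - z))^-1 <= m^-1 by rewrite lef_pV2 ?posrE ?nm_gt0.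
    have i2 : (nm (w0 - z))^-1 <= m^-1 by rewrite lef_pV2 ?posrE ?nm_gt0.
    rewrite nmM !nmV expr2 invfM; apply: (ler_pM _ _ i1 i2); by rewrite invr_ge0 nm_ge0.
  apply: (le_trans (sint_bound uv cd' B)).
  have -> : v - u = h by rewrite vE addrC addKr.
  by have -> : nm d * (2 * (M * (h * nm d / m ^+ 2)) * h) = K * h ^+ 2 by rewrite /K; ring.
apply: papprox_lim => eps eps0.
pose T := K * (hi - lo) ^+ 2.
have T0 : 0 <= T by rewrite mulr_ge0// sqr_ge0.
have [n nP] : exists n : nat, T / eps < n%:R.
  by have [n _ nP] := nbhs_infty_gtr (T / eps); exists n; exact: (nP n (leqnn n)).
have n0 : 0 < n%:R :> R by apply: le_lt_trans nP; rewrite divr_ge0// ltW.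
have hE : lo + n%:R * ((hi - lo) / n%:R) = hi.
  by rewrite mulrCA mulfV ?lt0r_neq0// mulr1 addrC subrK.
have h0 : 0 <= (hi - lo) / n%:R by rewrite divr_ge0 ?subr_ge0// ltW.
have [|A aA AP] := step _ h0 n; first by rewrite hE.
exists A => // z Ez; rewrite -{1}hE; apply: (le_trans (AP z Ez)).
have -> : n%:R * (K * ((hi - lo) / n%:R) ^+ 2) = T / n%:R by rewrite /T; field; rewrite lt0r_neq0.
by rewrite ler_pdivrMr// mulrC -ler_pdivrMr// ltW.
Qed.

(** Cauchy's formula along a grid chain in U around E. The chain avoids the full set E, so each of
    its points is separated from E and its Cauchy kernel is a limit of polynomials. *)
Theorem runge E U f : compact E -> full E -> open U -> E `<=` U ->
  (forall z, U z -> cder f z) -> papprox E f.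
Proof.
move=> cE fE oU EU hf; have clE := compact_cclosed cE.
have [d d0 dP] := compact_nbhd cE oU EU.
have [s [s1 _ s3]] := grid_chain (compact_cbounded cE) d0.
have E1 z : E z -> (kc R)^-1 * chint s (fun w => f w / (w - z)) = f z.
  move=> Ez; rewrite (s3 f z Ez) ?mulKf ?kc_neq0// => w w' Ew' ww'.
  exact: hf (dP _ _ Ew' ww').
apply: (papprox_ext E1); apply: papprox_scale.
have on e : List.In e s -> elo e <= ehi e /\ forall w, on_edge e w -> sep E w /\ ctn f w.
  move=> /s1[le _ H]; split=> // w /H[nEw [z Ez wz]]; split; first exact: full_sep.
  exact/cder_ctn/hf/(dP _ _ Ez wz).
rewrite /chint; elim: s on {s1 s3 E1} => [|e s IH] on.
  by apply: (papprox_ext _ (@papprox0 E)) => z _; rewrite big_nil.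
apply: (papprox_ext (g := fun z => eint (fun w => f w / (w - z)) e +
   \sum_(e0 <- s) eint (fun w => f w / (w - z)) e0)).
  by move=> z _; rewrite big_cons.
have [le H] := on e (or_introl erefl).
have IH' := IH (fun e' ie => on e' (or_intror ie)).
exact: (papprox_add (papprox_scale (ecoef e) (papprox_sint clE le H)) IH').
Qed.

End PolynomialApproximation.

(** * Stability of full sets under disjoint unions and hulls *)

Section Fullness.
Variable R : realType.
Local Notation C := R[i].
Implicit Types (f g L : C -> C) (z w a : C) (E U W K G : set (Cplx R)) (p q r : {poly R[i]}).

Lemma poly_antideriv p : exists A : {poly R[i]}, A^`() = p.
Proof.
exists (\poly_(i < (size p).+1) (p`_i.-1 / i%:R)); apply/polyP => i.
rewrite coef_deriv coef_poly ltnS; case: ltnP => ip /=.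
  by rewrite -[_ *+ i.+1]mulr_natr divfK// pnatr_eq0.
by rewrite mul0rn nth_default.
Qed.

(* 1/(w - a) is a limit of derivatives near E, hence has vanishing integral over closed contours
   near E. *)
Definition good E a := exists U, [/\ open U, E `<=` U &
  forall K, compact K -> K `<=` U -> forall e : R, 0 < e -> exists L,
    (forall w, U w -> cder L w) /\
    (forall w, K w -> nm (cD L w - (w - a)^-1) <= e)].

(** On |q| < 3/4 the powers of q still tend to 0, so 1 / (w - a) is a uniform limit of polynomials
    there, and polynomials have primitives. Any threshold strictly between 1/2 and 1 gives such a
    neighbourhood of E. *)
Lemma sep_good E a : sep E a -> good E a.
Proof.
move=> [q [qa qE]]; pose U : set (Cplx R) := [set w | nm q.[w] < 3 / 4].
have oU : open U.
  apply/openCP => z zU.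
  have d0 : 0 < 3 / 4 - nm q.[z] by rewrite subr_gt0.
  have /ctnP/(_ _ d0)[d d10 dP] := cder_ctn (cder_horner q z).
  exists d => // w /dP; have := nm_leD q.[w] q.[z]; rewrite /U /=.
  move: (nm q.[w]) (nm q.[z]) (nm _) => *; lra.
exists U; split => // [z /qE|K cK KU e e0].
  by rewrite /U /= => h; apply: (le_lt_trans h); lra.
have Ka : ~ K a by move=> /KU; rewrite /U /= qa nm1; lra.
have [d d0 dP] := closed_outside (compact_cclosed cK) Ka.
have h01 : 0 <= (3 / 4 : R) < 1 by lra.
have [n nP] := pow_small h01 (mulr_gt0 e0 d0).
have qna : (q ^+ n).[a] = 1 by rewrite horner_exp qa expr1n.
have [r rE] := sep_factor qna; have [A AE] := poly_antideriv (- r).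
exists (fun w => A.[w]); split=> [w _|w Kw]; first exact: cder_horner.
rewrite (cD_eq (iscder_horner A w)) AE hornerN.
have dw : d <= nm (a - w) by rewrite nm_sym dP.
have aw : a - w != 0 by rewrite -nm_gt0 (lt_le_trans d0).
have wa : w - a != 0 by rewrite -opprB oppr_eq0.
have -> : - r.[w] - (w - a)^-1 = (q.[w]) ^+ n / (a - w).
  have -> : r.[w] = (1 - (q ^+ n).[w]) / (a - w) by rewrite rE mulrAC mulfV ?mul1r.
  by rewrite horner_exp; field; rewrite aw.
rewrite nmM nmX nmV ler_pdivrMr ?nm_gt0//.
apply: (@le_trans _ _ ((3 / 4) ^+ n)).
  have qw : nm q.[w] <= 3 / 4 := ltW (KU w Kw).
  by rewrite lerXn2r ?nnegrE ?nm_ge0 ?divr_ge0.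
by apply: (le_trans nP); rewrite ler_pM2l.
Qed.

Lemma disjoint_nbhds E1 E2 : compact E1 -> compact E2 -> E1 `&` E2 = set0 ->
  exists N1 N2 : set (Cplx R), [/\ open N1, open N2, E1 `<=` N1, E2 `<=` N2 &
    forall w, N1 w -> N2 w -> False].
Proof.
move=> c1 c2 dis.
have E12 : E1 `<=` ~` E2.
  by move=> z z1 z2; have : (E1 `&` E2) z by []; rewrite dis.
have [d d0 dP] := compact_nbhd c1 (closed_openC (compact_cclosed c2)) E12.
have d2 : 0 < d / 2 by rewrite divr_gt0.
pose nb E : set (Cplx R) := [set w | exists2 z, E z & nm (w - z) < d / 2].
have onb E : open (nb E).
  apply/openCP => w [z Ez wz]; exists (d / 2 - nm (w - z)); first by rewrite subr_gt0.
  move=> v vw; exists z => //; apply: (le_lt_trans (nm_tri v w z)).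
  by rewrite -ltrBrDr.
have nbE E : E `<=` nb E by move=> z Ez; exists z => //; rewrite subrr nm0.
exists (nb E1), (nb E2); split => // w [z1 h1 l1] [z2 h2 l2].
apply: (dP z1 z2 h1) => //; apply: (le_lt_trans (nm_tri z2 w z1)).
by rewrite [nm (z2 - w)]nm_sym (splitr d) ltrD.
Qed.

(** Primitives on disjoint neighbourhoods glue to a single one. Removing from K the open
    neighbourhood of the other set leaves two compact parts to which the hypotheses apply. *)
Lemma good_union E1 E2 a : compact E1 -> compact E2 -> E1 `&` E2 = set0 ->
  good E1 a -> good E2 a -> good (E1 `|` E2) a.
Proof.
move=> c1 c2 dis [U1 [opU1 EU1 g1]] [U2 [opU2 EU2 g2]].
have [N1 [N2 [oN1 oN2 EN1 EN2 nn]]] := disjoint_nbhds c1 c2 dis.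
pose V1 := U1 `&` N1; pose V2 := U2 `&` N2.
have oV1 : open V1 by exact: openI.
have oV2 : open V2 by exact: openI.
exists (V1 `|` V2); split; first exact: openU.
  by move=> z [h|h]; [left|right]; split; [exact: EU1|exact: EN1|exact: EU2|exact: EN2].
move=> K cK KV e e0.
have cK1 : compact (K `\` V2).
  by apply: (subclosed_compact _ cK) => [|z []//]; rewrite setDE; apply: closedI (compact_cclosed cK) (open_closedC oV2).
have cK2 : compact (K `\` V1).
  by apply: (subclosed_compact _ cK) => [|z []//]; rewrite setDE; apply: closedI (compact_cclosed cK) (open_closedC oV1).
have KU1 : K `\` V2 `<=` U1 by move=> z [/KV[[]//|]].
have KU2 : K `\` V1 `<=` U2 by move=> z [/KV[//|[]//]].
have [L1 [h1 k1]] := g1 _ cK1 KU1 e e0; have [L2 [h2 k2]] := g2 _ cK2 KU2 e e0.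
pose L w := if `[< V1 w >] then L1 w else L2 w.
have D1 w : V1 w -> iscder L w (cD L1 w).
  move=> v1; have [r r0 rP] := (proj1 (openCP V1) oV1) w v1.
  apply: (iscder_near r0 _ (iscderD (h1 w (proj1 v1)))) => v /rP vV.
  by rewrite /L asboolT.
have D2 w : V2 w -> iscder L w (cD L2 w).
  move=> v2; have [r r0 rP] := (proj1 (openCP V2) oV2) w v2.
  apply: (iscder_near r0 _ (iscderD (h2 w (proj1 v2)))) => v /rP vV.
  by rewrite /L asboolF// => v1; exact: nn (proj2 v1) (proj2 vV).
exists L; split=> [w [/D1|/D2] /iscder_der//|w Kw].
have [v1|v2] := KV w Kw.
  rewrite (cD_eq (D1 w v1)); apply: k1; split => // v2; exact: nn (proj2 v1) (proj2 v2).
rewrite (cD_eq (D2 w v2)); apply: k2; split => // v1; exact: nn (proj2 v1) (proj2 v2).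
Qed.

Lemma chint_bound (s : seq (edge R)) : exists2 T : R, 0 <= T & forall f g (e : R), 0 <= e ->
  (forall x, List.In x s -> elo x <= ehi x) ->
  (forall x w, List.In x s -> on_edge x w -> [/\ ctn f w, ctn g w & nm (f w - g w) <= e]) ->
  nm (chint s f - chint s g) <= T * e.
Proof.
elim: s => [|x s [T T0 IH]].
  by exists 0 => // f g e e0 _ _; rewrite /chint !big_nil subrr nm0 mul0r.
pose S := nm (ecoef x) * (nm (edir x) * 2 * `|ehi x - elo x|).
exists (S + T); first by rewrite addr_ge0// !mulr_ge0// nm_ge0.
move=> f g e e0 le H; rewrite /chint !big_cons.
have -> : eint f x + \sum_(e <- s) eint f e - (eint g x + \sum_(e <- s) eint g e) =
  (eint f x - eint g x) + (chint s f - chint s g) by rewrite /chint; ring.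
apply: (le_trans (nmD _ _)); rewrite mulrDl; apply: lerD; last first.
  by apply: IH => // [y ?|y w ?]; [apply: le|apply: H]; right.
have xin : List.In x (x :: s) by left.
have lex := le x xin.
have cf : scont f (epos x) (edir x) (elo x) (ehi x).
  by apply: scont_edge => w /(H x w xin)[].
have cg : scont g (epos x) (edir x) (elo x) (ehi x).
  by apply: scont_edge => w /(H x w xin)[].
rewrite /eint -mulrBr nmM -(sintB cf cg) /S -!mulrA [X in _ <= _ * X]mulrA ler_wpM2l ?nm_ge0//.
have cfg : scont (fun w => f w - g w) (epos x) (edir x) (elo x) (ehi x).
  by move=> t tx; exact: ctn_sub (cf t tx) (cg t tx).
have B t : elo x <= t <= ehi x -> nm (f (epos x + t%:C * edir x) - g (epos x + t%:C * edir x)) <= e.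
  by move=> tx; have [|] := H x (epos x + t%:C * edir x) xin; first by exists t.
apply: (le_trans (sint_bound lex cfg B)).
rewrite ger0_norm ?subr_ge0//.
by rewrite le_eqVlt; apply/orP; left; apply/eqP; ring.
Qed.

(* Were a in a hole W, the contour around E u W would have winding number 1 about a, while
   1/(w - a) is a limit of derivatives near E. *)
Lemma good_hole E W a : compact E -> good E a -> hole E W -> W a -> False.
Proof.
move=> cE [U [oU EU gU]] [oW bW WE cW] Wa.
have [d d0 dP] := compact_nbhd cE oU EU.
have d2 : 0 < d / 2 by rewrite divr_gt0.
pose O : set (Cplx R) := [set w | exists2 z, E z & nm (w - z) < d / 2].
have oO : open O.
  apply/openCP => w [z Ez wz]; exists (d / 2 - nm (w - z)); first by rewrite subr_gt0.
  move=> v vw; exists z => //; apply: (le_lt_trans (nm_tri v w z)).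
  by rewrite -ltrBrDr.
have EO : E `<=` O by move=> z Ez; exists z => //; rewrite subrr nm0.
(* F is the part of W away from E, compact inside W. A point of the chain near F would lie in W,
   contrary to the chain avoiding X; so every chain point is near a point of O, hence within d of E
   and in U. *)
pose X := W `|` E; pose F := X `\` O.
have bX : cbounded X by apply: cboundedU => //; exact: compact_cbounded.
have cF : compact F.
  apply: closed_cbounded_compact; last by apply: cboundedS bX => z [].
  by rewrite /F setDE; apply: closedI => //; exact: open_closedC.
have FW : F `<=` W by move=> z [[//|/EO]].
have [d' d'0 d'P] := compact_nbhd cF oW FW.
pose m := Num.min (d / 2) d'.
have m0 : 0 < m by rewrite lt_min d2.
have [s [s1 s2 s3]] := grid_chain bX m0.
have inU x w : List.In x s -> on_edge x w -> U w /\ w != a.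
  move=> xs xw; have [_ _ /(_ w xw)[nX [z Xz]]] := s1 x xs.
  rewrite lt_min => /andP[wz wz']; split; last first.
    by apply/negP => /eqP E1; apply: nX; rewrite E1; left.
  have [Oz|nOz] := pselect (O z); last first.
    by exfalso; apply: nX; left; apply: (d'P z w) => //; split.
  have [z' Ez' zz'] := Oz; apply: (dP z' w Ez'); apply: (le_lt_trans (nm_tri w z z')).
  by rewrite (splitr d) ltrD.
have les x : List.In x s -> elo x <= ehi x by move=> /s1[].
have [T T0 TP] := chint_bound s.
have ca w : w != a -> ctn (fun w => (w - a)^-1) w.
  move=> wa; have wa0 : w - a != 0 by rewrite subr_eq0.
  exact: (@ctn_inv _ (fun w => w - a) w wa0 (ctn_sub (ctn_id w) (ctn_cst a w))).
have key : chint s (fun w => (w - a)^-1) = kc R.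
  have := s3 (fun=> 1) a (or_introl Wa) (fun w _ _ _ => cder_cst 1 w).
  rewrite mulr1 => <-; congr chint; apply/funext => w; by rewrite mul1r.
pose K : set (Cplx R) := [set w | exists2 x, List.In x s & on_edge x w].
have cK : compact K.
  rewrite /K; elim: (s) => [|x l IH].
    suff -> : [set w : Cplx R | exists2 x, List.In x [::] & on_edge x w] = set0 by exact: compact0.
    by apply/seteqP; split => // w [].
  suff -> : [set w : Cplx R | exists2 y, List.In y (x :: l) & on_edge y w] =
    esupp x `|` [set w : Cplx R | exists2 y, List.In y l & on_edge y w].
    by apply: compactU => //; exact: esupp_compact.
  apply/seteqP; split=> w; first by move=> [y [<-|yl] yw]; [left|right; exists y].
  by move=> [xw|[y yl yw]]; [exists x => //; left|exists y => //; right].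
have KU : K `<=` U by move=> w [x xs /(inU x w xs)[]].
have k0 : 0 < nm (kc R) by rewrite nm_gt0 kc_neq0.
(* With this accuracy the two contour integrals, 0 and [kc], differ by at most half of |[kc]|. *)
have e0 : 0 < nm (kc R) / (T + 1) / 2 by rewrite !divr_gt0// ltr_wpDl.
have [L [hL LP]] := gU K cK KU _ e0.
have cL := deriv_cder oU hL.
have Z : chint s (cD L) = 0.
  apply: (s2 L) => x w xs xw; have [Uw _] := inU x w xs xw.
  by split; [exact: iscderD (hL w Uw)|exact: cder_ctn (cL w Uw)].
have := TP (cD L) (fun w => (w - a)^-1) _ (ltW e0) les.
rewrite Z key sub0r nmN => B.
have : nm (kc R) <= T * (nm (kc R) / (T + 1) / 2).
  apply: B => x w xs xw; have [Uw wa] := inU x w xs xw; split.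
  - exact: cder_ctn (cL w Uw).
  - exact: ca.
  - by apply: LP; exists x.
rewrite leNgt => /negP; apply.
have T1 : T / (T + 1) <= 1 by rewrite ler_pdivrMr ?ltr_wpDl// mul1r lerDl ler01.
have -> : T * (nm (kc R) / (T + 1) / 2) = (T / (T + 1)) * (nm (kc R) / 2) by rewrite !mulrA; congr (_ / _); rewrite mulrAC.
apply: (@le_lt_trans _ _ (nm (kc R) / 2)).
  by rewrite ger_pMl// divr_gt0.
by rewrite ltr_pdivrMr// ltr_pMr// ltr1n.
Qed.

Lemma hole_out E W a : hole E W -> W a -> ~ E a.
Proof. by move=> [_ _ WE _] Wa Ea; have : (W `&` E) a by []; rewrite WE. Qed.

Lemma set0_of W : (forall a, W a -> False) -> W = set0.
Proof. by move=> h; apply/seteqP; split => // a /h. Qed.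

Lemma full_union E1 E2 : compact E1 -> compact E2 -> E1 `&` E2 = set0 ->
  full E1 -> full E2 -> full (E1 `|` E2).
Proof.
move=> c1 c2 dis f1 f2 W hW; apply: set0_of => a Wa; have nE := hole_out hW Wa.
have n1 : ~ E1 a by move=> ?; apply: nE; left.
have n2 : ~ E2 a by move=> ?; apply: nE; right.
have gd := good_union c1 c2 dis (sep_good (full_sep c1 f1 n1)) (sep_good (full_sep c2 f2 n2)).
exact: good_hole (compactU c1 c2) gd hW Wa.
Qed.

(** A hole W of the hull becomes a hole of E once the part of the hull outside E is added to it. Its
    points off the hull are separated from E, hence good, which [good_hole] forbids. *)
Lemma hull_full E : compact E -> full (hull E).
Proof.
move=> cE W hW; apply: set0_of => a Wa.
have sa : sep E a by apply: contrapT => h; exact: hole_out hW Wa h.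
have [oW bW _ cW] := hW; have [oV bV VE _] := hull_hole cE.
have EH := @sub_hull R E.
have hVW : hole E (W `|` (hull E `\` E)).
  split; [exact: openU | exact: cboundedU | |].
  - apply: set0_of => z [[Wz|[_ nE]] Ez //]; exact: hole_out hW Wz (EH _ Ez).
  - by rewrite -setUA [_ `\` _ `|` _]setUC setDUK.
by apply: good_hole cE (sep_good sa) hVW _; left.
Qed.

End Fullness.

(** * Images under injective holomorphic maps, and hulls inside G *)

Section Images.
Variable R : realType.
Local Notation C := R[i].
Implicit Types (f g L : C -> C) (z w a : C) (E U W K G V : set (Cplx R)) (p q r : {poly R[i]}).

Lemma compact_image K f : compact K -> (forall z, K z -> ctn f z) -> compact (f @` K : set (Cplx R)).
Proof.
move=> cK cf; apply: (continuous_compact (f := f : Cplx R -> Cplx R)) => //.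
by apply: continuous_in_subspaceT => z /set_mem /cf.
Qed.

Lemma compact_bound K f : compact K -> (forall z, K z -> ctn f z) ->
  exists2 M : R, 0 <= M & forall z, K z -> nm (f z) <= M.
Proof.
move=> cK cf; have [M MP] := compact_cbounded (compact_image cK cf).
exists (Num.max M 0); first by rewrite le_max lexx orbT.
by move=> z Kz; rewrite le_max (MP (f z))//; exists z.
Qed.

Section Injective.
Variables (G : set (Cplx R)) (phi : C -> C).
Hypothesis oG : open G.
Hypothesis hphi : forall z, G z -> cder phi z.
Hypothesis iphi : forall z w, G z -> G w -> phi z = phi w -> z = w.

Lemma inj_image_open V : open V -> V `<=` G -> open (phi @` V : set (Cplx R)).
Proof.
move=> oV VG; apply/openCP => _ [z Vz <-].
have [e e0 [psi psiP]] := inj_inverse oV (fun z Vz => hphi (VG z Vz))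
  (fun z w Vz Vw => iphi (VG z Vz) (VG w Vw)) Vz.
by exists e => // w /psiP[h1 h2 _]; exists (psi w).
Qed.

(** By injectivity the set-theoretic inverse coincides near each value with the differentiable local
    inverse. *)
Lemma inj_global_inverse : exists psi : C -> C, (forall z, G z -> psi (phi z) = z) /\
  forall z, G z -> cder psi (phi z).
Proof.
pose psi w := if pselect (exists2 z, G z & phi z = w) is left h then s2val (cid2 h) else 0.
have psiK z : G z -> psi (phi z) = z.
  move=> Gz; rewrite /psi; case: pselect => [h|]; last by move=> h; exfalso; apply: h; exists z.
  by apply: iphi => //; case: (cid2 h).
exists psi; split; [exact: psiK|move=> z Gz].
have [e e0 [chi chiP]] := inj_inverse oG hphi iphi Gz.
have [|_ _ cchi] := chiP (phi z); first by rewrite subrr nm0.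
apply: (cder_near e0 _ cchi) => w /chiP[h1 h2 _].
by rewrite -{2}h2 psiK.
Qed.

(* A hole W of phi(K) lies in phi(G): if it contained a value a that phi omits, Runge's theorem
   for phi' / (phi - a) and a primitive of the approximating polynomial, composed with the
   inverse of phi, would make a good.  So the inverse of phi maps W onto a hole of K. *)
Lemma full_image K K' V : compact K -> full K -> compact K' -> full K' ->
  open V -> K `<=` V -> V `<=` K' -> K' `<=` G -> full (phi @` K).
Proof.
move=> cK fK cK' fK' oV KV VK' K'G W hW.
have [psi [psiK hpsi]] := inj_global_inverse.
have KG : K `<=` G by move=> z /KV/VK'/K'G.
have cpK : compact (phi @` K : set (Cplx R)).
  by apply: compact_image => // z /KG/hphi/cder_ctn.
have WG a : W a -> exists2 z, G z & phi z = a.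
  move=> Wa; apply: contrapT => nG.
  have ne z : G z -> phi z - a != 0.
    by move=> Gz; rewrite subr_eq0; apply/negP => /eqP E; apply: nG; exists z.
  pose h z := cD phi z / (phi z - a).
  have hh z : G z -> cder h z.
    move=> Gz; exact: (cder_mul (deriv_cder oG hphi Gz)
      (@cder_inv _ (fun z => phi z - a) z (ne z Gz) (cder_sub (hphi Gz) (cder_cst a z)))).
  (* The approximation is needed on K' rather than on K, since goodness asks for it on the open
     neighbourhood phi(V) of phi(K). *)
  have ah := runge cK' fK' oG K'G hh.
  apply: (good_hole cpK _ hW Wa).
  have VG : V `<=` G by move=> z /VK'/K'G.
  exists (phi @` V); split; [exact: inj_image_open | by move=> _ [z /KV Vz <-]; exists z |].
  move=> Q cQ QV e e0.
  have oU : open (phi @` G : set (Cplx R)) by exact: inj_image_open.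
  have hpsi' w : (phi @` G) w -> cder psi w by move=> [z Gz <-]; exact: hpsi.
  have cdpsi := deriv_cder oU hpsi'.
  have QG w : Q w -> (phi @` G) w by move=> /QV[z /VG Gz <-]; exists z.
  (* The derivative of A o psi is (p o psi) psi', and by the chain rule 1 / (w - a) is (h o psi)
     psi'; the error of p is thus multiplied by |psi'|, bounded by M on Q. *)
  have [M M0 MP] := compact_bound cQ (fun w Qw => cder_ctn (cdpsi w (QG w Qw))).
  have M1 : 0 < M + 1 by rewrite ltr_wpDl.
  have [p pP] := ah _ (divr_gt0 e0 M1); have [A AE] := poly_antideriv p.
  have DL w : (phi @` G) w -> iscder (fun w => A.[psi w]) w (p.[psi w] * cD psi w).
    move=> Gw; rewrite -AE; exact: (iscder_comp (iscderD (hpsi' w Gw)) (iscder_horner A (psi w))).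
  exists (fun w => A.[psi w]); split=> [w [z /VG Gz <-]|w Qw].
    by apply: iscder_der (DL _ _); exists z.
  rewrite (cD_eq (DL w (QG w Qw))).
  have [z Vz zw] := QV w Qw; have Gz := VG z Vz.
  have psiw : psi w = z by rewrite -zw psiK.
  have one : cD phi z * cD psi w = 1.
    have D1 : iscder (fun v => phi (psi v)) w (cD phi z * cD psi w).
      apply: (iscder_comp (iscderD (hpsi' w (QG w Qw)))).
      by rewrite psiw; exact: iscderD (hphi Gz).
    have [r r0 rP] := (proj1 (openCP _) oU) w (QG w Qw).
    apply: iscder_unique (iscder_near r0 _ D1) (iscder_id w) => v /rP[u Gu <-].
    by rewrite psiK.
  have wE : (w - a)^-1 = h z * cD psi w.
    by rewrite /h zw mulrAC one mul1r.
  rewrite psiw wE -mulrBl nmM -nmN opprB.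
  apply: (@le_trans _ _ (e / (M + 1) * M)).
    by apply: ler_pM; rewrite ?nm_ge0 ?pP ?MP//; exact: VK'.
  by rewrite mulrAC ler_pdivrMr// ler_pM2l// lerDl ler01.
pose V' : set (Cplx R) := psi @` W.
have V'G : V' `<=` G by move=> _ [w /WG[z Gz <-] <-]; rewrite psiK.
have [oW bW WE cW] := hW.
have cWE : compact (W `|` phi @` K).
  by apply: closed_cbounded_compact => //; apply: cboundedU => //; exact: compact_cbounded.
have V'E : V' = [set z | G z /\ W (phi z)].
  apply/seteqP; split=> [_ [w Ww <-]|z [Gz Wz]].
    by have [z Gz zw] := WG w Ww; rewrite -zw psiK//= zw.
  by exists (phi z) => //; rewrite psiK.
have V'K : V' `|` K = psi @` (W `|` phi @` K).
  apply/seteqP; split=> [z [[w Ww <-]|Kz]|_ [w [Ww|[z Kz <-]] <-]].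
  - by exists w => //; left.
  - by exists (phi z); [right; exists z|rewrite psiK//; exact: KG].
  - by left; exists w.
  - by right; rewrite psiK//; exact: KG.
have cV'K : compact (V' `|` K).
  rewrite V'K; apply: compact_image => // w [/WG[z Gz <-]|[z /KG Gz <-]]; exact/cder_ctn/hpsi.
suff V'0 : V' = set0.
  by apply: set0_of => w Ww; have : V' (psi w) by [exists w]; rewrite V'0.
apply: fK; split.
- rewrite V'E; apply/openCP => z [Gz Wz].
  have [d1 d10 d1P] := (proj1 (openCP G) oG) z Gz.
  have [d2 d20 d2P] := (proj1 (openCP W) oW) (phi z) Wz.
  have /ctnP/(_ _ d20)[d3 d30 d3P] := cder_ctn (hphi Gz).
  exists (Num.min d1 d3); first by rewrite lt_min d10.
  by move=> w; rewrite lt_min => /andP[/d1P Gw /d3P/d2P].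
- by apply: cboundedS (compact_cbounded cV'K) => z; left.
- apply: set0_of => z []; rewrite V'E => -[Gz Wz] Kz.
  by apply: (hole_out hW Wz); exists z.
- exact: compact_cclosed.
Qed.

End Injective.

(* If the hull of K left G, then hull K \ G would be clopen in the complement of G in the sphere
   without containing infinity. *)
Lemma hull_sub G K : open G -> simply_connected G -> compact K -> K `<=` G -> hull K `<=` G.
Proof.
move=> oG sc cK KG z hz; apply: contrapT => nGz.
have nK : ~ K z by move=> /KG.
pose V : set (Cplx R) := hull K `\` K.
pose A : set (one_point_compactification (Cplx R)) := ~` (Some @` G).
pose S (Q : set (Cplx R)) : set (one_point_compactification (Cplx R)) := Some @` Q.
have clH : closed (S (hull K)).
  rewrite -openC openE => -[x|] /= nx.
    have nHx : (~` hull K) x by move=> Hx; apply: nx; exists x.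
    have /openCP oH := closed_openC (@hull_cclosed R K).
    have [d d0 dP] := oH x nHx.
    rewrite /interior /=; apply/nbhsCP; exists d => // w wx [v Hv [vw]].
    by apply: (dP w wx); rewrite -vw.
  exists (hull K); first by split; [exact: hull_compact|exact: hull_cclosed].
  by move=> _ [[x nHx <-]|->] [v Hv] //= [vx]; apply: nHx; rewrite -vx.
have BA : A `&` S V = A.
  apply: (sc (A `&` S V)).
  - by exists (Some z); split; [move=> [v Gv [vz]]; apply: nGz; rewrite -vz|exists z].
  - exists (S V) => //; apply: one_point_compactification_open_some.
    exact: outside_hull_open (compact_cclosed cK).
  - exists (S (hull K)) => //; apply/seteqP; split=> x [Ax [v Hv vx]]; split => //; exists v => //.
      by case: Hv.
    by split => // Kv; apply: Ax; exists v => //; exact: KG.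
have : A None by move=> [v].
by rewrite -BA => -[_ [v]].
Qed.

End Images.

(** * Approximation on finitely many disjoint full sets *)

Section SimultaneousApproximation.
Variable R : realType.
Local Notation C := R[i].
Implicit Types (f g : C -> C) (z w a : C) (E U W K G V : set (Cplx R)) (p q r : {poly R[i]}).

Lemma glue_cder (U1 U2 : set (Cplx R)) f1 f2 : open U1 -> open U2 -> (forall w, U1 w -> U2 w -> False) ->
  exists g, (forall w, U1 w -> g w = f1 w) /\ (forall w, U2 w -> g w = f2 w) /\
   forall (w : C), (U1 w -> cder f1 w) -> (U2 w -> cder f2 w) -> U1 w \/ U2 w -> cder g w.
Proof.
move=> oU1 oU2 dis; pose g w := if `[< U1 w >] then f1 w else f2 w.
have g1 w : U1 w -> g w = f1 w by move=> u; rewrite /g asboolT.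
have g2 w : U2 w -> g w = f2 w.
  by move=> u2; rewrite /g asboolF// => u1; exact: dis u1 u2.
exists g; split => //; split => // w d1 d2 [u1|u2].
  have [r r0 rP] := (proj1 (openCP U1) oU1) w u1.
  by apply: (cder_near r0 _ (d1 u1)) => v /rP /g1.
have [r r0 rP] := (proj1 (openCP U2) oU2) w u2.
by apply: (cder_near r0 _ (d2 u2)) => v /rP /g2.
Qed.

Lemma runge2 E1 E2 (U1 U2 : set (Cplx R)) f1 f2 (e : R) :
  compact E1 -> compact E2 -> E1 `&` E2 = set0 -> full E1 -> full E2 ->
  open U1 -> open U2 -> E1 `<=` U1 -> E2 `<=` U2 ->
  (forall z, U1 z -> cder f1 z) -> (forall z, U2 z -> cder f2 z) -> 0 < e ->
  exists p : {poly R[i]}, (forall z, E1 z -> nm (f1 z - p.[z]) <= e) /\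
    (forall z, E2 z -> nm (f2 z - p.[z]) <= e).
Proof.
move=> c1 c2 dis F1 F2 oU1 oU2 EU1 EU2 h1 h2 e0.
have [N1 [N2 [oO1 oO2 EO1 EO2 Odis]]] := disjoint_nbhds c1 c2 dis.
have oV1 : open (U1 `&` N1) by exact: openI.
have oV2 : open (U2 `&` N2) by exact: openI.
have Vdis w : (U1 `&` N1) w -> (U2 `&` N2) w -> False by move=> [_ u] [_]; exact: Odis.
have [g [g1 [g2 hg]]] := glue_cder f1 f2 oV1 oV2 Vdis.
have EV : E1 `|` E2 `<=` (U1 `&` N1) `|` (U2 `&` N2).
  by move=> z [Ez|Ez]; [left|right]; split; [exact: EU1|exact: EO1|exact: EU2|exact: EO2].
have [|p pP] := runge (f := g) (compactU c1 c2) (full_union c1 c2 dis F1 F2)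
  (openU oV1 oV2) EV _ e0.
  by move=> z Vz; apply: hg => // [[/h1]|[/h2]].
exists p; split=> z Ez.
  by rewrite -g1 ?pP//; [left|split; [exact: EU1|exact: EO1]].
by rewrite -g2 ?pP//; [right|split; [exact: EU2|exact: EO2]].
Qed.

Section Family.
Variables (I : eqType) (E U : I -> set (Cplx R)) (F : I -> C -> C).

Definition family_cover (L : set (Cplx R)) (s : seq I) := foldr (fun i S => E i `|` S) L s.

Lemma family_coverP L s w : family_cover L s w <-> L w \/ exists2 i, i \in s & E i w.
Proof.
elim: s => [|i s IH] /=; first by split; [left|case=> // -[]].
split=> [[Ei|/IH[Lw|[j js Ej]]]|[Lw|[j]]].
- by right; exists i; rewrite ?mem_head.
- by left.
- by right; exists j; rewrite // inE js orbT.
- by right; apply/IH; left.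
- by rewrite inE => /predU1P[->|js] Ej; [left|right; apply/IH; right; exists j].
Qed.

(** The sets are added one at a time. The polynomial found for the previous ones becomes the target
    on their union, each step using half of the error; compactness and fullness of the union are
    carried along for the next application of [runge2]. *)
Lemma family_approx L (s : seq I) (e : R) : compact L -> full L -> uniq s ->
  (forall i, i \in s -> [/\ compact (E i), full (E i), open (U i), E i `<=` U i &
     forall z, U i z -> cder (F i) z]) ->
  (forall i, i \in s -> forall w, L w -> E i w -> False) ->
  (forall i j, i \in s -> j \in s -> i != j -> forall w, E i w -> E j w -> False) ->
  0 < e ->
  [/\ compact (family_cover L s), full (family_cover L s) &
   exists p : {poly R[i]}, (forall z, L z -> nm p.[z] <= e) /\
    forall i, i \in s -> forall z, E i z -> nm (F i z - p.[z]) <= e].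
Proof.
move=> cL fL; elim: s e => [|i s IH] e /=.
  by move=> _ _ _ _ e0; split => //; exists 0; split=> // z _; rewrite horner0 nm0 ltW.
move=> /andP[nis us] hE hL hd e0.
have sub j : j \in s -> j \in i :: s by move=> js; rewrite inE js orbT.
have e2 : 0 < e / 2 by rewrite divr_gt0.
have [cS fS [p [pL pE]]] := IH _ us (fun j js => hE j (sub j js)) (fun j js => hL j (sub j js))
  (fun j k js ks => hd j k (sub j js) (sub k ks)) e2.
have iin : i \in i :: s by rewrite mem_head.
have [ci fi oUi EUi hF] := hE i iin.
have dis : E i `&` family_cover L s = set0.
  apply: set0_of => w [Eiw /family_coverP[Lw|[j js Ejw]]]; first exact: hL Lw Eiw.
  have ij : i != j by apply: contraNneq nis => ->.
  exact: hd iin (sub j js) ij w Eiw Ejw.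
split; [exact: compactU|exact: full_union|].
have [q [qE qS]] := runge2 ci cS dis fi fS oUi openT EUi (@subsetT _ _) hF
  (fun z _ => cder_horner p z) e2.
have small (a b c : C) : nm (a - b) <= e / 2 -> nm (b - c) <= e / 2 -> nm (a - c) <= e.
  by move=> h1 h2; apply: (le_trans (nm_tri a b c)); rewrite (splitr e) lerD.
exists q; split=> [z Lz|j].
  have Sz : family_cover L s z by apply/family_coverP; left.
  rewrite -nmN -sub0r; apply: (small _ p.[z]); last exact: qS.
  by rewrite sub0r nmN pL.
rewrite inE => /predU1P[->|js] z Ez.
  by apply: (le_trans (qE z Ez)); rewrite ler_pdivrMr// ler_pMr// ler1n.
apply: (small _ p.[z]); first exact: pE.
by apply: qS; apply/family_coverP; right; exists j.
Qed.

End Family.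

End SimultaneousApproximation.

(** The choice function is delivered in a sigma type, so that section-local definitions can refer to
    it through [sval]. *)
Lemma sig_choice (X Y : Type) (P : X -> Y -> Prop) :
  (forall x, exists y, P x y) -> {f : X -> Y | forall x, P x (f x)}.
Proof. by move=> /boolp.choice[f fP]; exists f. Qed.

(** * Simultaneous approximation on a locally finite family *)

Section Limits.
Variable R : realType.
Local Notation C := R[i].

(** The intervals of radius 2^-n about x_n are nested, since a step of 2^-(n+2) is less than 2^-n -
    2^-(n+1). *)
Lemma geometric_limit (x : nat -> R) m :
  (forall n, (m <= n)%N -> `|x n.+1 - x n| <= (1 / 2) ^+ n.+2) ->
  exists l, forall n, (m <= n)%N -> `|x n - l| <= (1 / 2) ^+ n.
Proof.
move=> h; pose u n : R := (1 / 2) ^+ n.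
have u0 n : 0 <= u n by rewrite exprn_ge0// divr_ge0.
have uS n : u n.+1 = u n / 2 by rewrite /u exprSr mul1r.
have h' n : (m <= n)%N -> x n - u n / 4 <= x n.+1 /\ x n.+1 <= x n + u n / 4.
  move=> /h; rewrite -/(u _) !uS ler_norml => /andP[h1 h2]; split; lra.
have [l lP] : exists l, forall n, x (m + n)%N - u (m + n)%N <= l <= x (m + n)%N + u (m + n)%N.
  apply: (@nested_point _ (fun n => x (m + n)%N - u (m + n)%N) (fun n => x (m + n)%N + u (m + n)%N)) => n.
  - have [] := h' _ (leq_addr n m); rewrite addnS uS; have := u0 (m + n)%N.
    by move: (u _) (x _) (x _) => *; lra.
  - have [] := h' _ (leq_addr n m); rewrite addnS uS; have := u0 (m + n)%N.
    by move: (u _) (x _) (x _) => *; lra.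
  - by have := u0 (m + n)%N; move: (u _) (x _) => *; lra.
exists l => n mn; have := lP (n - m)%N; rewrite subnKC// => /andP[h1 h2].
by rewrite ler_norml -/(u _); apply/andP; split; lra.
Qed.

Lemma geometric_climit (x : nat -> C) m :
  (forall n, (m <= n)%N -> nm (x n.+1 - x n) <= (1 / 2) ^+ n.+2) ->
  exists l, forall n, (m <= n)%N -> nm (x n - l) <= 2 * (1 / 2) ^+ n.
Proof.
move=> h.
have [a aP] : exists a, forall n, (m <= n)%N -> `|complex.Re (x n) - a| <= (1 / 2) ^+ n.
  by apply: geometric_limit => n /h; apply: le_trans; rewrite -creB nm_Re.
have [b bP] : exists b, forall n, (m <= n)%N -> `|complex.Im (x n) - b| <= (1 / 2) ^+ n.
  by apply: geometric_limit => n /h; apply: le_trans; rewrite -cimB nm_Im.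
exists (a +i* b) => n mn; apply: (le_trans (nm_ReIm _)).
by rewrite creB cimB mulrDl mul1r lerD ?aP ?bP.
Qed.

End Limits.

Section LocallyFiniteFamily.
Variable R : realType.
Local Notation C := R[i].
Implicit Types (f g : C -> C) (z w a : C) (p q r : {poly R[i]}).

Lemma full0 : full (set0 : set (Cplx R)).
Proof.
by move=> W [oW bW _]; rewrite setU0 => cW; exact: clopen_cbounded.
Qed.

Lemma family_cover_compact (I : eqType) (E : I -> set (Cplx R)) L (s : seq I) : compact L ->
  (forall i, i \in s -> compact (E i)) -> compact (family_cover E L s).
Proof.
move=> cL; elim: s => //= i s IH h; apply: compactU; first by apply: h; rewrite mem_head.
by apply: IH => j js; apply: h; rewrite inE js orbT.
Qed.

Variables (I : choiceType) (G : set (Cplx R)) (D : set I) (B U : I -> set (Cplx R)).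
Variables (T : I -> C -> C) (eps : I -> R) (K : nat -> set (Cplx R)).
Hypothesis oG : open G.
Hypothesis scG : simply_connected G.
Hypothesis cB : forall i, D i -> compact (B i).
Hypothesis fB : forall i, D i -> full (B i).
Hypothesis BG : forall i, D i -> B i `<=` G.
Hypothesis oU : forall i, D i -> open (U i).
Hypothesis BU : forall i, D i -> B i `<=` U i.
Hypothesis hT : forall i, D i -> forall z, U i z -> cder (T i) z.
Hypothesis eps0 : forall i, D i -> 0 < eps i.
Hypothesis disB : forall i j, D i -> D j -> i != j -> forall w, B i w -> B j w -> False.
Hypothesis finB : forall Q : set (Cplx R), compact Q -> Q `<=` G ->
  finite_set [set i | D i /\ exists2 w, Q w & B i w].
Hypothesis cK : forall j, compact (K j).
Hypothesis KG : forall j, K j `<=` G.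
Hypothesis KS : forall j, K j `<=` K j.+1.
Hypothesis exK : forall z, G z -> exists m, exists2 r : R, 0 < r & forall w, nm (w - z) < r -> K m w.

Let finB' (Q : set (Cplx R)) : compact Q -> Q `<=` G ->
  exists2 s : seq I, uniq s & forall i, i \in s <-> D i /\ exists2 w, Q w & B i w.
Proof.
move=> cQ QG; have /finite_seqP[s sE] := finB cQ QG.
exists (undup s); first exact: undup_uniq.
move=> i; rewrite mem_undup; split=> [si|h].
  by have : [set` s] i by []; rewrite -sE.
by have : [set` s] i by rewrite -sE.
Qed.

Let meet : {c : nat -> seq I | forall j i, i \in c j <-> D i /\ exists2 w, K j w & B i w}.
Proof.
apply: (@sig_choice nat (seq I) (fun j c => forall i, i \in c <-> D i /\ exists2 w, K j w & B i w)) => j.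
by have [s _ sP] := finB' (@cK j) (@KG j); exists s.
Qed.

Let core j := family_cover B (K j) (sval meet j).

Let coreP j w : core j w <-> K j w \/ exists i, [/\ D i, exists2 v, K j v & B i v & B i w].
Proof.
rewrite /core; split=> [/family_coverP[Kw|[i /(svalP meet)[Di Ki] Bw]]|h].
- by left.
- by right; exists i.
- apply/family_coverP; case: h => [Kw|[i [Di Ki Bw]]]; first by left.
  right; exists i => //.
  exact: (proj2 (svalP meet j i) (conj Di Ki)).
Qed.

Let c_core j : compact (core j).
Proof. by apply: family_cover_compact => // i /(svalP meet)[/cB]. Qed.

Let coreG j : core j `<=` G.
Proof. by move=> w /coreP[/KG//|[i [Di _ /(BG Di)]]]. Qed.

Let coreS j : core j `<=` core j.+1.
Proof.
move=> w /coreP[Kw|[i [Di [v Kv Bv] Bw]]]; apply/coreP; first by left; exact: KS.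
by right; exists i; split => //; exists v => //; exact: KS.
Qed.

(** Starting from the empty set makes every point of G enter at a well-defined step from [L j] to
    [L j.+1]. *)
Let L j := if j is j'.+1 then hull (core j') else set0.

Let cL j : compact (L j).
Proof. by case: j => [|j] /=; [exact: compact0|exact: hull_compact]. Qed.

Let fL j : full (L j).
Proof. by case: j => [|j] /=; [exact: full0|exact: hull_full]. Qed.

Let LG j : L j `<=` G.
Proof. by case: j => [|j] //=; exact: hull_sub. Qed.

Let LS j : L j `<=` L j.+1.
Proof. by case: j => [|j] //=; apply: hullS; exact: coreS. Qed.

Let Lmono j k : (j <= k)%N -> L j `<=` L k.
Proof.
by move=> /subnK <-; elim: (k - j)%N => // n IH w /IH /LS; rewrite addSn.
Qed.

Let KL j : K j `<=` L j.+1.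
Proof. by move=> w Kw; apply: sub_hull; apply/coreP; left. Qed.

(* B i either lies in the core or misses it; in the second case the part of B i in the hull is cut
   out by the open set hull \ core. *)
Let clopenB i j : D i -> closed (B i `&` L j) /\ closed (B i `\` L j).
Proof.
move=> Di; have clB := compact_cclosed (cB Di); have clL := compact_cclosed (@cL j).
split; first exact: closedI.
case: j clL => [|j] clL /=; first by rewrite setD0.
have [Bc|nBc] := pselect (B i `<=` core j).
  suff -> : B i `\` hull (core j) = set0 by exact: closed0.
  by apply: set0_of => w [/Bc/sub_hull].
have dis w : B i w -> core j w -> False.
  move=> Bw /coreP[Kw|[k [Dk Kk Bk]]].
    by apply: nBc => v Bv; apply/coreP; right; exists i; split => //; exists w.
  have [ik|/eqP ik] := eqVneq i k.
    by apply: nBc => v Bv; apply/coreP; right; exists i; split => //; rewrite ik.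
  by apply: (disB Di Dk _ Bw Bk); apply/eqP.
suff -> : B i `\` hull (core j) = B i `\` (hull (core j) `\` core j).
  rewrite setDE; apply: closedI => //; apply: open_closedC.
  exact: outside_hull_open (compact_cclosed (@c_core j)).
apply/seteqP; split=> w [Bw h]; split => //; first by move=> [].
by move=> Hw; apply: h; split => // /(dis w Bw).
Qed.

Let E j i := B i `&` (L j.+1 `\` L j).

Let E_closed j i : D i -> closed (E j i).
Proof.
move=> Di; have [_ h1] := clopenB j Di; have [h2 _] := clopenB j.+1 Di.
suff -> : E j i = (B i `&` L j.+1) `&` (B i `\` L j) by exact: closedI.
by apply/seteqP; split=> w; [move=> [Bw [h h']]|move=> [[Bw h] [_ h']]].
Qed.

Let E_compact j i : D i -> compact (E j i).
Proof. by move=> Di; apply: (@subclosed_compact _ _ (B i)); [exact: E_closed|exact: cB|move=> w []]. Qed.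

(** The rest of B i splits into the part in [L j] and the part outside [L j.+1], both closed, so
    [E j i] is clopen in the full set B i. *)
Let E_full j i : D i -> full (E j i).
Proof.
move=> Di; have [h1 _] := clopenB j Di; have [_ h2] := clopenB j.+1 Di.
apply: (@clopen_full _ _ ((B i `&` L j) `|` (B i `\` L j.+1))).
- exact: E_compact.
- suff -> : E j i `|` (B i `&` L j `|` B i `\` L j.+1) = B i by exact: fB.
  apply/seteqP; split=> w; first by move=> [[]|[[]|[]]].
  move=> Bw; have [l|l] := pselect (L j w); first by right; left.
  by have [l'|l'] := pselect (L j.+1 w); [left|right; right].
- exact: E_closed.
- exact: closedU.
- apply: set0_of => w [[Bw [l1 l2]] [[_ l3]|[_ l3]]]; [exact: l2 l3|exact: l3 l1].
- by apply: cboundedS (compact_cbounded (cB Di)) => w [[]|[]].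
Qed.

Let stage : {s : nat -> seq I | forall j, uniq (s j) /\
  forall i, i \in s j <-> D i /\ exists2 w, L j.+1 w & B i w}.
Proof.
apply: (@sig_choice nat (seq I) (fun j c => uniq c /\ forall i, i \in c <-> D i /\ exists2 w, L j.+1 w & B i w)) => j.
by have [s us sP] := finB' (@cL j.+1) (@LG j.+1); exists s.
Qed.

Let s j := sval stage j.

Let sP j i : i \in s j <-> D i /\ exists2 w, L j.+1 w & B i w.
Proof. exact: (svalP stage j).2. Qed.

Let tol : {e : nat -> R | forall j, 0 < e j /\ e j <= 1 /\ forall i, i \in s j -> e j <= eps i}.
Proof.
apply: (@sig_choice nat R (fun j e => 0 < e /\ e <= 1 /\ forall i, i \in s j -> e <= eps i)) => j.
have : forall i, i \in s j -> 0 < eps i by move=> i /sP[/eps0].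
elim: (s j) => [|i l IH] h; first by exists 1.
have [|e [e0 [e1 eP]]] := IH; first by move=> k kl; apply: h; rewrite inE kl orbT.
exists (Num.min e (eps i)); rewrite lt_min e0 h ?mem_head// ge_min e1; split => //; split => // k.
by rewrite inE ge_min => /predU1P[->|/eP ->//]; rewrite lexx orbT.
Qed.

(** A running minimum: a correction at stage k also disturbs the values prescribed at earlier
    stages, so it must respect the tolerances of all sets met up to then. *)
Let mu := fix mu j := if j is j'.+1 then Num.min (mu j') (sval tol j) else sval tol 0%N.

Let mu0 j : 0 < mu j.
Proof.
by elim: j => [|j IH] /=; [have [] := svalP tol 0%N|rewrite lt_min IH; have [] := svalP tol j.+1].
Qed.

Let mu_tol j : mu j <= sval tol j.
Proof. by case: j => [|j] /=; rewrite ?ge_min lexx ?orbT. Qed.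

Let mu1 j : mu j <= 1.
Proof. by apply: (le_trans (mu_tol j)); have [_ []] := svalP tol j. Qed.

Let mu_mono j k : (j <= k)%N -> mu k <= mu j.
Proof.
move=> /subnK <-; elim: (k - j)%N => // n; apply: le_trans.
by rewrite addSn /= ge_min lexx.
Qed.

Let mu_eps j k i : (j <= k)%N -> i \in s j -> mu k <= eps i.
Proof.
move=> jk ij; apply: (le_trans (mu_mono jk)); apply: (le_trans (mu_tol j)).
by have [_ [_]] := svalP tol j; apply.
Qed.

(** As [mu j] <= 1 this fits the step size of [geometric_climit], and the sum over all stages from j
    on stays below [eps i] for every i met at stage j. *)
Let eta j : R := mu j * (1 / 2) ^+ j.+2.

Let eta0 j : 0 < eta j.
Proof. by rewrite mulr_gt0// exprn_gt0// divr_gt0. Qed.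

Let correct : {h : nat -> {poly R[i]} -> {poly R[i]} | forall j (p : {poly R[i]}),
  (forall z, L j z -> nm (h j p).[z] <= eta j) /\
  forall i, i \in s j -> forall z, E j i z -> nm (T i z - p.[z] - (h j p).[z]) <= eta j}.
Proof.
suff H (q : nat * {poly R[i]}) : {h : {poly R[i]} |
  (forall z, L q.1 z -> nm h.[z] <= eta q.1) /\
  forall i, i \in s q.1 -> forall z, E q.1 i z -> nm (T i z - q.2.[z] - h.[z]) <= eta q.1}.
  by exists (fun j p => sval (H (j, p))) => j p; exact: (svalP (H (j, p))).
case: q => j p /=; apply: cid.
have [] := @family_approx R I (E j) U (fun i z => T i z - p.[z]) (L j) (s j) (eta j)
  (@cL j) (@fL j) (svalP stage j).1.
- move=> i /sP[Di _]; split; [exact: E_compact|exact: E_full|exact: oU|by move=> w []; move=> /(BU Di)|].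
  by move=> z Uz; exact: (cder_sub (hT Di Uz) (cder_horner p z)).
- by move=> i _ w Lw [_ []].
- by move=> i k /sP[Di _] /sP[Dk _] ik w [Bi _] [Bk _]; exact: disB ik w Bi Bk.
- exact: eta0.
- by move=> _ _.
Qed.

Let f_ := fix f_ j : {poly R[i]} := if j is j'.+1 then f_ j' + sval correct j' (f_ j') else 0.

Let f_S j : f_ j.+1 = f_ j + sval correct j (f_ j). Proof. by []. Qed.

Let f_step j k z : (j <= k)%N -> L j z -> nm ((f_ k.+1).[z] - (f_ k).[z]) <= eta k.
Proof.
move=> jk /(Lmono jk) Lz; rewrite f_S hornerD addrAC subrr add0r.
exact: (svalP correct k (f_ k)).1.
Qed.

(** The bound eps (1 - 2^-n) leaves the slack eps 2^-(n+1) for passing to n + 1, while the step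
    costs at most eps 2^-(n+2). *)
Let f_target j i z : i \in s j -> E j i z -> forall n, (j < n)%N ->
  nm ((f_ n).[z] - T i z) <= eps i * (1 - (1 / 2) ^+ n).
Proof.
move=> ij Ez; have [_ [Lz _]] := Ez.
have e0 : 0 < eps i by apply: eps0; case/sP: ij.
pose u n : R := (1 / 2) ^+ n.
have u0 n : 0 <= u n by rewrite exprn_ge0// divr_ge0.
have uS n : u n.+1 = u n / 2 by rewrite /u exprSr mul1r.
have u1 n : u n <= 1 by rewrite exprn_ile1 ?divr_ge0//; lra.
have eu k : (j <= k)%N -> eta k <= eps i * (u k / 4).
  move=> jk; have -> : u k / 4 = u k.+2 by rewrite !uS; lra.
  by rewrite /eta ler_wpM2r ?(mu_eps jk ij) ?exprn_ge0 ?divr_ge0.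
elim=> // n IH; rewrite ltnS leq_eqVlt => /predU1P[<-|jn].
  rewrite f_S hornerD -nmN opprB opprD addrA.
  apply: (le_trans ((svalP correct j (f_ j)).2 i ij z Ez)); apply: (le_trans (eu j (leqnn j))).
  rewrite ler_wpM2l ?(ltW e0)// -/(u _) uS; have := u1 j; have := u0 j; lra.
have -> : (f_ n.+1).[z] - T i z = ((f_ n.+1).[z] - (f_ n).[z]) + ((f_ n).[z] - T i z) by ring.
apply: (le_trans (nmD _ _)); apply: (le_trans (lerD (f_step jn Lz) (IH jn))).
apply: (le_trans (lerD (eu n (ltnW jn)) (lexx _))); rewrite -mulrDr ler_wpM2l ?(ltW e0)//.
rewrite -!/(u _) uS; have := u0 n; lra.
Qed.

Let limf : {f : C -> C | forall z j, L j z -> forall n, (j <= n)%N ->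
  nm ((f_ n).[z] - f z) <= 2 * (1 / 2) ^+ n}.
Proof.
apply: (@sig_choice C C (fun z l => forall j, L j z -> forall n, (j <= n)%N ->
  nm ((f_ n).[z] - l) <= 2 * (1 / 2) ^+ n)) => z.
have [[m Lm]|nL] := pselect (exists m, L m z); last first.
  by exists 0 => j Lj; exfalso; apply: nL; exists j.
(* The limit at z must be independent of j; the least stage containing z gives an estimate valid for
   all later ones. Outside all stages the value is set to 0. *)
have ex : exists m, `[< L m z >] by exists m; apply/asboolP.
case: (ex_minnP ex) => m0 /asboolP L0 m0min.
have [l lP] : exists l, forall n, (m0 <= n)%N -> nm ((f_ n).[z] - l) <= 2 * (1 / 2) ^+ n.
  apply: geometric_climit => n mn; apply: (le_trans (f_step mn L0)).
  by rewrite /eta ger_pMl ?mu1// exprn_gt0// divr_gt0.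
exists l => j Lj n jn; apply: lP; apply: leq_trans jn; apply: m0min; exact/asboolP.
Qed.

Theorem locally_finite_approx : exists f : C -> C, (forall z, G z -> cder f z) /\
  forall i, D i -> forall w, B i w -> nm (f w - T i w) <= eps i.
Proof.
pose f := sval limf; have fP := svalP limf.
have h01 : 0 <= (1 / 2 : R) < 1 by lra.
have two n (e : R) : 0 < e -> exists2 k, (n <= k)%N & 2 * (1 / 2) ^+ k <= e.
  move=> e0; have [k kP] := pow_small h01 (divr_gt0 e0 (ltr0n R 2)).
  exists (maxn n k); first exact: leq_maxl.
  rewrite mulrC -ler_pdivlMr//; apply: le_trans kP.
  by rewrite ler_wiXn2l ?leq_maxr//; lra.
exists f; split=> [z /exK[m [r r0 rP]]|i Di w Bw].
  apply: (weierstrass r0) => e e0; have [n mn ne] := two m.+1 e e0.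
  exists (fun w => (f_ n).[w]) => w /rP/KL Lw; split; first exact: cder_horner.
  by rewrite nm_sym; apply: (le_trans (fP w m.+1 Lw n mn)).
have [m [r r0 rP]] := exK (BG Di Bw).
have ex : exists m, `[< L m w >].
  by exists m.+1; apply/asboolP/KL/rP; rewrite subrr nm0.
(* The least stage containing w is not 0, as [L 0] is empty; it is some j + 1, and w lies in
   [E j i], where stage j prescribes the value. *)
case: (ex_minnP ex) => -[/asboolP//|j] /asboolP Lj jmin.
have Ew : E j i w.
  split => //; split => // Lw; have := jmin j; rewrite ltnn => h.
  by have : false by apply: h; apply/asboolP.
have ij : i \in s j by apply/sP; split => //; exists w.
have e0 := eps0 Di.
apply/ler_addgt0Pr => e e'0; have [n jn ne] := two j.+1 e e'0.
have -> : f w - T i w = (f w - (f_ n).[w]) + ((f_ n).[w] - T i w) by ring.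
apply: (le_trans (nmD _ _)); rewrite addrC; apply: lerD; last first.
  by rewrite nm_sym; apply: (le_trans (fP w j.+1 Lj n jn)).
apply: (le_trans (f_target ij Ew jn)); rewrite ger_pMr// lerBlDr lerDl exprn_ge0// divr_ge0//.
Qed.

End LocallyFiniteFamily.

(** * Polynomials with rational coefficients, densities and the topology of H(G) *)

Section RationalPolynomials.
Variable R : realType.

Definition rat_poly (s : seq (rat * rat)) : {poly R[i]} :=
  foldr (fun c p => p * 'X + (ratr c.1 +i* ratr c.2)%:P) 0 s.

Lemma ratr_approx (x e : R) : 0 < e -> exists q : rat, `|x - ratr q| <= e.
Proof.
move=> e0; have [|q] := @rat_in_itvoo R (x - e) (x + e); first by lra.
by rewrite in_itv /= => /andP[h1 h2]; exists q; rewrite ler_norml; apply/andP; split; lra.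
Qed.

Lemma rat_poly_dense (p : {poly R[i]}) (M e : R) : 0 < e ->
  exists s, forall z, nm z <= M -> nm (p.[z] - (rat_poly s).[z]) <= e.
Proof.
elim/poly_ind: p e => [|p c IH] e e0.
  by exists [::] => z _; rewrite /= subrr nm0 ltW.
have M0 : 0 < `|M| + 1 by rewrite ltr_wpDl.
have [s sP] := IH (e / 2 / (`|M| + 1)) (divr_gt0 (divr_gt0 e0 (ltr0n R 2)) M0).
have e4 : 0 < e / 4 by rewrite divr_gt0.
have [a aP] := ratr_approx (complex.Re c) e4.
have [b bP] := ratr_approx (complex.Im c) e4.
exists ((a, b) :: s) => z zM; rewrite /= !hornerMXaddC /=.
have -> : p.[z] * z + c - ((rat_poly s).[z] * z + (ratr a +i* ratr b)) =
  (p.[z] - (rat_poly s).[z]) * z + (c - (ratr a +i* ratr b)) by ring.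
apply: (le_trans (nmD _ _)); have -> : e = e / 2 + e / 2 by lra.
apply: lerD; last first.
  apply: (le_trans (nm_ReIm _)); rewrite creB cimB /=; lra.
rewrite nmM; apply: (@le_trans _ _ (e / 2 / (`|M| + 1) * (`|M| + 1))); last first.
  by rewrite divfK// gt_eqF.
apply: ler_pM; rewrite ?nm_ge0// ?sP//; apply: (le_trans zM).
by apply: (le_trans (ler_norm M)); rewrite lerDl.
Qed.

(** A code stands for a pair whose first component is ignored; this makes each polynomial occur
    infinitely often. *)
Definition enum_rat_poly (nu : nat) : {poly R[i]} :=
  rat_poly (if @choice.unpickle (nat * seq (rat * rat))%type nu is Some c then c.2 else [::]).

Lemma enum_rat_poly_frequent (s : seq (rat * rat)) N :
  exists2 nu, (N <= nu)%N & enum_rat_poly nu = rat_poly s.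
Proof.
pose k (m : 'I_N.+1) := choice.pickle (val m, s).
have ki : injective k.
  by move=> m m' h; apply: val_inj; exact: (congr1 fst (pcan_inj (@choice.pickleK _) h)).
(* N + 1 distinct codes cannot all lie below N. *)
have [m mN] : exists m, (N <= k m)%N.
  apply: contrapT => /forallNP h.
  have lt m : (k m < N)%N by rewrite ltnNge; apply/negP/h.
  have inj : injective (fun m => Ordinal (lt m)) by move=> x y [] /ki.
  by have := leq_card _ inj; rewrite !card_ord ltnn.
by exists (k m) => //; rewrite /enum_rat_poly /k choice.pickleK.
Qed.

End RationalPolynomials.

Section LowerDensity.
Variable R : realType.

Lemma lower_density_le (A S : set nat) : A `<=` S ->
  (lower_density R A <= lower_density R S)%E.
Proof.
move=> AS; rewrite /lower_density !limn_einf_lim.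
apply: lee_lim; [exact: is_cvg_einfs|exact: is_cvg_einfs|].
near=> n; rewrite /einfs; apply: le_ereal_inf_tmp => _ [m /= nm <-].
apply: le_trans (_ : (_ <= _)%E); first by apply: ereal_inf_lbound; exists m.
have fin (B : set nat) : finite_set (B `&` [set k | (1 <= k <= m)%N]).
  apply: (sub_finite_set _ (finite_II m.+1)) => k [_ /= /andP[_]]; by rewrite ltnS.
rewrite lee_fin ler_wpM2r ?invr_ge0// ler_nat; apply: fsubset_leq_card.
by apply/fsubsetP => k; rewrite !in_fset_set// !inE => -[/AS].
Unshelve. all: by end_near. Qed.

End LowerDensity.

(** * Neighbourhoods in H(G) *)

Section CompactOpenTopology.
Variables (R : realType) (G : domain R).

Lemma entourageCP (E : set (Cplx R * Cplx R)) : entourage E ->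
  exists2 e : R, 0 < e & forall v w : R[i], nm (w - v) < e -> E (v, w).
Proof.
rewrite -entourage_from_ballE => -[e /= e0 eE].
have ee : e = (complex.Re e)%:C by rewrite RRe_real// gtr0_real.
exists (complex.Re e); first by rewrite -ltcR -ee.
by move=> v w vw; apply: eE; rewrite -ball_normE /= ee ltc_nm nm_sym.
Qed.

Let near0 (f : G -> Cplx R) (x : set G * R) : set (G -> Cplx R) :=
  [set g | forall z, x.1 z -> nm (g z - f z) < x.2].

Let near_filter (f : G -> Cplx R) :
  Filter (filter_from [set x : set G * R | compact x.1 /\ 0 < x.2] (near0 f)).
Proof.
apply: filter_from_filter; first by exists (set0, 1); split => //=; exact: compact0.
move=> [Q e] [Q' e'] [/= cQ e0] [/= cQ' e'0]; exists (Q `|` Q', Num.min e e').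
  by split => /=; [exact: compactU|rewrite lt_min e0].
by move=> g gP; split=> z Qz; have := gP z; rewrite /= lt_min => h;
  have /andP[] := h ltac:(by [left|right]).
Qed.

(** The sets [near0] of functions uniformly close to [g0] on a compact set form a filter base. The
    filter converges to [g0] uniformly on compact sets, so it contains the open set that induces
    V. *)
Lemma hol_space_nbhs (V : set (hol_space G)) (g0 : hol_space G) : open V -> V g0 ->
  exists Q : set G, compact Q /\ exists2 e : R, 0 < e &
    forall g : hol_space G, (forall z, Q z -> nm (\val g z - \val g0 z) < e) -> V g.
Proof.
move=> [W oW <-] Wg0.
have FF := near_filter (\val g0).
have : {family compact, filter_from [set x : set G * R | compact x.1 /\ 0 < x.2]
  (near0 (\val g0)) --> (\val g0 : G -> Cplx R)}.
  apply/fam_cvgP => Q cQ P /uniform_nbhs[E [/entourageCP[e e0 eE] EP]].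
  by exists (Q, e) => //= g gP; apply: EP => z /gP; exact: eE.
have nO : nbhs (\val g0 : {family compact, G -> Cplx R}) W.
  by apply: open_nbhs_nbhs; split.
move=> /(_ _ nO)[[Q e] [/= cQ e0] QW]; exists Q; split => //; exists e => // g gP.
exact: QW.
Qed.

End CompactOpenTopology.

(** * Passage between the subtype G and the plane *)

Section Subtype.
Variables (R : realType) (G : domain R).

Definition inplane (X : set G) : set (Cplx R) := (fun z : G => \val z) @` X.

Definition ext (f : G -> Cplx R) : R[i] -> R[i] := valL_ (0 : Cplx R) f.

Lemma ext_val f (z : G) : ext f (\val z) = f z.
Proof. exact: (congr1 (@^~ z) (valLK (0 : Cplx R) f)). Qed.

Lemma inplaneG X : inplane X `<=` G.
Proof. by move=> _ [z _ <-]; exact: (set_mem (valP z)). Qed.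

Lemma domP z : domain_set G z -> exists z' : G, \val z' = z.
Proof. by move=> Gz; exists (SigSub (mem_set Gz)). Qed.

Lemma inplane_compact X : compact X -> compact (inplane X).
Proof.
move=> cX; apply: continuous_compact => //; apply: continuous_subspaceT.
exact: (@initial_continuous _ _ (fun z : G => \val z : Cplx R)).
Qed.

Lemma inplane_interior (X : set G) (z : G) : (interior X) z ->
  exists2 d : R, 0 < d & forall w, nm (w - \val z) < d -> inplane X w.
Proof.
move=> [_ [[W oW <-] /= Wz] WX].
have /openCP/(_ _ Wz)[d d0 dW] := oW.
have /openCP/(_ _ (set_mem (valP z)))[e e0 eG] := @domain_open R G.
exists (Num.min d e); first by rewrite lt_min d0.
move=> w; rewrite lt_min => /andP[/dW Ww /eG Gw].
exists (SigSub (mem_set Gw)) => //; exact: WX.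
Qed.

Lemma cder_ext f z : holomorphic f -> domain_set G z -> cder (ext f) z.
Proof. by move=> hf /domP[z' <-]; exact: hf. Qed.

Lemma holomorphic_restrict (F : R[i] -> R[i]) : (forall z, domain_set G z -> cder F z) ->
  holomorphic (fun z : G => F (\val z) : Cplx R).
Proof.
move=> hF z; have Gz : domain_set G (\val z) := set_mem (valP z).
have /openCP/(_ _ Gz)[d d0 dG] := @domain_open R G.
apply: (@cder_near _ F _ _ d d0) (hF _ Gz) => w /dG/domP[w' <-].
by rewrite -[RHS]/(ext _ _) ext_val.
Qed.

Section Exhaustion.
Variable K : nat -> set G.
Hypothesis exK : exhaustive K.

Lemma exhaustive_nbhs z : domain_set G z -> exists m, exists2 r : R, 0 < r &
  forall w, nm (w - z) < r -> inplane (K m) w.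
Proof.
case: exK => _ UK KS /domP[z' <-].
have [m _ Kz] : (\bigcup_nu K nu) z' by rewrite UK.
by exists m.+1; exact: inplane_interior (KS m _ Kz).
Qed.

Lemma exhaustiveS j : K j `<=` K j.+1.
Proof. by case: exK => _ _ KS z /KS/interior_subset. Qed.

Lemma exhaustive_mono j k : (j <= k)%N -> K j `<=` K k.
Proof.
by move=> /subnK <-; elim: (k - j)%N => // n IH z /IH /exhaustiveS; rewrite addSn.
Qed.

Lemma exhaustive_compact (Q : set (Cplx R)) : compact Q -> Q `<=` G ->
  exists m, Q `<=` inplane (K m).
Proof.
move=> /compact_near_coveringP cQ QG.
have : \forall m \near \oo, Q `<=` [set z | inplane (K m) z].
  apply: (cQ nat \oo (fun m z => inplane (K m) z)) => z /QG/exhaustive_nbhs[m [r r0 rK]].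
  exists ([set w | nm (w - z) < r], [set k | (m <= k)%N]); first split => /=.
  - by apply/nbhsCP; exists r.
  - by exists m.
  - by move=> [w k] [/= /rK[w' Kw <-] mk]; exists w' => //; exact: exhaustive_mono Kw.
by move=> [m _ h]; exists m; exact: h (leqnn m).
Qed.

End Exhaustion.

End Subtype.

(** * The frequently hypercyclic function *)

Lemma cder_poly_comp (R : realType) (p : {poly R[i]}) (g : R[i] -> R[i]) w :
  cder g w -> cder (fun z => p.[g z]) w.
Proof. by move=> hg; apply: (cder_comp hg (cder_horner p (g w))). Qed.

Theorem theorem2p6 (R : realType) (G : domain R)
    (G_sc : simply_connected G)
    (phi : nat -> hol_selfmap G)
    (phi_univ : forall n, (0 < n)%N -> injective (phi n))
    (phi_sfr : strongly_frequently_runaway (fun n => phi n : G -> G)) :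
  frequently_hypercyclic R (fun n => comp_op (phi n)).
Proof.
have [K [A [[exK cKc A0] [dA [_ tB] finB]]]] := phi_sfr.
have oG : open (G : set (Cplx R)) := @domain_open R G.
pose f n : R[i] -> R[i] := ext (fun z => \val (phi n z)).
have fE n (z : G) : f n (\val z) = \val (phi n z) by exact: ext_val.
have hf n z : domain_set G z -> cder (f n) z.
  by apply: cder_ext; exact: selfmap_hol.
have fG n z : domain_set G z -> domain_set G (f n z).
  by move=> /domP[z' <-]; rewrite fE; exact: (set_mem (valP (phi n z'))).
have injf n : (0 < n)%N -> forall z w, domain_set G z -> domain_set G w -> f n z = f n w -> z = w.
  move=> n0 _ _ /domP[z <-] /domP[w <-]; rewrite !fE => /val_inj zw.
  by rewrite (phi_univ n n0 _ _ zw).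
have [psi psiP] : {psi : nat -> R[i] -> R[i] | forall n, (0 < n)%N ->
    (forall z, domain_set G z -> psi n (f n z) = z) /\
    forall z, domain_set G z -> cder (psi n) (f n z)}.
  apply: (@sig_choice nat (R[i] -> R[i]) (fun n p => (0 < n)%N ->
    (forall z, domain_set G z -> p (f n z) = z) /\
    forall z, domain_set G z -> cder p (f n z))) => n.
  have [n0|n0] := pselect (0 < n)%N; last by exists id => /n0.
  by have [p pP] := inj_global_inverse oG (hf n) (injf n n0); exists p.
pose D : set (nat * nat)%type := [set p | A p.2 p.1].
have D0 p : D p -> (0 < p.1)%N by exact: A0.
have cK nu : compact (inplane (K nu)) by apply: inplane_compact; case: (cKc nu).
have fK nu : full (inplane (K nu)) by apply: connected_full => //; case: (cKc nu).
pose B (p : nat * nat) : set (Cplx R) := f p.1 @` inplane (K p.2).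
pose U (p : nat * nat) : set (Cplx R) := f p.1 @` (G : set (Cplx R)).
pose T (p : nat * nat) w := (enum_rat_poly R p.2).[psi p.1 w].
pose eps (p : nat * nat) : R := p.2.+1%:R^-1.
have BE p w : B p w -> exists2 z : G, K p.2 z & w = \val (phi p.1 z).
  by move=> [_ [z Kz <-] <-]; exists z => //; exact: fE.
have BU p : B p `<=` U p by move=> _ [z /inplaneG Gz <-]; exists z.
have cB p : compact (B p) by apply: compact_image => // z /inplaneG/(hf p.1); exact: cder_ctn.
have [F [hF FT]] : exists F : R[i] -> R[i], (forall z, domain_set G z -> cder F z) /\
    forall p, D p -> forall w, B p w -> nm (F w - T p w) <= eps p.
  apply: (@locally_finite_approx R _ G D B U T eps (fun nu => inplane (K nu)) oG G_sc).
  - by move=> p _; exact: cB.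
  - move=> p /D0 p0; rewrite /B.
    (* The next set of the exhaustion is a full compact neighbourhood of K_nu inside G, as
       [full_image] asks. *)
    apply: (@full_image R G (f p.1) oG (hf p.1) (injf p.1 p0) _ (inplane (K p.2.+1))
      (interior (inplane (K p.2.+1)))) => //.
    + exact: open_interior.
    + move=> _ [z Kz <-]; case: exK => _ _ /(_ _ _ Kz)/inplane_interior[d d0 dK].
      by apply/nbhsCP; exists d.
    + exact: interior_subset.
    + exact: inplaneG.
  - by move=> p _ _ [z /inplaneG Gz <-]; exact: fG.
  - by move=> p /D0 p0; exact (@inj_image_open R G (f p.1) (hf p.1) (injf p.1 p0) G oG (fun _ h => h)).
  - by move=> p _; exact: BU.
  - move=> p /D0 p0 _ [z Gz <-].
    exact: cder_poly_comp ((psiP p.1 p0).2 z Gz).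
  - by move=> p _; rewrite invr_gt0.
  - move=> p q Dp Dq /eqP pq w /BE[z Kz wz] /BE[z' Kz' wz']; apply: pq.
    apply: tB => //; exists (phi p.1 z); split; first by exists z.
    by exists z' => //; apply: val_inj; rewrite -wz -wz'.
  - move=> Q cQ QG; have [m mP] := exhaustive_compact exK cQ QG.
    apply: sub_finite_set (finB (K m) (cKc m).1) => p [Dp [w /mP[z Kz zw] /BE[z' Kz' wz']]].
    split => //; exists z; split => //; exists z' => //.
    by apply: val_inj; rewrite -wz'.
  - exact: cK.
  - by move=> j; exact: inplaneG.
  - by move=> j _ [z /(exhaustiveS exK) Kz <-]; exists z.
  - exact: exhaustive_nbhs.
exists (SigSub (mem_set (holomorphic_restrict hF)) : hol_space G).
move=> V oV [g0 Vg0]; have [Q [cQ [e e0 QV]]] := hol_space_nbhs oV Vg0.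
have [m Qm] := exhaustive_compact exK (inplane_compact cQ) (@inplaneG _ _ Q).
(* Three errors of e / 4 occur: g0 against p, p against the rational polynomial, and F o phi_n
   against the latter. Their sum is strictly below e. *)
have e4 : 0 < e / 4 by rewrite divr_gt0.
have [p pP] := runge (cK m) (fK m) oG (@inplaneG _ _ _)
  (fun z => cder_ext (set_mem (valP g0))) e4.
have [M MP] := compact_cbounded (cK m).
have [s sP] := rat_poly_dense p M e4.
have [N Ne] : exists N : nat, N.+1%:R^-1 <= e / 4.
  have := @archi_boundP R (e / 4)^-1; rewrite invr_ge0 ltW// => /(_ isT) h.
  exists (Num.bound (e / 4)^-1); rewrite -[leRHS]invrK lef_pV2 ?posrE ?invr_gt0//.
  by apply: (le_trans (ltW h)); rewrite ler_nat.
(* nu >= m gives K_m inside K_nu, and nu >= N gives 1 / (nu + 1) <= e / 4. *)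
have [nu nuN nus] := enum_rat_poly_frequent R s (maxn m N).
apply: (lt_le_trans (dA nu)); apply: lower_density_le => n An.
split; first exact: A0 An.
apply: QV => z Qz.
have [z' Kz' zz'] : inplane (K m) (\val z) by apply: Qm; exists z.
have Kz : inplane (K m) (\val z) by rewrite -zz'; exists z'.
have Gz : domain_set G (\val z) := set_mem (valP z).
have [psiK _] := psiP n (A0 _ _ An).
have Bw : B (n, nu) (f n (\val z)).
  exists (\val z) => //; exists z' => //.
  by apply: exhaustive_mono exK _ _ _ _ Kz'; exact: leq_trans (leq_maxl _ _) nuN.
have := FT (n, nu) An _ Bw; rewrite /T /= psiK// fE nus => h1.
have := sP _ (MP _ Kz); have := pP _ Kz; rewrite ext_val => h2 h3.
have h4 : eps (n, nu) <= e / 4.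
  apply: le_trans Ne; rewrite /eps /= lef_pV2 ?posrE// ler_nat ltnS.
  exact: leq_trans (leq_maxr _ _) nuN.
rewrite -[X in nm (X - _)]/(F (\val (phi n z))).
have -> : F (\val (phi n z)) - \val g0 z = (F (\val (phi n z)) - (rat_poly R s).[(\val z)]) -
  (p.[(\val z)] - (rat_poly R s).[(\val z)]) - (\val g0 z - p.[(\val z)]) by ring.
apply: (le_lt_trans (nmB _ _)); apply: (le_lt_trans (lerD (nmB _ _) (lexx _))).
by lra.
Qed.
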